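(* Let $m\ge 2$ and let $\{\kappa_n\}_{n=1}^\infty$ be a sequence of real numbers such that $\kappa_n=0$ for $n\ge m+1$. Let $$\varphi(z)=\kappa_1+\frac{\kappa_2}{z}+\dots+\frac{\kappa_m}{z^{m-1}},\qquad z\in\mathbb C\setminus\{0\},$$ and let $\Omega_\varphi$ be the component of $\{z\in\mathbb C^+:\operatorname{Im}(z+\varphi(z))>0\}$ which contains $\infty$. Then $\{\kappa_n\}_{n=1}^\infty$ is the sequence of free cumulants of some probability measure with compact support if and only if every Jordan curve, contained in $\mathbb C^+\cup\mathbb R$ and connecting $0$ and $\infty$, contains a point of the boundary of $\Omega_\varphi$.
   Context: $\mathbb C^+$ is the open upper half-plane. Probability measures are Borel probability measures on $\mathbb R$. The free cumulants $\kappa_n(\mu)$ of a compactly supported probability measure $\mu$ are the usual (Speicher) free cumulants. Equivalently, with $G_\mu(z)=\int_{\mathbb R}\frac{\mu(dt)}{z-t}$, $F_\mu=1/G_\mu$, and $F_\mu^{(-1)}$ the inverse of $F_\mu$ near $\infty$, one has $F_\mu^{(-1)}(z)-z=\sum_{n\ge1}\kappa_n(\mu)z^{-(n-1)}$ for large $|z|$.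
   Formalization: Assumes some κ_n ≠ 0 with 2 ≤ n ≤ m (for constant φ the claim fails: δ_{κ_1} exists, yet t ↦ it meets ∂Ω_φ only at 0), and the boundary point on the curve must differ from the end points 0, ∞ (else κ_2 = −1, other κ_n = 0 is a counterexample). *)

(* Defs.v *)
From HB Require Import structures.
From mathcomp Require Import all_boot all_order all_algebra.
From mathcomp Require Import all_classical all_reals all_analysis.
From mathcomp Require Import complex.

Set Implicit Arguments.
Unset Strict Implicit.
Unset Printing Implicit Defensive.

Import Order.TTheory GRing.Theory Num.Theory.
Import numFieldNormedType.Exports.

Local Open Scope ring_scope.

(* A crossing consists of i < j < k < l with i, k in one block and j, l in a
   different one. *)
Definition noncrossing (n : nat) (P : {set {set 'I_n}}) : bool :=
  [forall V in P, forall W in P, (V != W) ==>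
    ~~ [exists i in V, exists j in W, exists k in V, exists l in W,
          [&& (i < j)%N, (j < k)%N & (k < l)%N]]].

(* Speicher's moment-cumulant formula
     m_n(mu) = \sum_(P in NC(n)) \prod_(V in P) kappa_|V|,   n >= 1,
   whose term for the one-block partition is kappa_n, so that it determines
   kappa_n recursively.  Blocks are nonempty: kappa 0 plays no role. *)
Definition is_free_cumulants (R : realType)
    (mu : probability (measurableTypeR R) R) (kappa : nat -> R) : Prop :=
  forall n : nat, (0 < n)%N ->
    (\int[mu]_x (x ^+ n)%:E)%E =
    (\sum_(P : {set {set 'I_n}}
             | finset.partition P (finset.setTfor 'I_n) && noncrossing P)
       \prod_(V in P) kappa #|V|)%:E.

Local Open Scope classical_set_scope.

Definition compact_support (R : realType)
    (mu : probability (measurableTypeR R) R) : Prop :=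
  exists2 K : set R, compact K & mu (~` K) = 0%E.

Definition boundary (T : topologicalType) (A : set T) : set T :=
  closure A `\` interior A.

(* The complex plane is R[i]; its usual topology is carried by the alias
   R[i]^o. *)
Definition upper_half_plane (R : realType) : set R[i]^o :=
  [set z | 0 < complex.Im z].

(* kappa_1 + kappa_2 / z + ... + kappa_m / z ^ (m - 1) *)
Definition phi (R : realType) (m : nat) (kappa : nat -> R) (z : R[i]) : R[i] :=
  \sum_(1 <= n < m.+1) (kappa n)%:C%C / z ^+ n.-1.

Definition positive_region (R : realType) (f : R[i] -> R[i]) : set R[i]^o :=
  [set z | upper_half_plane z /\ 0 < complex.Im (z + f z)].

(* A subset of the upper half-plane "contains infinity" when it contains all
   points of the upper half-plane of sufficiently large modulus. *)
Definition contains_infty (R : realType) (A : set R[i]^o) : Prop :=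
  exists r : R, forall w : R[i]^o,
    upper_half_plane w -> r < Normc.normc w -> A w.

(* At most one component of the region contains infinity: this is the set of
   the points which lie in it. *)
Definition Omega (R : realType) (f : R[i] -> R[i]) : set R[i]^o :=
  [set z | contains_infty (connected_component (positive_region f) z)].

(* A simple arc of the Riemann sphere from 0 to infinity, inside the closed
   upper half-plane, with parameter t in [0, +oo]; the end at t = +oo is the
   point at infinity. *)
Definition jordan_curve_0_infty (R : realType) (g : R -> R[i]^o) : Prop :=
  [/\ {within `[0, +oo[, continuous g},
      {in `[0, +oo[ &, injective g},
      g 0 = 0,
      Normc.normc (g t) @[t --> +oo] --> +oo &
      forall t : R, 0 <= t -> 0 <= complex.Im (g t)].

(* The end points 0 and infinity are left out (t > 0): a curve starting from a
   point 0 in the closure of Omega, which is never in Omega, would otherwise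
   meet the boundary trivially. *)
Definition meets_boundary (R : realType) (g : R -> R[i]^o) (A : set R[i]^o) :
    Prop :=
  exists2 t : R, 0 < t & boundary A (g t).

(* Main.v *)
(** Put H(z) = z + phi(z).  Every measure considered has G = 1/F with
    H (F w) = w on the upper half-plane, by the functional equation of the
    R-transform, so everything turns on inverting H.

    If the Jordan curve condition holds, then H cannot take values on the
    imaginary axis at points of Omega near 0: since H(z) ~ kappa_p / z^(p-1)
    there, with kappa_p the last nonzero cumulant, the segment from 0 to such a
    point lies in Omega and extends inside Omega to infinity.  Hence H has no
    critical points in Omega, and is injective there (the pairs of distinct
    points with the same image form a clopen set, empty near infinity), and its
    inverse F is defined on the upper half-plane and bounded away from 0.  The
    measure is the limit of - Im (1 / F(x + i y)) / pi as y -> 0; its moments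
    are computed with an explicit primitive of w^n / F(w), and agree with the
    noncrossing sums by Lagrange inversion.

    Conversely, if the measure exists, its F is a right inverse of H with F w
    close to w at infinity, and F (H z) = z on all of Omega by connectedness.  A
    Jordan curve avoiding the boundary of Omega would stay inside Omega, and
    along it z -> 0 while H(z) -> infinity, so F (H z) -> infinity. *)
Require Import Defs.
From HB Require Import structures.
From mathcomp Require Import all_boot all_order all_algebra.
From mathcomp Require Import all_classical all_reals all_analysis.
From mathcomp Require Import measurable_realfun complex.
From mathcomp Require Import zify ring lra.

Set Implicit Arguments.
Unset Strict Implicit.
Unset Printing Implicit Defensive.

Import Order.TTheory GRing.Theory Num.Theory.
Import numFieldNormedType.Exports.

Local Open Scope ring_scope.

(** * Noncrossing partitions and the Raney array *)

(** Complex analysis is replaced by the algebra of H. The equation H(z) = w becomes a monic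
    polynomial equation in z with constant term [kappa p], which is not 0, and a point where a monic
    polynomial is small is close to a root. This yields the openness of H, limits of preimages, and
    the boundary values F(x + i0), whose candidates are finitely many roots. Critical points and
    coincidences H(z) = H(b) are treated at once, as zeros of the divided difference K(z, b) = (H(z)
    - H(b)) / (z - b). The imaginary axis suffices for injectivity because a clopen subset of Omega
    is empty as soon as it misses one point: take a point over i y with y beyond the values of H on
    the part of Omega away from 0 and infinity; the axis condition takes care of the part near 0.
    Holomorphy of the Cauchy transform enters only through Taylor expansions with explicit
    remainders: the functional equation holds for large |w| and reaches any w of the upper
    half-plane by one re-expansion, at a point i y so high that the disc of radius y around it
    contains w. *)

Definition cum1 (R : comNzRingType) (kappa : nat -> R) (n : nat) : R :=
  if n is 0 then 1 else kappa n.

(* With [g = v C(g)] the power series inverse of [u / C(u)], where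
   [C(u) = 1 + \sum_n kappa_n u^n], the entry [raney kappa n k] is the
   coefficient of [v^n] in [g^k]; the recursion reads [g^k+1 = v C(g) g^k]. *)
Fixpoint raney (R : comNzRingType) (kappa : nat -> R) (n k : nat) : R :=
  match n, k with
  | 0, 0 => 1
  | n'.+1, k'.+1 => \sum_(s < n'.+1) cum1 kappa s * raney kappa n' (k' + s)
  | _, _ => 0
  end.

Arguments raney : simpl never.

Section Raney.
Variables (R : comNzRingType) (kappa : nat -> R).

Lemma raneySS n k : raney kappa n.+1 k.+1 =
  \sum_(s < n.+1) cum1 kappa s * raney kappa n (k + s).
Proof. by []. Qed.

Lemma raney00 : raney kappa 0 0 = 1. Proof. by []. Qed.

Lemma raney0S k : raney kappa 0 k.+1 = 0. Proof. by []. Qed.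

Lemma raneyS0 n : raney kappa n.+1 0 = 0. Proof. by []. Qed.

Lemma raney_gt n k : (n < k)%N -> raney kappa n k = 0.
Proof.
elim: n k => [|n IHn] [|k] // nk.
by rewrite raneySS big1 // => s _; rewrite IHn ?mulr0 //; lia.
Qed.

(** The terms with [s > n] vanish by [raney_gt], so sums for different [n] can share a common range
    and be exchanged. *)
Lemma raneySS_ge M n k : (n < M)%N -> raney kappa n.+1 k.+1 =
  \sum_(s < M) cum1 kappa s * raney kappa n (k + s).
Proof.
move=> nM; rewrite raneySS (big_ord_widen M (fun s => cum1 kappa s * raney kappa n (k + s))) //.
rewrite big_mkcond; apply: eq_bigr => s _; case: ifP => // /negbT.
by rewrite -leqNgt => ns; rewrite raney_gt ?mulr0 //; lia.
Qed.

(** This is [g^(k+l) = g^k g^l]: the induction peels one factor [g = v C(g)] off [g^(k+1)] on both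
    sides. *)
Lemma raneyD n k l : raney kappa n (k + l) =
  \sum_(i < n.+1) raney kappa i k * raney kappa (n - i) l.
Proof.
elim: n k => [|n IHn] [|k].
- by rewrite big_ord1 mul1r.
- by rewrite big_ord1 mul0r.
- rewrite big_ord_recl mul1r big1 ?addr0 // => i _.
  by rewrite [raney _ (lift _ _) _]raneyS0 mul0r.
rewrite addSn (raneySS_ge _ (ltnSn n)) [RHS]big_ord_recl raney0S mul0r add0r.
under eq_bigr => s _ do rewrite addnAC IHn mulr_sumr.
rewrite exchange_big; apply: eq_bigr => i _.
rewrite subSS (@raneySS_ge n.+1) // mulr_suml.
by apply: eq_bigr => s _; rewrite mulrA addnC.
Qed.

End Raney.

(** * Weighted noncrossing partitions, one element at a time *)

Section NoncrossingSum.
Variables (R : comNzRingType) (kappa : nat -> R) (N : nat).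
Implicit Types (A U V W D : {set 'I_N}) (P : {set {set 'I_N}}) (d e : 'I_N).

Definition cross V W := [exists i in V, exists j in W, exists k in V, exists l in W,
          [&& (i < j)%N, (j < k)%N & (k < l)%N]].

Lemma crossP V W : reflect (exists i j k l : 'I_N, [/\ i \in V, j \in W, k \in V, l \in W &
  [/\ (i < j)%N, (j < k)%N & (k < l)%N]]) (cross V W).
Proof.
apply: (iffP idP).
  case/existsP=> i /andP[iV] /existsP[j] /andP[jW] /existsP[k] /andP[kV] /existsP[l] /andP[lW].
  by case/and3P=> ij jk kl; exists i, j, k, l.
case=> i [j] [k] [l] [iV jW kV lW [ij jk kl]].
apply/existsP; exists i; rewrite iV; apply/existsP; exists j; rewrite jW.
apply/existsP; exists k; rewrite kV; apply/existsP; exists l; rewrite lW.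
by rewrite ij jk kl.
Qed.

Definition nonx A P := forall V, V \in P -> ~~ cross A V /\ ~~ cross V A.

Lemma noncrossingP P : reflect
  (forall V W, V \in P -> W \in P -> V != W -> ~~ cross V W) (noncrossing P).
Proof.
apply: (iffP forall_inP) => h V.
  by move=> W VP WP VW; have /forall_inP/(_ W WP)/implyP/(_ VW) := h V VP.
by move=> VP; apply/forall_inP => W WP; apply/implyP => VW; exact: h.
Qed.

Lemma noncrossingU1 A P : A \notin P ->
  noncrossing (A |: P) <-> nonx A P /\ noncrossing P.
Proof.
move=> AP; split.
  move/noncrossingP => h; split.
    move=> V VP; have AV : A != V by apply: contraNneq AP => ->.
    by split; apply: h; rewrite ?setU11 ?setU1r // eq_sym.
  by apply/noncrossingP => V W VP WP; apply: h; rewrite setU1r.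
case=> hA /noncrossingP hP; apply/noncrossingP => V W.
rewrite !inE => /orP[/eqP->|VP] /orP[/eqP->|WP]; rewrite ?eqxx // => VW.
- by case: (hA W WP).
- by case: (hA V VP).
- exact: hP.
Qed.

Definition upset d : {set 'I_N} := [set x : 'I_N | (d <= x)%N].

Lemma partition_notin P D A : finset.partition P (D :\: A) -> A != finset.set0 -> A \notin P.
Proof.
move=> pP A0; apply/negP => AP.
have := partitionS pP AP; rewrite finset.subsetD => /andP[_].
by rewrite -setI_eq0 finset.setIid (negbTE A0).
Qed.

Lemma sub_part P D A V x : finset.partition P (D :\: A) -> V \in P -> x \in V ->
  (x \in D) && (x \notin A).
Proof.
move=> pP VP xV; have /fintype.subsetP/(_ x xV) := partitionS pP VP.
by rewrite !inE andbC.
Qed.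

Lemma big_partition_block d D (F : {set {set 'I_N}} -> R) : d \in D ->
  \sum_(P | finset.partition P D) F P =
  \sum_(A : {set 'I_N} | (A \subset D) && (d \in A))
     \sum_(P | finset.partition P (D :\: A)) F (A |: P).
Proof.
move=> dD; rewrite (partition_big (fun P => finset.pblock P d)
  (fun A : {set 'I_N} => (A \subset D) && (d \in A))) /=; last first.
  move=> P pP; rewrite mem_pblock (cover_partition pP) dD andbT.
  by apply/(partitionS pP)/pblock_mem; rewrite (cover_partition pP).
apply: eq_bigr => A /andP[AD dA].
have A0 : A != finset.set0 by apply/set0Pn; exists d.
rewrite (reindex_onto (fun P => A |: P) (fun P => P :\ A)) /=; last first.
  move=> P /andP[pP /eqP <-]; rewrite finset.setD1K //.
  by apply: pblock_mem; rewrite (cover_partition pP).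
apply: eq_bigl => P; apply/idP/idP.
  case/andP=> /andP[pP bA] /eqP PE.
  by rewrite -PE; apply: partitionD1 => //; rewrite setU11.
move=> pP; have nP := partition_notin pP A0.
have pU : finset.partition (A |: P) D.
  have -> : D = A :|: (D :\: A) by rewrite -{1}(finset.setID D A) (finset.setIidPr AD).
  apply: partitionU1 => //.
  by rewrite -setI_eq0 finset.setIDA finset.setDIl finset.setDv finset.set0I.
rewrite pU setU1K // eqxx andbT /=; apply/eqP.
by apply: def_pblock => //; [exact: partition_trivIset pU | rewrite setU11].
Qed.

(** [U] is a distinguished block whose own factor [kappa #|U|] is left out, because its content
    still changes in the recursion. *)
Definition ysum D U := \sum_(P | finset.partition P (D :\: U) && noncrossing (U |: P))
  \prod_(V in P) kappa #|V|.

Definition bsum d (s : nat) := \sum_(A : {set 'I_N} | [&& A \subset upset d, d \in A & #|A| == s]) ysum (upset d) A.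

Definition initial W U := [forall x in W, forall y in U :\: W, (x < y)%N].

Lemma initialP W U : reflect (forall x y, x \in W -> y \in U -> y \notin W -> (x < y)%N)
  (initial W U).
Proof.
apply: (iffP forall_inP) => h x.
  by move=> y xW yU yW; have /forall_inP/(_ y) := h x xW; rewrite !inE yU yW; exact.
by move=> xW; apply/forall_inP => y; rewrite !inE => /andP[yW yU]; exact: h.
Qed.

Lemma initial_ex U j : (j <= #|U|)%N ->
  exists2 W : {set 'I_N}, (W \subset U) && (#|W| == j) & initial W U.
Proof.
elim: j => [|j IHj] jU.
  exists finset.set0; first by rewrite finset.sub0set cards0 eqxx.
  by apply/initialP => x y; rewrite inE.
have [W /andP[WU /eqP Wj] /initialP iW] := IHj (ltnW jU).
have : (U :\: W) != finset.set0.
  rewrite -card_gt0 cardsD (finset.setIidPr WU); lia.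
case/set0Pn => z0 z0U.
case: (@arg_minnP 'I_N z0 (mem (U :\: W)) (@nat_of_ord N) z0U) => z zU zmin.
move: zU; rewrite /= !inE => /andP[zW zU].
exists (z |: W).
  by rewrite finset.subUset finset.sub1set zU WU cardsU1 zW Wj eqxx.
apply/initialP => x y; rewrite !inE negb_or => xW yU /andP[yz yW].
case/orP: xW => [/eqP ->|xW]; last exact: iW.
rewrite ltn_neqAle eq_sym; apply/andP; split; first by rewrite -val_eqE in yz.
by apply: zmin; rewrite /= !inE yW.
Qed.

Lemma initial_uniq U W W' : W \subset U -> W' \subset U -> #|W| = #|W'| ->
  initial W U -> initial W' U -> W = W'.
Proof.
move=> WU W'U cW /initialP iW /initialP iW'.
suff : (W \subset W') || (W' \subset W).
  case/orP => s; [|symmetry]; apply/eqP; by rewrite eqEcard s cW leqnn.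
apply: contraT; rewrite negb_or => /andP[/subsetPn[x xW xW'] /subsetPn[y yW' yW]].
have := iW _ _ xW (fintype.subsetP W'U _ yW') yW.
have := iW' _ _ yW' (fintype.subsetP WU _ xW) xW'.
lia.
Qed.

(** The [j] smallest elements of [U]; the default [set0] is not reached when [j <= #|U|]. *)
Definition firsts j U := odflt finset.set0 [pick W : {set 'I_N} | [&& W \subset U, #|W| == j & initial W U]].

Lemma firstsP j U : (j <= #|U|)%N ->
  [/\ firsts j U \subset U, #|firsts j U| = j & initial (firsts j U) U].
Proof.
move=> jU; rewrite /firsts; case: pickP => [W /and3P[? /eqP ? ?] //|h].
have [W /andP[WU Wj] iW] := initial_ex jU.
by have := h W; rewrite WU Wj iW.
Qed.

Section Step.
Variables (d e : 'I_N).
Hypothesis de : e = d.+1 :> nat.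

Lemma upsetS x : (x \in upset d) = (x == d) || (x \in upset e).
Proof. by rewrite !finset.inE de -val_eqE /= leq_eqVlt eq_sym. Qed.

Lemma memD x : x \in upset e -> (e <= x)%N /\ (d < x)%N.
Proof. by rewrite !finset.inE de => dx; rewrite dx. Qed.

Lemma merged_domain A W : d \in A -> upset d :\: A :\: W = upset e :\: ((A :\ d) :|: W).
Proof.
move=> dA; apply/setP => x; have := upsetS x.
rewrite !finset.inE; case: eqP => [->|_] /= ->; rewrite ?dA ?andbF //=.
  by rewrite de ltnn andbF.
by rewrite negb_or andbA (andbC (x \notin W)).
Qed.

(** Every block of [P] lies beyond [e]. A crossing of [A] that uses [d] can use [e] instead, and a
    crossing of the union with elements in both [A] and [W] can be moved inside one of them, by way
    of [d] or [e], because [W] precedes the rest of [A]. *)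
Lemma nonx_merge A W P : A \subset upset d -> d \in A -> W \subset upset d :\: A ->
  e \in A :|: W -> finset.partition P (upset d :\: A :\: W) ->
  (forall x y, x \in W -> y \in A -> y != d -> (x < y)%N) ->
  nonx ((A :\ d) :|: W) P <-> nonx A P /\ nonx W P.
Proof.
move=> AD dA WD eAW; rewrite merged_domain // => pP; set U := (A :\ d) :|: W => WA.
have eU : e \in U.
  by move: eAW; rewrite !finset.inE => /orP[->|->]; rewrite ?orbT // -val_eqE /= de neq_ltn ltnSn orbT.
have inP V x : V \in P -> x \in V -> (e < x)%N.
  move=> VP xV; have /andP[/memD[ex _] xU] := sub_part pP VP xV.
  by rewrite ltn_neqAle ex andbT; apply: contraNneq xU => /val_inj <-.
have AU x : x \in A -> (d < x)%N -> x \in U.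
  by move=> xA dx; rewrite !finset.inE xA -val_eqE andbT /= neq_ltn dx orbT.
have WU x : x \in W -> x \in U by rewrite !finset.inE => ->; rewrite orbT.
have dU x : x \in U -> x \in upset e.
  have /fintype.subsetP AD' := AD; have /fintype.subsetP WD' := WD.
  rewrite !finset.inE => /orP[/andP[xd /AD'] | /WD'].
    by have := upsetS x; rewrite !finset.inE (negbTE xd) => ->.
  rewrite !finset.inE => /andP[xA]; have := upsetS x.
  by rewrite !finset.inE => ->; case: eqP xA => // ->; rewrite dA.
split.
  move=> nx; split=> V VP; have [UV VU] := nx V VP; split; apply/negP => /crossP [i [j [k [l]]]].
  - case=> iA jV kA lV [ij jk kl]; move/negP: UV; apply; apply/crossP.
    have jd := inP V j VP jV.
    by exists e, j, k, l; split => //; apply: AU => //; apply: ltn_trans jk; apply: ltn_trans jd; rewrite de.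
  - case=> iV jA kV lA [ij jk kl]; move/negP: VU; apply; apply/crossP.
    have id := inP V i VP iV.
    have dj : (d < j)%N by apply: ltn_trans ij; apply: ltn_trans id; rewrite de.
    by exists i, j, k, l; split => //; apply: AU => //; apply: ltn_trans (ltn_trans jk kl).
  - case=> iA jV kA lV [ij jk kl]; move/negP: UV; apply; apply/crossP.
    by exists i, j, k, l; split => //; apply: WU.
  - case=> iA jV kA lV [ij jk kl]; move/negP: VU; apply; apply/crossP.
    by exists i, j, k, l; split => //; apply: WU.
case=> nA nW V VP; have [AV VA] := nA V VP; have [WV VW] := nW V VP.
have UE x : x \in U -> (x \in A) && (x != d) || (x \in W) by rewrite !finset.inE andbC.
split; apply/negP => /crossP [i [j [k [l]]]].
- case=> iU jV kU lV [ij jk kl].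
  case/orP: (UE k kU) => [/andP[kA kd]|kW].
    move/negP: AV; apply; apply/crossP; exists d, j, k, l; split => //; split => //.
    by apply: ltn_trans (inP V j VP jV); rewrite de.
  case/orP: (UE i iU) => [/andP[iA id]|iW]; first by have := ltn_trans (WA k i kW iA id) (ltn_trans ij jk); rewrite ltnn.
  by move/negP: WV; apply; apply/crossP; exists i, j, k, l.
- case=> iV jU kV lU [ij jk kl].
  case/orP: (UE j jU) => [/andP[jA jd]|jW].
    case/orP: (UE l lU) => [/andP[lA ld]|lW]; last by have := ltn_trans (WA l j lW jA jd) (ltn_trans jk kl); rewrite ltnn.
    by move/negP: VA; apply; apply/crossP; exists i, j, k, l.
  case/orP: (UE l lU) => [/andP[lA ld]|lW]; last first.
    by move/negP: VW; apply; apply/crossP; exists i, j, k, l.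
  have ei := inP V i VP iV.
  move: eAW; rewrite finset.inE => /orP[eA|eW].
    have ed : e != d by rewrite -val_eqE /= de neq_ltn ltnSn orbT.
    by have := ltn_trans (WA j e jW eA ed) (ltn_trans ei ij); rewrite ltnn.
  by move/negP: WV; apply; apply/crossP; exists e, i, j, k.
Qed.

Lemma noncrossing_mergeA A P : A \subset upset d -> d \in A -> e \in A ->
  finset.partition P (upset d :\: A) ->
  noncrossing (A |: P) = noncrossing ((A :\ d) |: P).
Proof.
move=> AD dA eA pP.
have pP0 : finset.partition P (upset d :\: A :\: finset.set0) by rewrite finset.setD0.
have := @nonx_merge A finset.set0 P AD dA (finset.sub0set _) _ pP0.
rewrite !finset.setU0 => /(_ eA) h.
have {}h := h (fun x y (H : x \in finset.set0) => ltac:(by rewrite finset.inE in H)).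
have AP : A \notin P by apply: partition_notin pP _; apply/set0Pn; exists d.
have UP : (A :\ d) \notin P.
  rewrite merged_domain // finset.setU0 in pP0.
  apply: partition_notin pP0 _; apply/set0Pn; exists e.
  by rewrite !finset.inE eA andbT -val_eqE /= de neq_ltn ltnSn orbT.
apply/idP/idP => /(noncrossingU1 _)[] // nA nP; apply/noncrossingU1 => //; split => //.
  by apply/h; split => // V _; split; apply/crossP => -[i [j [k [l]]]] [];
   rewrite ?finset.inE.
by case/h: nA.
Qed.

(** If some [y] in [A] other than [d] precedes some [x] in [W], then [d < e < y < x] is a crossing
    of [A] and [W]. So [W] must fit in the gap of [A] right after [d], that is, be initial in the
    merged block. *)
Lemma noncrossing_mergeW A W P : A \subset upset d -> d \in A -> W \subset upset d :\: A ->
  e \in W -> finset.partition P (upset d :\: A :\: W) ->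
  noncrossing (A |: (W |: P)) =
  noncrossing ((A :\ d) :|: W |: P) && initial W ((A :\ d) :|: W).
Proof.
move=> AD dA WD eW pP.
have pW : finset.partition (W |: P) (upset d :\: A).
  have -> : upset d :\: A = W :|: (upset d :\: A :\: W).
    by rewrite -{1}(finset.setID (upset d :\: A) W) (finset.setIidPr WD).
  apply: partitionU1 => //; first by apply/set0Pn; exists e.
  by rewrite -setI_eq0 finset.setIDA finset.setDIl finset.setDv finset.set0I.
have AW : A \notin W |: P by apply: partition_notin pW _; apply/set0Pn; exists d.
have WP : W \notin P by apply: partition_notin pP _; apply/set0Pn; exists e.
have UP : ((A :\ d) :|: W) \notin P.
  rewrite merged_domain // in pP.
  by apply: partition_notin pP _; apply/set0Pn; exists e; rewrite !finset.inE eW orbT.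
have AW0 x : x \in A -> x \in W -> False.
  by move=> xA /(fintype.subsetP WD); rewrite !finset.inE xA.
have eAW : e \in A :|: W by rewrite finset.inE eW orbT.
have WAP : initial W ((A :\ d) :|: W) <->
    (forall x y, x \in W -> y \in A -> y != d -> (x < y)%N).
  split=> [/initialP h x y xW yA yd|h].
    apply: h => //; first by rewrite !finset.inE yA yd.
    by apply/negP => /(AW0 _ yA).
  apply/initialP => x y xW; rewrite !finset.inE => /orP[/andP[yd yA] _|->//].
  exact: h.
apply/idP/andP.
  case/(noncrossingU1 AW) => nA /(noncrossingU1 WP) [nW nP].
  have [nAW nWA] := nA W (setU11 _ _).
  have h : initial W (A :\ d :|: W).
    apply/WAP => x y xW yA yd; rewrite ltnNge; apply/negP => yx.
    move/negP: nAW; apply; apply/crossP; exists d, e, y, x; split => //.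
    have yD := fintype.subsetP AD y yA; rewrite upsetS (negbTE yd) in yD.
    have [ey dy] := memD yD.
    split; first by rewrite de.
      by rewrite ltn_neqAle ey andbT; apply: contraTneq yA => /val_inj <-; apply/negP => /AW0; exact.
    by rewrite ltn_neqAle yx andbT; apply: contraTneq yA => /val_inj ->; apply/negP => /AW0; exact.
  split => //; apply/noncrossingU1 => //; split => //.
  apply/(nonx_merge AD dA WD eAW pP); first exact/WAP.
  by split => // V VP; apply: nA; rewrite setU1r.
case=> /(noncrossingU1 UP) [nU nP] /WAP h.
have [nA nW] := (nonx_merge AD dA WD eAW pP h).1 nU.
have WDe x : x \in W -> (d < x)%N.
  move=> /(fintype.subsetP WD); rewrite finset.inE upsetS => /andP[xA].
  by case: eqP xA => [->|_ _ /memD[]//]; rewrite dA.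
apply/noncrossingU1 => //; split; last by apply/noncrossingU1.
move=> V; rewrite !finset.inE => /orP[/eqP->|]; last exact: nA.
have hd y : y \in A -> (d < y)%N -> y != d by move=> _ dy; rewrite -val_eqE /= neq_ltn dy orbT.
split; apply/crossP => -[i [j [k [l]]]] [iA jW kA lW [ij jk kl]].
  have kd := hd _ kA (ltn_trans (WDe j jW) jk).
  by have := ltn_trans (h _ _ lW kA kd) kl; rewrite ltnn.
have jd := hd _ jW (ltn_trans (WDe i iA) ij).
by have := ltn_trans (h _ _ kA jW jd) jk; rewrite ltnn.
Qed.

Lemma ysum_drop A : A \subset upset d -> d \in A -> e \in A ->
  ysum (upset d) A = ysum (upset e) (A :\ d).
Proof.
move=> AD dA eA; apply: eq_bigl => P; have := @merged_domain A finset.set0 dA.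
rewrite finset.setD0 finset.setU0 => <-.
by case: (boolP (finset.partition _ _)) => //= pP; rewrite noncrossing_mergeA.
Qed.

Lemma ysum_merge A : A \subset upset d -> d \in A -> e \notin A ->
  ysum (upset d) A = \sum_(W : {set 'I_N} | [&& W \subset upset d :\: A, e \in W &
    initial W ((A :\ d) :|: W)]) kappa #|W| * ysum (upset e) ((A :\ d) :|: W).
Proof.
move=> AD dA eA; rewrite /ysum big_mkcondr (big_partition_block (d := e)); last first.
  by rewrite finset.inE eA upsetS finset.inE leqnn orbT.
under [RHS]eq_bigl => W do rewrite andbA.
rewrite [RHS]big_mkcondr; apply: eq_bigr => W /andP[WD eW].
have h P : finset.partition P (upset d :\: A :\: W) ->
    (if noncrossing (A |: (W |: P)) then \prod_(V in W |: P) kappa #|V| else 0) =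
    (if initial W (A :\ d :|: W) then
       (if noncrossing (A :\ d :|: W |: P) then kappa #|W| * \prod_(V in P) kappa #|V| else 0)
     else 0).
  move=> pP; have WP : W \notin P by apply: partition_notin pP _; apply/set0Pn; exists e.
  rewrite noncrossing_mergeW // big_setU1 //= andbC.
  by case: initial; case: noncrossing.
under eq_bigr => P pP do rewrite h //.
case: initial; last by rewrite big1.
rewrite mulr_sumr -merged_domain // -big_mkcondr.
by apply: eq_bigr => P _.
Qed.

Lemma merged_facts A W s : [&& A \subset upset d, d \in A & #|A| == s.+1] ->
  W \subset upset d :\: A -> e \in W -> let U := (A :\ d) :|: W in
  [/\ U \subset upset e, e \in U & #|U| = (s + #|W|)%N].
Proof.
case/and3P=> AD dA /eqP As WD eW U; split.
- apply/fintype.subsetP => x; rewrite !finset.inE => /orP[/andP[xd /(fintype.subsetP AD)]|].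
    by have := upsetS x; rewrite !finset.inE (negbTE xd) => ->.
  move=> /(fintype.subsetP WD); have := upsetS x; rewrite !finset.inE => -> /andP[].
  by case: eqP => // ->; rewrite dA.
- by rewrite !finset.inE eW orbT.
- rewrite /U cardsU; have -> : (A :\ d) :&: W = finset.set0.
    apply/setP => x; rewrite !finset.inE; apply/negbTE/negP => /andP[/andP[_ xA]].
    by move/(fintype.subsetP WD); rewrite !finset.inE xA.
  by rewrite cards0 subn0; have := cardsD1 d A; rewrite As dA add1n => -[<-].
Qed.

(** Remove [d] from its block [A]. If [e] is in [A], there remains a block of size [s] containing
    [e]: this is the term [j = 0]. Otherwise the block [W] of [e], of size [j > 0], is merged with
    [A :\ d] into a block of size [s + j], and its factor [kappa j] is paid. Since [W] consists of
    the first [j] elements of the merged block, nothing is lost. The result is the recursion of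
    [raney]. *)
Lemma bsumS s : bsum d s.+1 = \sum_(j < N.+1) cum1 kappa j * bsum e (s + j).
Proof.
have dDe U : U \subset upset e -> d \notin U.
  by move=> UD; apply/negP => /(fintype.subsetP UD); rewrite finset.inE de ltnn.
rewrite /bsum (bigID (fun A : {set 'I_N} => e \in A)) (bigD1 ord0) //=; congr (_ + _).
  rewrite mul1r addn0.
  rewrite (reindex_onto (fun U : {set 'I_N} => d |: U) (fun A => A :\ d)) /=; last first.
    by move=> A /andP[/and3P[_ dA _] _]; rewrite finset.setD1K.
  apply: eq_big => U; last first.
    by case/andP=> /andP[/and3P[AD dA _] eA] /eqP UE; rewrite ysum_drop // UE.
  apply/idP/idP.
    case/andP=> /andP[/and3P[AD dA /eqP As] eA] /eqP UE.
    have dU : d \notin U by rewrite -UE !finset.inE eqxx.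
    move: As; rewrite cardsU1 dU add1n => -[->]; rewrite eqxx andbT.
    apply/andP; split; last first.
      by move: eA; rewrite !finset.inE -val_eqE /= de (gtn_eqF (ltnSn d)).
    apply/fintype.subsetP => x xU; have /(fintype.subsetP AD) : x \in d |: U by rewrite setU1r.
    by rewrite upsetS; case: eqP xU => // ->; rewrite (negbTE dU).
  case/and3P=> UD eU /eqP Us; have dU := dDe U UD.
  rewrite setU1K // eqxx cardsU1 dU Us add1n eqxx setU11 setU1r // !andbT.
  apply/fintype.subsetP => x; rewrite upsetS finset.in_setU1 => /orP[->//|/(fintype.subsetP UD) ->].
  by rewrite orbT.
under eq_bigr => A /andP[/and3P[AD dA _] eA] do rewrite ysum_merge //.
under [RHS]eq_bigr => j _ do rewrite mulr_sumr.
rewrite !pair_big_dep /=.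
rewrite (reindex_onto
  (fun q : 'I_N.+1 * {set 'I_N} => (d |: (q.2 :\: firsts q.1 q.2), firsts q.1 q.2))
  (fun p => (inord #|p.2|, (p.1 :\ d) :|: p.2))) /=; last first.
  case=> A W /= /andP[/andP[cA eA] /and3P[WD eW iW]].
  have [UD eU cU] := merged_facts cA WD eW.
  rewrite inordK; last by rewrite ltnS (leq_trans (max_card _)) ?card_ord.
  have fW : firsts #|W| (A :\ d :|: W) = W.
    have [fU cf fi] := @firstsP #|W| (A :\ d :|: W) ltac:(by rewrite cU leq_addl).
    by apply: (@initial_uniq (A :\ d :|: W)); rewrite ?finset.subsetUr.
  rewrite fW; congr (_, _); have /and3P[_ dA _] := cA.
  apply/setP => x; rewrite !finset.inE; case: (eqVneq x d) => [->|xd] //=.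
  case: (boolP (x \in W)) => [/(fintype.subsetP WD)|xW]; last by rewrite orbF.
  by rewrite !finset.inE => /andP[/negbTE ->].
apply: eq_big => [[j U]|[j U]] /=; last first.
  case/andP=> /andP[/andP[cA eA] /and3P[WD eW iW]] /eqP[jE UE].
  have jW : nat_of_ord j = #|firsts j U|.
    by rewrite -[in LHS]jE inordK // ltnS (leq_trans (max_card _)) ?card_ord.
  have : (0 < j)%N by rewrite jW; apply/card_gt0P; exists e.
  by rewrite UE -jW; case: (nat_of_ord j).
apply/idP/idP.
  case/andP=> /andP[/andP[cA eA] /and3P[WD eW iW]] /eqP[jE UE].
  have [UD eU cU] := merged_facts cA WD eW.
  have jW : nat_of_ord j = #|firsts j U|.
    by rewrite -[in LHS]jE inordK // ltnS (leq_trans (max_card _)) ?card_ord.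
  rewrite UE in UD eU cU; rewrite UD eU cU -jW eqxx !andbT.
  by rewrite -val_eqE /= jW -lt0n; apply/card_gt0P; exists e.
case/andP=> j0 /and3P[UD eU /eqP cU].
have [fU cf fi] := @firstsP j U ltac:(by rewrite cU leq_addl).
set W := firsts j U in fU cf fi *.
have dU := dDe U UD.
have eW : e \in W.
  apply: contraT => eW; have /set0Pn[x xW] : W != finset.set0 by rewrite -finset.card_gt0 cf lt0n.
  have := initialP _ _ fi x e xW eU eW; have := fintype.subsetP UD x (fintype.subsetP fU x xW).
  by rewrite finset.inE leqNgt => /negbTE ->.
have UE : (d |: U :\: W) :\ d :|: W = U.
  rewrite setU1K; last by rewrite !finset.inE (negbTE dU) andbF.
  by rewrite finset.setUC -{1}(finset.setIidPr fU) finset.setID.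
rewrite UE cf fi inord_val !eqxx !andbT setU11 /= eW.
have -> : #|d |: U :\: W| = s.+1.
  rewrite cardsU1 !finset.inE (negbTE dU) andbF add1n cardsD (finset.setIidPr fU) cU cf.
  by rewrite addnK.
rewrite eqxx !finset.inE eW /= orbF andbT; apply/andP; split; first (apply/andP; split).
- apply/fintype.subsetP => x; rewrite upsetS !finset.inE => /orP[->//|/andP[_ /(fintype.subsetP UD)]].
  by rewrite !finset.inE => ->; rewrite orbT.
- by rewrite -val_eqE /= de neq_ltn ltnSn orbT.
rewrite andbT; apply/fintype.subsetP => x xW; have xU := fintype.subsetP UD x (fintype.subsetP fU x xW).
rewrite finset.inE upsetS xU orbT andbT !finset.inE xW orbF.
by apply: contraTneq xU => ->; rewrite finset.inE de ltnn.
Qed.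

End Step.


Lemma bsum0 d : bsum d 0 = 0.
Proof.
rewrite /bsum big1 // => A /and3P[_ dA]; rewrite finset.cards_eq0 => /eqP A0.
by rewrite A0 finset.inE in dA.
Qed.

Lemma bsum_last d s : N = d.+1 -> bsum d s = (s == 1)%:R.
Proof.
move=> Nd; have Dd : upset d = [set d]%SET.
  apply/setP => x; rewrite !finset.inE -val_eqE /=.
  have xd : (x <= d)%N by rewrite -ltnS -Nd ltn_ord.
  by rewrite eqn_leq xd.
rewrite /bsum Dd; have cE (A : {set 'I_N}) :
    [&& A \subset [set d]%SET, d \in A & #|A| == s] = (A == [set d]%SET) && (s == 1%N).
  rewrite finset.subset1; case: (eqVneq A [set d]%SET) => [->|_] /=.
    by rewrite finset.set11 cards1 eq_sym.
  by apply/negbTE/negP => /andP[/eqP ->]; rewrite finset.inE.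
rewrite (eq_bigl _ _ cE); case: eqP => _; last by rewrite big1 // => A; rewrite andbF.
under eq_bigl do rewrite andbT.
rewrite big_pred1_eq /ysum finset.setDv (big_pred1 finset.set0) ?big_set0 // => P.
rewrite partition_set0 /=; apply/andP/eqP => [[/eqP]//|->]; rewrite eqxx; split=> //.
apply/noncrossingU1; rewrite ?finset.inE //.
split; first by move=> V; rewrite finset.inE.
by apply/noncrossingP => V W; rewrite finset.inE.
Qed.

Lemma bsum_raney d s : bsum d s = raney kappa (N - d) s.
Proof.
move En : (N - d.+1)%N => n.
elim: n d s En => [|n IHn] d s En.
  have Nd : N = d.+1 by have := ltn_ord d; lia.
  rewrite bsum_last // [X in (X - _)%N]Nd subSnn; case: s => [|s]; first by rewrite raneyS0.
  by rewrite raneySS big_ord1 mul1r addn0; case: s.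
have eN : (d.+1 < N)%N by lia.
case: s => [|s]; first by rewrite bsum0 -(subnSK (ltn_ord d)) raneyS0.
rewrite (@bsumS d (Ordinal eN)) // -(subnSK (ltn_ord d)) (@raneySS_ge _ _ N.+1); last by lia.
by apply: eq_bigr => j _; rewrite IHn //=; lia.
Qed.

End NoncrossingSum.

(** Sort by the size [j] of the block of the least element: its factor [kappa j], absent from
    [bsum], turns [raney kappa n j] into a term of the recursion for [raney kappa n.+1 1]. *)
Lemma noncrossing_sum (R : comNzRingType) (kappa : nat -> R) (n : nat) : (0 < n)%N ->
  \sum_(P : {set {set 'I_n}}
             | finset.partition P (finset.setTfor 'I_n) && noncrossing P)
       \prod_(V in P) kappa #|V| = raney kappa n.+1 1.
Proof.
move=> n0; pose d := Ordinal n0.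
have DT : finset.setTfor 'I_n = upset d by apply/setP => x; rewrite !finset.inE.
rewrite DT big_mkcondr (big_partition_block (d := d)) ?finset.inE //.
rewrite raneySS (partition_big (fun A : {set 'I_n} => inord #|A| : 'I_n.+1) xpredT) //=.
apply: eq_bigr => j _; rewrite add0n.
have := bsum_raney kappa d j; rewrite subn0 => <-; rewrite /bsum.
rewrite mulr_sumr; apply: eq_big => [A|A].
  rewrite -andbA; congr (_ && (_ && _)); rewrite -val_eqE /= inordK //.
  by rewrite ltnS (leq_trans (max_card _)) ?card_ord.
case/andP=> /andP[AD dA] /eqP jE.
have jA : nat_of_ord j = #|A| by rewrite -jE inordK // ltnS (leq_trans (max_card _)) ?card_ord.
have cj : cum1 kappa j = kappa #|A|.
  have : (0 < #|A|)%N by apply/card_gt0P; exists d.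
  by rewrite jA; case: #|A|.
rewrite cj mulr_sumr -big_mkcondr; apply: eq_bigr => P /andP[pP nP].
have AP : A \notin P by apply: partition_notin pP _; apply/set0Pn; exists d.
by rewrite big_setU1.
Qed.

(** * Lagrange inversion *)

Section Lagrange.
Variables (R : numFieldType) (kappa : nat -> R) (p : nat).
Hypothesis kappa_eq0 : forall n, (p < n)%N -> kappa n = 0.

Definition cum_poly : {poly R} := \poly_(i < p.+1) cum1 kappa i.

Lemma coef_cum_poly i : cum_poly`_i = cum1 kappa i.
Proof.
rewrite coef_poly ltnS; case: leqP => // pi.
by case: i pi => // i pi; rewrite /= kappa_eq0.
Qed.

(** Lagrange's formula [n [v^n] g^k = k [u^(n-k)] C^n]. In the inductive step the recursion produces
    coefficients of [C C^(n+1)] with weights [k + i]; the weights [i] give [u C' C^(n+1)], which is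
    [u (C^(n+2))' / (n + 2)]. *)
Lemma raney_lagrange n k : (k <= n)%N ->
  n%:R * raney kappa n k = k%:R * (cum_poly ^+ n)`_(n - k).
Proof.
elim: n k => [|n IHn] [|k]; rewrite ?mul0r // ?raneyS0 ?mulr0 // ltnS => kn.
rewrite subSS; case: n => [|n] in IHn kn *.
  move: kn; rewrite leqn0 => /eqP ->.
  by rewrite raneySS big_ord1 expr1 coef_cum_poly raney00 !mulr1.
set C := cum_poly; have n0 : n.+1%:R != 0 :> R by rewrite pnatr_eq0.
have recE : n.+1%:R * raney kappa n.+2 k.+1 =
    \sum_(i < (n.+1 - k).+1) (k + i)%:R * (C`_i * (C ^+ n.+1)`_(n.+1 - k - i)).
  rewrite raneySS mulr_sumr.
  rewrite [RHS](big_ord_widen n.+2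
    (fun i => (k + i)%:R * (C`_i * (C ^+ n.+1)`_(n.+1 - k - i)))); last by lia.
  rewrite [RHS]big_mkcond; apply: eq_bigr => i _; rewrite mulrCA; case: ifP => ik.
    by rewrite IHn; [rewrite coef_cum_poly mulrCA subnDA|lia].
  by rewrite raney_gt ?mulr0 //; lia.
have dE : n.+2%:R * \sum_(i < (n.+1 - k).+1) i%:R * (C`_i * (C ^+ n.+1)`_(n.+1 - k - i)) =
    (n.+1 - k)%:R * (C ^+ n.+2)`_(n.+1 - k).
  have -> : \sum_(i < (n.+1 - k).+1) i%:R * (C`_i * (C ^+ n.+1)`_(n.+1 - k - i)) =
      ('X * C^`() * C ^+ n.+1)`_(n.+1 - k).
    rewrite coefM; apply: eq_bigr => i _; rewrite mulrA; congr (_ * _).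
    by rewrite coefXM; case: (i : nat) => [|j] /=; rewrite ?mul0r // coef_deriv mulr_natl.
  have -> : (n.+1 - k)%:R * (C ^+ n.+2)`_(n.+1 - k) = ('X * (C ^+ n.+2)^`())`_(n.+1 - k).
    by rewrite coefXM; case: (n.+1 - k)%N => [|j] /=; rewrite ?mul0r // coef_deriv mulr_natl.
  by rewrite deriv_exp /= mulr_natl -coefMn -mulrA mulrnAr.
apply: (mulfI n0); rewrite mulrCA recE.
under eq_bigr => i _ do rewrite natrD mulrDl.
rewrite big_split /= -mulr_sumr mulrDr dE -coefM -exprS.
by rewrite mulrA -mulrDl [RHS]mulrA natrB // !mulrS; congr (_ * _); ring.
Qed.

Lemma raney_lagrange1 n : n.+1%:R * raney kappa n.+1 1 = (cum_poly ^+ n.+1)`_n.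
Proof. by rewrite raney_lagrange // mul1r subn1. Qed.

End Lagrange.

(** * The topology of the complex plane *)

Local Open Scope classical_set_scope.

Notation normc := Normc.normc.
Arguments Normc.normc : simpl never.

Section ComplexNorm.
Variable R : realType.
Implicit Types (z w : R[i]) (x y : R).

Lemma normrC z : `|z| = (normc z)%:C%C. Proof. by case: z. Qed.

Lemma normc_ge0 z : 0 <= normc z.
Proof. by case: z => a b; exact: sqrtr_ge0. Qed.

Lemma normc0 : normc (0 : R[i]) = 0. Proof. exact: Normc.normc0. Qed.

Lemma normc1 : normc (1 : R[i]) = 1. Proof. exact: Normc.normc1. Qed.

Lemma normcM z w : normc (z * w) = normc z * normc w.
Proof. exact: Normc.normcM. Qed.

Lemma normcV z : normc z^-1 = (normc z)^-1.
Proof. exact: Normc.normcV. Qed.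

Lemma normcf_div z w : normc (z / w) = normc z / normc w.
Proof. by rewrite normcM normcV. Qed.

Lemma normcX z n : normc (z ^+ n) = normc z ^+ n.
Proof. by elim: n => [|n IH]; rewrite ?expr0 ?normc1 // !exprS normcM IH. Qed.

Lemma normc_eq0 z : (normc z == 0) = (z == 0).
Proof.
by apply/eqP/eqP => [/Normc.eq0_normc|->]; rewrite ?normc0.
Qed.

Lemma normc_gt0 z : (0 < normc z) = (z != 0).
Proof. by rewrite lt_def normc_ge0 andbT normc_eq0. Qed.

Lemma ler_normcD z w : normc (z + w) <= normc z + normc w.
Proof. exact: le_normcD. Qed.

Lemma normcNE z : normc (- z) = normc z. Proof. exact: normcN. Qed.

Lemma ler_normcB z w : normc (z - w) <= normc z + normc w.
Proof. by rewrite (le_trans (ler_normcD _ _)) ?normcNE. Qed.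

Lemma normc_distC z w : normc (z - w) = normc (w - z).
Proof. by rewrite -normcNE opprB. Qed.

Lemma lerB_normc z w : normc z - normc w <= normc (z - w).
Proof. by rewrite lerBlDr; have := ler_normcD (z - w) w; rewrite subrK. Qed.

Lemma lerB_normcD z w : normc z - normc w <= normc (z + w).
Proof. by rewrite -(normcNE w) -{2}(opprK w); exact: lerB_normc. Qed.

Lemma normc_real x : normc x%:C%C = `|x|.
Proof. by rewrite /normc /= expr0n /= addr0 sqrtr_sqr. Qed.

Lemma ler_normc_sum (I : Type) (r : seq I) (P : pred I) (F : I -> R[i]) :
  normc (\sum_(i <- r | P i) F i) <= \sum_(i <- r | P i) normc (F i).
Proof.
elim/big_ind2 : _ => //; first by rewrite normc0.
by move=> a b c d ab cd; rewrite (le_trans (ler_normcD _ _)) // lerD.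
Qed.

Lemma normcE_sqr z : normc z ^+ 2 = complex.Re z ^+ 2 + complex.Im z ^+ 2.
Proof. by case: z => a b; rewrite /normc sqr_sqrtr // addr_ge0 ?sqr_ge0. Qed.

Lemma ler_Re_normc z : `|complex.Re z| <= normc z.
Proof.
by rewrite -(ler_pXn2r (n := 2)) ?nnegrE ?normc_ge0 // normcE_sqr real_normK ?num_real // lerDl sqr_ge0.
Qed.

Lemma ler_Im_normc z : `|complex.Im z| <= normc z.
Proof.
by rewrite -(ler_pXn2r (n := 2)) ?nnegrE ?normc_ge0 // normcE_sqr real_normK ?num_real // lerDr sqr_ge0.
Qed.

Lemma ler_normc_ReIm z : normc z <= `|complex.Re z| + `|complex.Im z|.
Proof.
rewrite -(ler_pXn2r (n := 2)) ?nnegrE ?normc_ge0 ?addr_ge0 // normcE_sqr sqrrD.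
by rewrite !real_normK ?num_real // lerD2r lerDl mulrn_wge0 ?mulr_ge0.
Qed.

Lemma ReD z w : complex.Re (z + w) = complex.Re z + complex.Re w.
Proof. by case: z; case: w. Qed.

Lemma ImD z w : complex.Im (z + w) = complex.Im z + complex.Im w.
Proof. by case: z; case: w. Qed.

Lemma ReN z : complex.Re (- z) = - complex.Re z. Proof. by case: z. Qed.

Lemma ImN z : complex.Im (- z) = - complex.Im z. Proof. by case: z. Qed.

Lemma ImB z w : complex.Im (z - w) = complex.Im z - complex.Im w.
Proof. by rewrite ImD ImN. Qed.

Lemma ReB z w : complex.Re (z - w) = complex.Re z - complex.Re w.
Proof. by rewrite ReD ReN. Qed.

Lemma ReM z w : complex.Re (z * w) =
  complex.Re z * complex.Re w - complex.Im z * complex.Im w.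
Proof. by case: z; case: w. Qed.

Lemma ImM z w : complex.Im (z * w) =
  complex.Re z * complex.Im w + complex.Im z * complex.Re w.
Proof. by case: z; case: w. Qed.

Lemma ImZ x z : complex.Im (x%:C%C * z) = x * complex.Im z.
Proof. by case: z => a b; rewrite ImM /= mul0r addr0. Qed.

Lemma ReZ x z : complex.Re (x%:C%C * z) = x * complex.Re z.
Proof. by case: z => a b; rewrite ReM /= mul0r subr0. Qed.

Lemma Im_sum (I : Type) (r : seq I) (P : pred I) (F : I -> R[i]) :
  complex.Im (\sum_(i <- r | P i) F i) = \sum_(i <- r | P i) complex.Im (F i).
Proof. by elim/big_rec2 : _ => // i y1 y2 _ <-; rewrite ImD. Qed.

Lemma ImV z : complex.Im z^-1 = - complex.Im z / normc z ^+ 2.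
Proof. by rewrite normcE_sqr; case: z => a b /=; rewrite mulNr. Qed.

Lemma ReV z : complex.Re z^-1 = complex.Re z / normc z ^+ 2.
Proof. by rewrite normcE_sqr; case: z. Qed.

(** Radii of balls in [R[i]^o] are elements of [R[i]], real as soon as they are positive; from here
    on all radii are taken in [R]. *)
Lemma nbhs_normcP z (A : set R[i]^o) :
  nbhs (z : R[i]^o) A <-> exists2 e : R, 0 < e & forall w, normc (w - z) < e -> A w.
Proof.
split.
  case/nbhs_ballP => e /= e0 zA; exists (complex.Re e).
    by move: e0; rewrite ltcE => /andP[].
  move=> w wz; apply: zA; rewrite -ball_normE /=.
  rewrite -opprB normrN normrC ltcE /= wz andbT.
  by move: e0; rewrite ltcE => /andP[].
case=> e e0 zA; apply/nbhs_ballP; exists (e%:C%C); first by rewrite /= ltcR.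
move=> w; rewrite -ball_normE /= -opprB normrN normrC ltcR; exact: zA.
Qed.

Lemma near_normcP z (P : R[i] -> Prop) :
  (\forall w \near (z : R[i]^o), P w) <->
  exists2 e : R, 0 < e & forall w, normc (w - z) < e -> P w.
Proof. exact: nbhs_normcP. Qed.

Lemma continuous_normcP (T : topologicalType) (f : T -> R[i]^o) (t : T) :
  {for t, continuous f} <->
  forall e : R, 0 < e -> \forall s \near t, normc (f s - f t) < e.
Proof.
split=> [cf e e0|h A /nbhs_normcP[e e0 eA]].
  have : nbhs (f t) [set w : R[i]^o | normc (w - f t) < e].
    by apply/nbhs_normcP; exists e.
  exact: cf.
by have := h e e0; apply: filterS => s; exact: eA.
Qed.

Lemma closure_normcP (A : set R[i]^o) z :
  closure A z <-> forall e : R, 0 < e -> exists2 w, A w & normc (w - z) < e.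
Proof.
split=> [cA e e0|h B /nbhs_normcP[e e0 eB]].
  have /cA[w [Aw Bw]] : nbhs (z : R[i]^o) [set w : R[i]^o | normc (w - z) < e].
    by apply/nbhs_normcP; exists e.
  by exists w.
by have [w Aw wz] := h e e0; exists w; split => //; exact: eB.
Qed.

Lemma open_normcP (A : set R[i]^o) :
  open A <-> forall z, A z -> exists2 e : R, 0 < e & forall w, normc (w - z) < e -> A w.
Proof.
split=> [oA z Az|h]; first by apply/nbhs_normcP; exact: open_nbhs_nbhs.
by rewrite openE => z Az; apply/nbhs_normcP; exact: h.
Qed.

Lemma continuous_Re : continuous (fun z : R[i]^o => complex.Re z).
Proof.
move=> z A /nbhs_ballP[e /= e0 eA]; apply/nbhs_normcP; exists e => // w wz; apply: eA.
rewrite /ball /=.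
by rewrite -ReB; apply: le_lt_trans (ler_Re_normc _) _; rewrite normc_distC.
Qed.

Lemma continuous_Im : continuous (fun z : R[i]^o => complex.Im z).
Proof.
move=> z A /nbhs_ballP[e /= e0 eA]; apply/nbhs_normcP; exists e => // w wz; apply: eA.
rewrite /ball /=.
by rewrite -ImB; apply: le_lt_trans (ler_Im_normc _) _; rewrite normc_distC.
Qed.

Lemma continuous_realC : continuous (fun x : R => x%:C%C : R[i]^o).
Proof.
move=> x; apply/continuous_normcP => e e0; apply/nbhs_ballP; exists e => // y; rewrite /ball /= => xy.
have -> : (y%:C%C : R[i]^o) - x%:C%C = (y - x)%:C%C by rewrite rmorphB.
by rewrite normc_real distrC.
Qed.

End ComplexNorm.

(** * Connectedness and arcs in the plane *)

Section PlaneTopology.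
Variable R : realType.
Implicit Types (A : set R[i]^o) (z w a b : R[i]^o) (s t e : R).

Lemma connected_clopen (T : topologicalType) (A P : set T) : connected A ->
  (A `&` P !=set0) ->
  (forall x, A x -> P x -> \forall y \near x, A y -> P y) ->
  (forall x, A x -> closure (A `&` P) x -> P x) ->
  A `<=` P.
Proof.
move=> cA AP0 oP cP; suff -> : A = A `&` P by move=> x [].
apply/esym/cA => //.
  exists (interior [set y | A y -> P y]); first exact: open_interior.
  apply/seteqP; split=> x [Ax].
    by move=> Px; split => //; exact: oP.
  by move=> /interior_subset /(_ Ax).
exists (closure (A `&` P)); first exact: closed_closure.
apply/seteqP; split=> x [Ax h]; last by split => //; exact: cP.
by split => //; apply: subset_closure.
Qed.

Lemma connected_locally_constant (T : topologicalType) (A P : set T) : connected A ->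
  (A `&` P !=set0) ->
  (forall x, A x -> \forall y \near x, A y -> (P x <-> P y)) ->
  A `<=` P.
Proof.
move=> cA AP0 h; apply: connected_clopen => // x Ax.
  by move=> Px; near=> y => Ay; apply/(near (h x Ax) y) => //; near: y.
move=> cl; have [y [[Ay Py] Ny]] := cl _ (h x Ax).
by apply/(Ny Ay).
Unshelve. all: by end_near. Qed.

Definition seg a b t : R[i]^o := a + t%:C%C * (b - a).

Lemma seg0 a b : seg a b 0 = a. Proof. by rewrite /seg mul0r addr0. Qed.

Lemma seg1 a b : seg a b 1 = b. Proof. by rewrite /seg mul1r addrC subrK. Qed.

Lemma segB a b s t : seg a b s - seg a b t = (s - t)%:C%C * (b - a).
Proof. by rewrite /seg rmorphB mulrBl; ring. Qed.

Lemma Im_seg a b t : complex.Im (seg a b t) = (1 - t) * complex.Im a + t * complex.Im b.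
Proof. by rewrite /seg ImD ImZ ImB; ring. Qed.

Lemma normc_segB a b t : 0 <= t <= 1 -> normc (seg a b t - a) <= normc (b - a).
Proof.
move=> /andP[t0 t1]; rewrite -[X in _ - X](seg0 a b) segB subr0 normcM normc_real.
by rewrite ger0_norm // ler_piMl ?normc_ge0.
Qed.

Lemma continuous_seg a b : continuous (seg a b).
Proof.
move=> t; apply/continuous_normcP => e e0; apply/nbhs_ballP.
have c0 : 0 < normc (b - a) + 1 by rewrite ltr_wpDl ?normc_ge0.
exists (e / (normc (b - a) + 1)); first by rewrite /= divr_gt0.
move=> s; rewrite /ball /= distrC ltr_pdivlMr // => st; rewrite segB normcM normc_real.
by apply: le_lt_trans st; rewrite ler_wpM2l // lerDl.
Qed.

Lemma seg_component A a b : (forall t, 0 <= t <= 1 -> A (seg a b t)) ->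
  connected_component A a = connected_component A b.
Proof.
move=> h; apply: same_connected_component.
have : connected [set seg a b t | t in `[0, 1]%classic].
  apply: connected_continuous_connected; first by apply/connected_intervalP/interval_is_interval.
  by apply: continuous_subspaceT => t; exact: continuous_seg.
move=> cS; exists [set seg a b t | t in `[0, 1]%classic]; last first.
  by exists 1; rewrite ?seg1 //= in_itv /= ler01 lexx.
split => //; first by exists 0; rewrite ?seg0 //= in_itv /= ler01 lexx.
by move=> _ [t /= + <-]; rewrite in_itv /=; exact: h.
Qed.

Lemma open_connected_component A z : open A -> open (connected_component A z).
Proof.
move=> /open_normcP oA; apply/open_normcP => w zw.
have [e e0 eA] := oA w (connected_component_sub zw).
exists e => // v vw; have E : connected_component A w = connected_component A v.
  apply: seg_component => t t01; apply: eA.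
  by apply: le_lt_trans vw; exact: normc_segB.
rewrite (same_connected_component zw) E; apply: connected_component_refl.
exact: eA.
Qed.

Lemma connected_seg A : (forall a b t, A a -> A b -> 0 <= t <= 1 -> A (seg a b t)) ->
  connected A.
Proof.
move=> h; have [->|/set0P[a Aa]] := eqVneq A set0; first exact: connected0.
suff -> : A = connected_component A a by exact: component_connected.
apply/seteqP; split; last exact: connected_component_sub.
move=> b Ab; rewrite (@seg_component A a b); first exact: connected_component_refl.
by move=> t; exact: h.
Qed.

Lemma connected_upper : connected (@upper_half_plane R).
Proof.
apply: connected_seg => a b t; rewrite /upper_half_plane /= Im_seg.
by move=> a0 b0 /andP[t0 t1]; nra.
Qed.

(** [z] itself need not lie in [A], which allows arcs issued from a boundary point such as 0. *)
Definition arc_to_infty A z (g : R -> R[i]^o) :=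
  [/\ continuous g, {in `[0, +oo[ &, injective g}, g 0 = z,
      (forall M, exists T, forall t, T < t -> M < normc (g t)) &
      forall t, 0 < t -> A (g t)].

(** The segment from [z'] to [z] may cut the arc. It is followed only up to the first parameter [t0]
    at which it meets the arc, and the arc is followed from there on: the result is again simple. *)
Lemma arc_extend A g z z' : arc_to_infty A z g -> A z ->
  (forall t, 0 < t <= 1 -> A (seg z' z t)) ->
  exists h, arc_to_infty A z' h.
Proof.
move=> [cg ig g0 goo gA] Az sA.
pose T := [set t | `[0, 1]%classic t /\ [set g s | s in `[0, +oo[%classic] (seg z' z t)].
have T1 : T 1.
  by split; rewrite /= ?in_itv /= ?ler01 ?lexx //; exists 0; rewrite ?seg1 //= in_itv /= lexx.
(* Beyond some parameter [S] the arc has left the disc that contains the segment, so only its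
   compact piece over [[0, S]] matters. *)
have cT : compact T.
  pose M := normc z' + normc (z - z').
  have [S hS] := goo M.
  have -> : T = `[0, 1]%classic `&` (seg z' z @^-1` [set g s | s in `[0, S]%classic]).
    apply/seteqP; split=> t /= [t01 [s /= s0 gs]]; split => //; exists s => //.
      move: s0; rewrite /= !in_itv /= andbT => ->/=; rewrite leNgt; apply/negP => /hS.
      rewrite gs ltNge => /negP; apply; rewrite /seg (le_trans (ler_normcD _ _)) // lerD2l.
      move: t01; rewrite /= in_itv /= => /andP[t0 t1].
      by rewrite normcM normc_real ger0_norm // ler_piMl ?normc_ge0.
    by move: s0; rewrite /= !in_itv /= => /andP[->].
  apply: compact_closedI; first exact: segment_compact.
  apply: closed_comp => [t _|]; first exact: continuous_seg.
  apply: compact_closed; first exact: norm_hausdorff.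
  apply: continuous_compact; last exact: segment_compact.
  by apply: continuous_subspaceT => t; exact: cg.
have [t0 Tt0 tmin] := @compact_EVT_min _ _ (@id R) T (ex_intro _ _ T1) cT
  (continuous_subspaceT (fun x => @cvg_id _ _)).
move: Tt0; rewrite inE => -[/=]; rewrite in_itv /= => /andP[t00 t01] [s0 /=].
rewrite in_itv /= andbT => s00 gs0.
have tT t : 0 <= t -> t < t0 -> forall s, 0 <= s -> g s <> seg z' z t.
  move=> t_ge0 tt0 s s_ge0 gst; have : t0 <= t.
    apply: tmin; rewrite inE; split; first by rewrite /= in_itv /= t_ge0 (le_trans (ltW tt0)).
    by exists s => //=; rewrite in_itv /= s_ge0.
  by rewrite leNgt tt0.
(* The clamps make [h] the segment on [[0, t0]] and the shifted arc afterwards, and keep it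
   continuous on the whole line. *)
pose h t := seg z' z (Num.max 0 (Num.min t t0)) + (g (s0 + Num.max 0 (t - t0)) - g s0).
have h1 t : 0 <= t -> t <= t0 -> h t = seg z' z t.
  move=> t_ge0 tt0; rewrite /h min_l // max_r // max_l ?subr_le0 // addr0.
  by rewrite subrr addr0.
have h2 t : t0 <= t -> h t = g (s0 + (t - t0)).
  move=> tt0; rewrite /h min_r // max_r // (max_r (x := 0)) ?subr_ge0 // gs0.
  by rewrite addrC subrK.
have segI t t' : 0 < t0 -> seg z' z t = seg z' z t' -> t = t'.
  move=> t0_gt0 /eqP; rewrite -subr_eq0 segB mulf_eq0 => /orP[/eqP[]/eqP|].
    by rewrite subr_eq0 => /eqP.
  rewrite subr_eq0 => /eqP zz'; exfalso; apply: (tT 0 _ _ 0) => //.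
  by rewrite g0 seg0.
exists h; split.
- have cm t : {for t, continuous (fun t => Num.max 0 (Num.min t t0))}.
    apply: (@continuous_max _ _ (cst 0) (fun t => Num.min t t0)); first exact: cvg_cst.
    by apply: (@continuous_min _ _ id (cst t0)); [exact: cvg_id|exact: cvg_cst].
  have cm' t : {for t, continuous (fun t => Num.max 0 (t - t0))}.
    apply: (@continuous_max _ _ (cst 0) (fun t => t - t0)); first exact: cvg_cst.
    by apply: cvgB; [exact: cvg_id|exact: cvg_cst].
  move=> t; apply: cvgD; last apply: cvgB; last exact: cvg_cst.
    by apply: cvg_comp; [exact: cm|exact: continuous_seg].
  apply: (@cvg_comp _ _ _ (fun t => s0 + Num.max 0 (t - t0)) g); last exact: cg.
  by apply: cvgD; [exact: cvg_cst|exact: cm'].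
- move=> t t'; rewrite !inE /= !in_itv /= !andbT => t_ge0 t'_ge0.
  wlog : t t' t_ge0 t'_ge0 / t <= t'.
    move=> H; case: (leP t t') => [|/ltW] tt' E; first exact: H.
    by apply/esym; apply: H.
  move=> tt'; case: (leP t' t0) => t't0.
    rewrite !h1 ?(le_trans tt') // => /segI.
    case: (ltP 0 t0) => [_|t0_le0]; first exact.
    by move=> _; apply/eqP; rewrite eq_le tt' /= (le_trans t't0) // (le_trans t0_le0).
  rewrite (h2 t' (ltW t't0)); case: (leP t0 t) => t0t.
    rewrite h2 // => /ig; rewrite !inE /= !in_itv /= !andbT => /(_ _ _)/addrI/addIr; apply.
      by rewrite addr_ge0 // subr_ge0.
    by rewrite addr_ge0 // subr_ge0 ltW.
  rewrite (h1 t t_ge0 (ltW t0t)) => /esym/(tT _ t_ge0 t0t); case.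
  by rewrite addr_ge0 // subr_ge0 ltW.
- by rewrite h1 ?seg0.
- move=> M; have [S hS] := goo M; exists (Num.max t0 (S + t0)) => t.
  rewrite gt_max => /andP[tt0 tS]; rewrite h2 ?ltW //; apply: hS.
  by rewrite ltr_wpDl // ltrBrDr.
- move=> t t_gt0; case: (leP t t0) => tt0.
    by rewrite h1 ?(ltW t_gt0) //; apply: sA; rewrite t_gt0 (le_trans tt0).
  rewrite h2 ?ltW //; apply: gA.
  by rewrite ltr_wpDl // subr_gt0.
Qed.

End PlaneTopology.

Section ComplexLimits.
Variables (R : realType) (T : Type) (F : set_system T).
Context {FF : Filter F}.
Implicit Types (f g : T -> R[i]^o) (a b : R[i]^o).

Lemma cvg_mulC f g a b : f @ F --> a -> g @ F --> b ->
  (fun x => f x * g x : R[i]^o) @ F --> (a * b : R[i]^o).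
Proof. by move=> fa gb; exact: (@cvgM R[i] T F FF f g a b fa gb). Qed.

Lemma cvg_invC f a : a != 0 -> f @ F --> a ->
  (fun x => (f x)^-1 : R[i]^o) @ F --> (a^-1 : R[i]^o).
Proof. by move=> a0 fa; exact: (@cvgV R[i] T F FF f a a0 fa). Qed.

Lemma cvg_expC f a n : f @ F --> a ->
  (fun x => f x ^+ n : R[i]^o) @ F --> (a ^+ n : R[i]^o).
Proof.
move=> fa; elim: n => [|n IH].
  by under eq_fun do rewrite expr0; exact: cvg_cst.
under eq_fun do rewrite exprS.
by rewrite exprS; exact: cvg_mulC.
Qed.

Lemma cvg_sumC (I : Type) (r : seq I) (P : pred I) (f : I -> T -> R[i]^o)
    (a : I -> R[i]^o) : (forall i, P i -> f i @ F --> a i) ->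
  (fun x => \sum_(i <- r | P i) f i x : R[i]^o) @ F --> (\sum_(i <- r | P i) a i : R[i]^o).
Proof. by move=> h; apply: cvg_big => //; exact: add_continuous. Qed.

Lemma cvg_normcP f a : f @ F --> a <->
  forall e : R, 0 < e -> \forall x \near F, normc (f x - a) < e.
Proof.
split=> [fa e e0|h A /nbhs_normcP[e e0 eA]].
  have : nbhs a [set w : R[i]^o | normc (w - a) < e] by apply/nbhs_normcP; exists e.
  exact: fa.
by have := h e e0; apply: filterS => s; exact: eA.
Qed.

End ComplexLimits.

(** * Roots of monic polynomials near points of small value *)

Section NearRoots.
Variable R : realType.
Implicit Types (Q : {poly R[i]}) (z w : R[i]).

(** [normc Q.[z]] is the product of the distances from [z] to the roots, hence at least the smallest
    distance to the power of the degree. This takes the place of the open mapping theorem and of the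
    continuity of roots. *)
Lemma near_root Q z : Q \is monic -> (1 < size Q)%N ->
  exists2 a, root Q a & normc (z - a) ^+ (size Q).-1 <= normc Q.[z].
Proof.
move=> mQ; have [rs QE] := closed_field_poly_normal Q.
rewrite (monicP mQ) scale1r in QE; rewrite QE size_prod_XsubC /=.
case: rs QE => [|r0 rs] // _ _.
suff [a ars ha] : exists2 a, a \in r0 :: rs &
    normc (z - a) ^+ (size (r0 :: rs)) <= normc (\prod_(r <- r0 :: rs) ('X - r%:P)).[z].
  by exists a; rewrite ?root_prod_XsubC.
elim: rs r0 => [|r1 rs IH] r0.
  by exists r0; rewrite ?inE // big_seq1 hornerXsubC.
have [a ars ha] := IH r1.
rewrite big_cons hornerM normcM hornerXsubC [size _]/=.
case: (leP (normc (z - r0)) (normc (z - a))) => h.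
  exists r0; first by rewrite inE eqxx.
  rewrite exprS.
  rewrite ler_wpM2l ?normc_ge0 //; apply: le_trans ha.
  by rewrite lerXn2r ?nnegrE ?normc_ge0.
exists a; first by rewrite inE ars orbT.
rewrite exprS.
by rewrite ler_pM ?exprn_ge0 ?normc_ge0 // ltW.
Qed.

(* The roots form a finite, hence compact, set. *)
Lemma limit_root Q (P : R -> R[i] -> Prop) : Q \is monic -> (1 < size Q)%N ->
  (forall d e z, d <= e -> P d z -> P e z) ->
  (forall e, 0 < e -> exists2 z, P e z & normc Q.[z] < e) ->
  exists2 a, root Q a & forall e, 0 < e -> exists2 z, P e z & normc (z - a) < e.
Proof.
move=> mQ sQ Pmon Plim; apply: contrapT => no.
have [rs QE] := closed_field_poly_normal Q.
rewrite (monicP mQ) scale1r in QE.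
have rootE a : root Q a = (a \in rs) by rewrite QE root_prod_XsubC.
have [e e0 he] : exists2 e, 0 < e & forall a, a \in rs ->
    forall z, P e z -> e <= normc (z - a).
  have : forall a, a \in rs -> root Q a by move=> a; rewrite rootE.
  elim: rs {QE rootE} => [|r rs IH] hrs; first by exists 1.
  have [e1 e10 h1] := IH (fun a ars => hrs a (mem_behead (s := r :: rs) ars)).
  have : ~ (forall e, 0 < e -> exists2 z, P e z & normc (z - r) < e).
    by move=> h; apply: no; exists r => //; apply: hrs; rewrite inE eqxx.
  move/existsNP => [e2 /not_implyP[e20 h2]].
  exists (Num.min e1 e2); first by rewrite lt_min e10.
  move=> a; rewrite inE => /orP[/eqP -> z Pz|ars z Pz].
    rewrite ge_min; apply/orP; right; rewrite leNgt; apply/negP => lt; apply: h2.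
    by exists z => //; apply: Pmon Pz; rewrite ge_min lexx orbT.
  by rewrite ge_min h1 //; apply: Pmon Pz; rewrite ge_min lexx.
have [z Pz Qz] := Plim (Num.min e (e ^+ (size Q).-1))
  ltac:(by rewrite lt_min e0 exprn_gt0).
have [a ra ha] := near_root z mQ sQ.
have := he a; rewrite -rootE => /(_ ra z) ea.
have {}ea : e <= normc (z - a) by apply: ea; apply: Pmon Pz; rewrite ge_min lexx.
move: ea; apply/negP; rewrite -ltNge -(ltr_pXn2r (n := (size Q).-1)) ?nnegrE ?normc_ge0 ?(ltW e0) //.
  apply: le_lt_trans ha _; apply: lt_le_trans Qz _.
  by rewrite ge_min lexx orbT.
by case: (size Q) sQ => [|[]].
Qed.

End NearRoots.

(** * The rational function z + phi(z) *)

Section Voiculescu.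
Variables (R : realType) (p : nat) (kappa : nat -> R).
Hypotheses (p_ge2 : (2 <= p)%N) (kappa_p : kappa p != 0).
Implicit Types (z w a b : R[i]).

Definition Hf z : R[i] := z + phi p kappa z.

(* The divided difference [(Hf z - Hf a) / (z - a)]. *)
Definition Kf z a : R[i] := 1 - z^-1 * a^-1 * (\sum_(1 <= n < p.+1) (kappa n)%:C%C *
   (\sum_(i < n.-1) (z^-1) ^+ (n.-1.-1 - i) * (a^-1) ^+ i)).

Lemma HfB z a : z != 0 -> a != 0 -> Hf z - Hf a = (z - a) * Kf z a.
Proof.
move=> z0 a0; have -> : Hf z - Hf a = (z - a) + (phi p kappa z - phi p kappa a).
  by rewrite /Hf; ring.
rewrite /Kf mulrBr mulr1; congr (_ + _).
have za : (z - a) * (z^-1 * a^-1) = - (z^-1 - a^-1) by field; rewrite z0 a0.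
rewrite mulrA za mulNr opprK /phi -sumrB mulr_sumr; apply: eq_bigr => n _.
by rewrite -mulrBr mulrCA -subrXX !exprVn.
Qed.

Lemma Kf_sym z a : Kf z a = Kf a z.
Proof.
rewrite /Kf [z^-1 * a^-1]mulrC; congr (_ - _ * _); apply: eq_bigr => n _; congr (_ * _).
rewrite (reindex_inj rev_ord_inj); apply: eq_bigr => i _ /=.
have := ltn_ord i; rewrite mulrC => ni.
by clear p_ge2 kappa_p; congr (_ ^+ _ * _ ^+ _); lia.
Qed.

Lemma Hf_conj z : Hf (z^*)%C = ((Hf z)^*)%C.
Proof.
rewrite /Hf /phi rmorphD rmorph_sum; congr (_ + _); apply: eq_bigr => n _.
by rewrite rmorphM fmorphV rmorphXn /= oppr0.
Qed.

(** The weight [n] pays for the summands of the inner sum of [Kf], fewer than [n] and each of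
    modulus at most 1 when [z] and [a] are outside the unit disc. *)
Definition csum : R := \sum_(1 <= n < p.+1) `|kappa n| *+ n.

Lemma csum_ge0 : 0 <= csum.
Proof. by apply: sumr_ge0 => n _; rewrite mulrn_wge0. Qed.

Lemma sum_kappa_le : \sum_(1 <= n < p.+1) `|kappa n| <= csum.
Proof.
rewrite /csum !big_seq; apply: ler_sum => n; rewrite mem_index_iota => /andP[n1 _].
by rewrite -mulr_natr ler_peMr // ler1n.
Qed.

Lemma Kf_near1 z a : 1 <= normc z -> 1 <= normc a ->
  normc (Kf z a - 1) <= csum / (normc z * normc a).
Proof.
move=> z1 a1; rewrite /Kf addrC addKr normcNE !normcM !normcV -invfM mulrC.
rewrite ler_wpM2r ?invr_ge0 ?mulr_ge0 ?normc_ge0 //.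
apply: le_trans (ler_normc_sum _ _ _) _; apply: ler_sum_nat => n /andP[n1 np].
rewrite normcM normc_real -mulr_natr ler_wpM2l //.
apply: le_trans (ler_normc_sum _ _ _) _.
apply: (@le_trans _ _ (\sum_(i < n.-1) 1)).
  have inv1 (u : R[i]) : 1 <= normc u -> normc u^-1 <= 1.
    by move=> u1; rewrite normcV invf_le1 // (lt_le_trans ltr01).
  by apply: ler_sum => i _; rewrite normcM !normcX mulr_ile1 ?exprn_ge0 ?normc_ge0
    ?exprn_ile1 ?normc_ge0 ?inv1.
by rewrite sumr_const card_ord ler_nat leq_pred.
Qed.

Lemma Hf_near_id z : 1 <= normc z -> normc (Hf z - z) <= csum.
Proof.
move=> z1; rewrite /Hf addrC addKr; apply: le_trans (ler_normc_sum _ _ _) _.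
apply: le_trans sum_kappa_le; apply: ler_sum => n _.
rewrite normcM normc_real normcV normcX ler_piMr // invf_le1 ?exprn_ege1 //.
by rewrite exprn_gt0 // (lt_le_trans ltr01).
Qed.

(** [H] commutes with conjugation, so its divided difference between [z] and the conjugate of [z] is
    the ratio of the imaginary parts. In particular [H] is real at nonzero real points. *)
Lemma Im_Hf z : z != 0 -> complex.Im (Hf z) = complex.Im z * complex.Re (Kf z (z^*)%C).
Proof.
move=> z0; have zc0 : (z^*)%C != 0 by rewrite conjc_eq0.
have := HfB z0 zc0; rewrite Hf_conj => /(congr1 (@complex.Im R)).
rewrite ImM !ImB ReB; case: (Hf z) => a b; case: (z) (Kf _ _) => x y [k l] /=.
lra.
Qed.

(* Outside the disc of this radius, [Im (Hf z)] has the sign of [Im z]. *)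
Definition rad : R := 2 * csum + 2.

Lemma rad_ge1 : 1 <= rad.
Proof. by have := csum_ge0; rewrite /rad; lra. Qed.

(** The constants in [rad] make [csum / (normc z * normc a)] at most [1 / 2]; hence [K] has real
    part at least [1 / 2] and does not vanish there. *)
Lemma Kf_far z a : rad <= normc z -> rad <= normc a -> normc (Kf z a - 1) <= 1 / 2.
Proof.
have c0 := csum_ge0 => zr ar; have r1 := rad_ge1.
apply: le_trans (Kf_near1 _ _) _; rewrite ?(le_trans r1) //.
have zz : rad * 1 <= normc z * normc a.
  by apply: ler_pM => //; [lra|exact: le_trans ar].
rewrite ler_pdivrMr; last by apply: lt_le_trans zz; lra.
by rewrite /rad in zz; lra.
Qed.

Lemma Kf_far_neq0 z a : rad <= normc z -> rad <= normc a -> Kf z a != 0.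
Proof.
move=> zr ar; apply: contraTneq (Kf_far zr ar) => ->.
by rewrite sub0r normcNE normc1; lra.
Qed.

Lemma normc_conj z : normc (z^*)%C = normc z.
Proof. by case: z => x y; rewrite /normc /= sqrrN. Qed.

Lemma Im_Hf_far z : rad <= normc z ->
  exists2 k, 1 / 2 <= k & complex.Im (Hf z) = complex.Im z * k.
Proof.
move=> zr; have r1 := rad_ge1; have z0 : z != 0 by rewrite -normc_gt0; lra.
exists (complex.Re (Kf z (z^*)%C)); last exact: Im_Hf.
have := Kf_far zr (_ : rad <= normc (z^*)%C); rewrite normc_conj => /(_ zr) h.
have := le_trans (ler_Re_normc _) h; rewrite ReB ler_norml /= => /andP[+ _]; lra.
Qed.

Lemma Hf_cvg (T : Type) (F : set_system T) (FF : Filter F) (u : T -> R[i]^o) (z : R[i]^o) :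
  z != 0 -> u @ F --> z -> (fun x => Hf (u x) : R[i]^o) @ F --> (Hf z : R[i]^o).
Proof.
move=> z0 uz; have ph : (fun x => phi p kappa (u x) : R[i]^o) @ F --> (phi p kappa z : R[i]^o).
  apply: (@cvg_sumC R T F FF _ _ _ (fun n x => (kappa n)%:C%C / u x ^+ n.-1)
    (fun n => (kappa n)%:C%C / z ^+ n.-1)) => n _.
  apply: (@cvg_mulC R T F FF (fun=> (kappa n)%:C%C) (fun x => (u x ^+ n.-1)^-1)).
    exact: cvg_cst.
  apply: (@cvg_invC R T F FF (fun x => u x ^+ n.-1)); first by rewrite expf_neq0.
  exact: cvg_expC.
exact: (cvgD uz ph).
Qed.

Lemma Kf_cvg (T : Type) (F : set_system T) (FF : Filter F) (u v : T -> R[i]^o) (z a : R[i]^o) :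
  z != 0 -> a != 0 -> u @ F --> z -> v @ F --> a ->
  (fun x => Kf (u x) (v x) : R[i]^o) @ F --> (Kf z a : R[i]^o).
Proof.
move=> z0 a0 uz va; have uz' := @cvg_invC R T F FF u z z0 uz.
have va' := @cvg_invC R T F FF v a a0 va.
pose S (x y : R[i]) : R[i] := \sum_(1 <= n < p.+1) (kappa n)%:C%C *
  (\sum_(i < n.-1) x ^+ (n.-1.-1 - i) * y ^+ i).
have hS : (fun x => S (u x)^-1 (v x)^-1 : R[i]^o) @ F --> (S z^-1 a^-1 : R[i]^o).
  apply: (@cvg_sumC R T F FF _ _ _ (fun n x => (kappa n)%:C%C *
    (\sum_(i < n.-1) (u x)^-1 ^+ (n.-1.-1 - i) * (v x)^-1 ^+ i))
    (fun n => (kappa n)%:C%C * (\sum_(i < n.-1) z^-1 ^+ (n.-1.-1 - i) * a^-1 ^+ i))) => n _.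
  apply: (@cvg_mulC R T F FF (fun=> (kappa n)%:C%C)); first exact: cvg_cst.
  apply: (@cvg_sumC R T F FF _ _ _ (fun (i : 'I_n.-1) x => (u x)^-1 ^+ (n.-1.-1 - i) * (v x)^-1 ^+ i)
    (fun i : 'I_n.-1 => z^-1 ^+ (n.-1.-1 - i) * a^-1 ^+ i)) => i _.
  exact: (@cvg_mulC R T F FF (fun x => (u x)^-1 ^+ _) (fun x => (v x)^-1 ^+ _) _ _
    (@cvg_expC R T F FF _ _ _ uz') (@cvg_expC R T F FF _ _ _ va')).
have h := @cvg_mulC R T F FF _ _ _ _ (@cvg_mulC R T F FF _ _ _ _ uz' va') hS.
have h1 : (fun _ : T => 1 : R[i]^o) @ F --> (1 : R[i]^o) by exact: cvg_cst.
exact: (cvgB h1 h).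
Qed.

(** Quantitative form of [H z ~ kappa p / z^(p-1)] at 0; the 1 added to [csum] accounts for
    [z * z ^+ p.-1]. *)
Lemma Hf_near0 z : normc z <= 1 -> z != 0 ->
  normc (z ^+ p.-1 * Hf z - (kappa p)%:C%C) <= (csum + 1) * normc z.
Proof.
move=> z1 z0; have -> : z ^+ p.-1 * Hf z - (kappa p)%:C%C =
    z * z ^+ p.-1 + \sum_(1 <= n < p) (kappa n)%:C%C * z ^+ (p - n).
  rewrite /Hf /phi mulrDr big_nat_recr /=; last by lia.
  rewrite mulrDr mulrCA divff ?expf_neq0 // mulr1 addrA addrK [z ^+ _ * z]mulrC.
  congr (_ + _); rewrite mulr_sumr; apply: eq_big_nat => n /andP[n1 np].
  rewrite mulrCA; congr (_ * _); have -> : p.-1 = ((p - n) + n.-1)%N by lia.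
  by rewrite exprD mulfK ?expf_neq0.
apply: le_trans (ler_normcD _ _) _; rewrite addrC mulrDl mul1r lerD //; last first.
  by rewrite normcM normcX ler_piMr ?normc_ge0 // exprn_ile1 ?normc_ge0.
apply: le_trans (ler_normc_sum _ _ _) _.
apply: (@le_trans _ _ (\sum_(1 <= n < p) (`|kappa n| * normc z))).
  apply: ler_sum_nat => n /andP[n1 np]; rewrite normcM normc_real normcX ler_wpM2l //.
  have -> : (p - n = (p - n).-1.+1)%N by lia.
  by rewrite exprS ler_piMr ?normc_ge0 // exprn_ile1 ?normc_ge0.
rewrite -mulr_suml ler_wpM2r ?normc_ge0 //; apply: le_trans sum_kappa_le.
by rewrite [leRHS]big_nat_recr /= ?lerDl //; lia.
Qed.

Lemma monic_lower n (q : {poly R[i]}) : (size q <= n)%N ->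
  'X^n + q \is monic /\ size ('X^n + q) = n.+1.
Proof.
move=> qn; have sX : (size q < size ('X^n : {poly R[i]}))%N by rewrite size_polyXn ltnS.
by rewrite monicE lead_coefDl // lead_coefXn size_polyDl // size_polyXn.
Qed.

(** The equation [H z = w] multiplied by [z ^+ p.-1]: monic of degree [p]. Its constant term
    [kappa p] is not 0, so its roots are exactly the solutions. *)
Definition Qpoly w : {poly R[i]} := 'X^p +
  (\sum_(1 <= n < p.+1) (kappa n)%:C%C *: 'X^(p - n) - w *: 'X^(p.-1)).

Lemma Qpoly_monic w : Qpoly w \is monic /\ size (Qpoly w) = p.+1.
Proof.
apply: monic_lower; apply: leq_trans (size_polyD _ _) _; rewrite geq_max; apply/andP; split.
  rewrite big_nat; apply: (leq_trans (size_sum _ _ _)); apply/bigmax_leqP_seq => n _ /andP[n1 np].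
  by rewrite (leq_trans (size_scale_leq _ _)) // size_polyXn; lia.
by rewrite size_polyN (leq_trans (size_scale_leq _ _)) // size_polyXn; lia.
Qed.

Lemma Qpoly_hornerE w z : z != 0 -> (Qpoly w).[z] = z ^+ p.-1 * (Hf z - w).
Proof.
move=> z0; rewrite /Qpoly !hornerE horner_sum /= -addrA /Hf /phi mulrBr mulrDr -addrA; congr (_ + (_ - _)).
- by rewrite -[in LHS](prednK (ltnW p_ge2)) exprSr.
- rewrite mulr_sumr; apply: eq_big_nat => n /andP[n1 np].
  rewrite hornerZ hornerXn [RHS]mulrCA; congr (_ * _); have -> : p.-1 = ((p - n) + n.-1)%N by lia.
  by rewrite exprD mulfK ?expf_neq0.
- by rewrite mulrC.
Qed.

Lemma Qpoly_horner0 w : (Qpoly w).[0] = (kappa p)%:C%C.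
Proof.
rewrite /Qpoly !hornerE horner_sum !expr0n big_nat_recr /=; last by lia.
rewrite !hornerE subnn expr0 mulr1 big_nat_cond big1 => [|n /andP[/andP[n1 np] _]].
  have p1 : (0 < p.-1)%N by lia.
  by rewrite (gtn_eqF (ltnW p_ge2)) (gtn_eqF p1) /= mulr0 subr0 !add0r.
by rewrite hornerZ hornerXn expr0n subn_eq0 leqNgt np mulr0.
Qed.

Lemma root_Qpoly w z : root (Qpoly w) z -> z != 0 /\ Hf z = w.
Proof.
have [->|z0] := eqVneq z 0.
  by rewrite rootE Qpoly_horner0 fmorph_eq0 (negbTE kappa_p).
rewrite rootE Qpoly_hornerE // mulf_eq0 expf_eq0 (negbTE z0) andbF /= subr_eq0 => /eqP.
by [].
Qed.

(** [K z a] multiplied by [z ^+ p.-1]: monic of degree [p - 1], with constant term [- kappa p / a],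
    so that for [a != 0] its roots are the zeros of [K] in the first variable. *)
Definition Kpoly a : {poly R[i]} := 'X^(p.-1) - a^-1 *:
  (\sum_(1 <= n < p.+1) (kappa n)%:C%C *: \sum_(i < n.-1) (a^-1) ^+ i *: 'X^(p - n + i)).

Lemma Kpoly_monic a : Kpoly a \is monic /\ size (Kpoly a) = p.
Proof.
have h : (p = p.-1.+1)%N by lia.
rewrite [X in _ = X]h; apply: monic_lower; rewrite size_polyN.
apply: leq_trans (size_scale_leq _ _) _; rewrite big_nat.
apply: (leq_trans (size_sum _ _ _)); apply/bigmax_leqP_seq => n _ /andP[n1 np].
apply: leq_trans (size_scale_leq _ _) _.
apply: (leq_trans (size_sum _ _ _)); apply/bigmax_leqP => i _.
by rewrite (leq_trans (size_scale_leq _ _)) // size_polyXn; have := ltn_ord i; lia.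
Qed.

Lemma Kpoly_hornerE z a : z != 0 -> (Kpoly a).[z] = z ^+ p.-1 * Kf z a.
Proof.
move=> z0; rewrite /Kpoly /Kf hornerD hornerN hornerZ hornerXn horner_sum mulrBr mulr1; congr (_ - _).
rewrite !mulrA [_ * a^-1]mulrC -!mulrA; congr (_ * _); rewrite !mulr_sumr.
apply: eq_big_nat => n /andP[n1 np]; rewrite hornerZ horner_sum !mulr_sumr.
apply: eq_bigr => i _; rewrite hornerZ hornerXn; have := ltn_ord i => ni.
have -> : p.-1 = ((p - n + i) + (n.-1.-1 - i).+1)%N by lia.
rewrite [z ^+ (_ + _.+1)]exprD [z ^+ _.+1]exprS [z^-1 ^+ _]exprVn.
have zn0 : z ^+ (n.-1.-1 - i) != 0 by rewrite expf_neq0.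
move: (z ^+ (p - n + i)) (z ^+ (n.-1.-1 - i)) (a^-1 ^+ i) zn0 => A B D B0.
by field; rewrite z0 B0.
Qed.

Lemma Kpoly_horner0 a : (Kpoly a).[0] = - (a^-1 * (kappa p)%:C%C).
Proof.
rewrite /Kpoly hornerD hornerN hornerZ hornerXn horner_sum expr0n.
have p1 : (0 < p.-1)%N by lia.
rewrite (gtn_eqF p1) sub0r; congr (- (_ * _)); rewrite big_nat_recr /=; last by lia.
rewrite big_nat_cond big1 ?add0r => [|n /andP[/andP[n1 np] _]].
  rewrite hornerZ horner_sum (bigD1 (Ordinal p1)) //=.
  rewrite hornerZ hornerXn subnn !expr0 !mulr1 big1 ?addr0 ?mulr1 // => i i0.
  rewrite hornerZ hornerXn expr0n add0n.
  by rewrite -val_eqE /= in i0; rewrite (negbTE i0) mulr0.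
rewrite hornerZ horner_sum big1 ?mulr0 // => i _.
have pn : (0 < p - n + i)%N by lia.
by rewrite hornerZ hornerXn expr0n (gtn_eqF pn) mulr0.
Qed.

Lemma root_Kpoly a z : a != 0 -> root (Kpoly a) z -> z != 0 /\ Kf z a = 0.
Proof.
move=> a0; have [->|z0] := eqVneq z 0.
  rewrite rootE Kpoly_horner0 oppr_eq0 mulf_eq0 invr_eq0 (negbTE a0) fmorph_eq0.
  by rewrite (negbTE kappa_p).
rewrite rootE Kpoly_hornerE // mulf_eq0 expf_eq0 (negbTE z0) andbF /= => /eqP.
by [].
Qed.

(** At [z] the polynomial [Qpoly w] has the value [z^(p-1) (H z - w)], small when [w] is close to
    [H z]; [near_root] then gives a preimage of [w] near [z]. *)
Lemma Hf_open z e : z != 0 -> 0 < e ->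
  exists2 d, 0 < d & forall w, normc (w - Hf z) < d ->
    exists z', [/\ z' != 0, Hf z' = w & normc (z' - z) < e].
Proof.
move=> z0 e0; have zp : 0 < normc z ^+ p.-1 by rewrite exprn_gt0 // normc_gt0.
exists (e ^+ p / normc z ^+ p.-1); first by rewrite divr_gt0 // exprn_gt0.
move=> w wz; have [mQ sQ] := Qpoly_monic w.
have [|z' rz'] := near_root z mQ; first by rewrite sQ; lia.
rewrite sQ Qpoly_hornerE // normcM normcX (normc_distC z) (normc_distC _ w) => h.
have [z'0 Hz'] := root_Qpoly rz'; exists z'; split => //.
rewrite -(ltr_pXn2r (n := p)) ?nnegrE ?normc_ge0 ?(ltW e0) //; last by lia.
by apply: le_lt_trans h _; rewrite mulrC -ltr_pdivlMr.
Qed.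

(** Apply [near_root] at [w] itself: the value [w^(p-1) (H w - w)] of [Qpoly w] has modulus at most
    [csum |w|^(p-1)], and the bound [csum * 2 ^+ p] makes this at most [(|w| / 2)^p]. *)
Lemma Hf_large w : csum * 2 ^+ p <= normc w -> 1 <= normc w ->
  exists z, [/\ z != 0, Hf z = w & normc w / 2 <= normc z].
Proof.
move=> wL w1; have w0 : w != 0 by rewrite -normc_gt0 (lt_le_trans ltr01).
have [mQ sQ] := Qpoly_monic w.
have [|z rz] := near_root w mQ; first by rewrite sQ; lia.
rewrite sQ Qpoly_hornerE // normcM normcX /= => h.
have [z0 Hz] := root_Qpoly rz; exists z; split => //.
have h1 : normc (w - z) ^+ p <= (normc w / 2) ^+ p.
  apply: le_trans h _; rewrite exprMn exprVn ler_pdivlMr ?exprn_gt0 //.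
  have -> : normc w ^+ p = normc w ^+ p.-1 * normc w by rewrite -exprSr prednK //; lia.
  rewrite -mulrA ler_wpM2l ?exprn_ge0 ?normc_ge0 //; apply: le_trans wL.
  by rewrite ler_wpM2r ?exprn_ge0 ?Hf_near_id.
have h2 : normc (w - z) <= normc w / 2.
  rewrite -(ler_pXn2r (n := p)) ?nnegrE ?normc_ge0 ?divr_ge0 ?normc_ge0 //; lia.
have := lerB_normc w (w - z); have -> : w - (w - z) = z by ring.
lra.
Qed.

End Voiculescu.

(** * The region Omega *)

Section OmegaRegion.
Variables (R : realType) (p : nat) (kappa : nat -> R).
Hypotheses (p_ge2 : (2 <= p)%N) (kappa_p : kappa p != 0).
Implicit Types (z w a b : R[i]).

Notation H := (Hf p kappa).
Notation pos := (positive_region (phi p kappa)).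
Notation Om := (Omega (phi p kappa)).
Notation rad := (rad p kappa).

Lemma upper_neq0 z : 0 < complex.Im z -> z != 0.
Proof. by apply: contraTneq => ->; rewrite ltxx. Qed.

Lemma far_positive z : 0 < complex.Im z -> rad <= normc z -> pos z.
Proof.
move=> z0 zr; split => //; have [k k2 E] := Im_Hf_far zr.
by rewrite -/(H z) E mulr_gt0 //; lra.
Qed.

Lemma Hf_continuous z : z != 0 -> {for (z : R[i]^o), continuous (H : R[i]^o -> R[i]^o)}.
Proof.
move=> z0; have idz : (fun x : R[i]^o => x) @ (z : R[i]^o) --> (z : R[i]^o) by exact: cvg_id.
exact: (@Hf_cvg R p kappa _ _ _ (fun x : R[i]^o => x) z z0 idz).
Qed.

Lemma open_positive : open pos.
Proof.
apply/open_normcP => z [z0 Hz0].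
have z00 := upper_neq0 z0.
have nh := (@continuous_normcP R _ (H : R[i]^o -> R[i]^o) z).1 (Hf_continuous z00) _ Hz0.
have /near_normcP[e e0 he] : \forall w \near (z : R[i]^o), complex.Im z / 2 < complex.Im w /\
    0 < complex.Im (H w).
  near=> w; split.
    have : normc (w - z) < complex.Im z / 2.
      by near: w; apply/near_normcP; exists (complex.Im z / 2) => //; rewrite divr_gt0.
    move=> h; have := le_lt_trans (ler_Im_normc _) h.
    by rewrite ImB ltr_norml => /andP[+ _]; lra.
  have : normc (H w - H z) < complex.Im (H z).
    by near: w; exact: nh.
  move=> h; have := le_lt_trans (ler_Im_normc _) h.
  by rewrite ImB ltr_norml => /andP[+ _]; lra.
exists e => // w /he[h1 h2]; split => //.
by rewrite /upper_half_plane /=; move: z0; rewrite /upper_half_plane /=; lra.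
Unshelve. all: by end_near. Qed.

Let base : R[i]^o := (0 +i* rad)%C.

Let base_far : 0 < complex.Im base /\ rad <= normc base.
Proof.
have r1 := rad_ge1 p kappa; split; first by rewrite /=; lra.
by rewrite (le_trans _ (ler_Im_normc _)) //= ger0_norm //; lra.
Qed.

(** Vertical segments upwards from [z] and from [base] and a horizontal one between their ends all
    stay outside the disc of radius [rad]. *)
Let far_component z : 0 < complex.Im z -> rad <= normc z ->
  connected_component pos z = connected_component pos base.
Proof.
move=> z0 zr; have r1 := rad_ge1 p kappa.
have [b0 br] := base_far.
rewrite (@seg_component _ _ z (complex.Re z +i* (complex.Im z + rad))%C).
  rewrite [RHS](@seg_component _ _ base (0 +i* (complex.Im z + rad))%C).
    apply: seg_component => t /andP[t0 t1].
    have E : complex.Im (seg (complex.Re z +i* (complex.Im z + rad))%C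
        (0 +i* (complex.Im z + rad))%C t) = complex.Im z + rad.
      by rewrite Im_seg /=; ring.
    apply: far_positive; rewrite ?E; first by lra.
    by rewrite (le_trans _ (ler_Im_normc _)) // E ger0_norm; lra.
  move=> t /andP[t0 t1].
  have E : complex.Im (seg base (0 +i* (complex.Im z + rad))%C t) = rad + t * complex.Im z.
    by rewrite Im_seg /=; ring.
  have tz : 0 <= t * complex.Im z by rewrite mulr_ge0 // ltW.
  apply: far_positive; rewrite ?E; first by lra.
  by rewrite (le_trans _ (ler_Im_normc _)) // E ger0_norm; lra.
move=> t /andP[t0 t1].
have tr : 0 <= t * rad by rewrite mulr_ge0 //; lra.
have E : complex.Im (seg z (complex.Re z +i* (complex.Im z + rad))%C t) =
    complex.Im z + t * rad.
  by rewrite Im_seg /=; ring.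
have E' : complex.Re (seg z (complex.Re z +i* (complex.Im z + rad))%C t) = complex.Re z.
  by rewrite /seg ReD ReZ ReB /=; ring.
apply: far_positive; rewrite ?E; first by lra.
apply: le_trans zr _.
rewrite -(ler_pXn2r (n := 2)) ?nnegrE ?normc_ge0 // !normcE_sqr E E' lerD2l.
by rewrite ler_pXn2r ?nnegrE ?addr_ge0 ?(ltW z0) // lerDl.
Qed.

Let OmE : Om = connected_component pos base.
Proof.
have [b0 br] := base_far; have r1 := rad_ge1 p kappa.
apply/seteqP; split=> z /=.
  case=> r hr; pose Y := Num.max rad (`|r| + 1).
  have Y0 : 0 < Y by rewrite /Y lt_max; apply/orP; left; lra.
  have YN : normc (0 +i* Y)%C = Y by rewrite /normc /= expr0n /= add0r sqrtr_sqr gtr0_norm.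
  have : connected_component pos z (0 +i* Y)%C.
    apply: hr; first by rewrite /upper_half_plane.
    by rewrite YN /Y lt_max; apply/orP; right; rewrite (le_lt_trans (ler_norm _)) ?ltrDl.
  move=> zY; rewrite -(@far_component (0 +i* Y)%C) //; last by rewrite YN /Y le_max lexx.
  exact: connected_component_sym.
move=> bz; exists rad => w w0 wr; rewrite -(same_connected_component bz).
rewrite -(far_component w0 (ltW wr)); apply: connected_component_refl.
by apply: far_positive => //; exact: ltW.
Qed.

Lemma far_Omega z : 0 < complex.Im z -> rad <= normc z -> Om z.
Proof.
move=> z0 zr; rewrite OmE -(far_component z0 zr); apply: connected_component_refl.
exact: far_positive.
Qed.

Lemma Omega_positive z : Om z -> 0 < complex.Im z /\ 0 < complex.Im (H z).
Proof. by rewrite OmE => /connected_component_sub[]. Qed.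

Lemma Omega_neq0 z : Om z -> z != 0.
Proof. by move=> /Omega_positive[z0 _]; exact: upper_neq0. Qed.

Lemma open_Omega : open Om.
Proof. by rewrite OmE; apply: open_connected_component; exact: open_positive. Qed.

Lemma connected_Omega : connected Om.
Proof. by rewrite OmE; exact: component_connected. Qed.

Lemma Omega_seg a b : Om a -> (forall t, 0 <= t <= 1 -> pos (seg a b t)) -> Om b.
Proof.
rewrite OmE => oa /seg_component E.
rewrite (same_connected_component oa) E; apply: connected_component_refl.
have := oa; rewrite (same_connected_component oa) E => h.
by have [C [Cb CA _] _] := h; exact: CA.
Qed.

(** [Im (H z) > 0] excludes real [z], where [H] is real. So a disc around [z] is inside the positive
    region, and a point of Omega in this disc is joined to [z] by a segment. *)
Lemma closure_Omega z : closure Om z -> z != 0 -> 0 < complex.Im (H z) -> Om z.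
Proof.
move=> /closure_normcP cz z0 Hz.
have z_ge0 : 0 <= complex.Im z.
  rewrite leNgt; apply/negP => zn.
  have [w /Omega_positive[w0 _] wz] := cz (- complex.Im z) ltac:(by rewrite oppr_gt0).
  have := le_lt_trans (ler_Im_normc _) wz.
  by rewrite ImB ltr_norml => /andP[_]; lra.
have z_gt0 : 0 < complex.Im z.
  by rewrite lt_def z_ge0 andbT; apply: contraTneq Hz => E; rewrite Im_Hf // E mul0r ltxx.
have /open_normcP/(_ z (conj z_gt0 Hz))[e e0 he] := open_positive.
have [w ow wz] := cz e e0.
apply: (Omega_seg ow) => t t01; apply: he.
have -> : seg w z t = seg z w (1 - t) by rewrite /seg rmorphB; ring.
apply: le_lt_trans wz; apply: normc_segB.
by lra.
Qed.

End OmegaRegion.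

(** * Inverting z + phi(z) on Omega *)

Section Inverse.
Variables (R : realType) (p : nat) (kappa : nat -> R).
Hypotheses (p_ge2 : (2 <= p)%N) (kappa_p : kappa p != 0).
Implicit Types (z w a b : R[i]).

Notation H := (Hf p kappa).
Notation K := (Kf p kappa).
Notation pos := (positive_region (phi p kappa)).
Notation Om := (Omega (phi p kappa)).
Notation rad := (rad p kappa).
Notation csum := (csum p kappa).

(** The property is locally constant on Omega: within a small disc, [arc_extend] moves the starting
    point along a segment. It holds at [i rad], from which a vertical half-line goes to infinity. *)
Lemma Omega_arc z : Om z -> exists g, arc_to_infty Om z g.
Proof.
have r1 := rad_ge1 p kappa.
suff : Om `<=` [set z | exists g, arc_to_infty Om z g] by exact.
apply: connected_locally_constant; first exact: connected_Omega.
  have far t : 0 <= t -> Om (0 +i* (rad + t))%C.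
    move=> t0; apply: far_Omega; first by rewrite /=; lra.
    by rewrite (le_trans _ (ler_Im_normc _)) //= ger0_norm; lra.
  exists (0 +i* rad)%C; split; first by have := far 0 (lexx _); rewrite addr0.
  exists (fun t => (0 +i* (rad + t))%C); split => //.
  - move=> t; apply/continuous_normcP => e e0; apply/nbhs_ballP; exists e => //= s.
    rewrite /ball /= distrC => ts; apply: le_lt_trans ts.
    by apply: le_trans (ler_normc_ReIm _) _; rewrite ReB ImB /= subrr normr0 add0r opprD addrACA subrr add0r.
  - by move=> s t _ _ [/addrI].
  - by rewrite addr0.
  - move=> M; exists `|M| => t Mt; apply: lt_le_trans (ler_Im_normc _) => /=.
    rewrite ger0_norm; last by have := normr_ge0 M; lra.
    by have := ler_norm M; lra.
  - by move=> t t0; apply: far; exact: ltW.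
move=> a oa; have /open_normcP/(_ a oa)[e e0 he] := @open_Omega R p kappa.
apply/near_normcP; exists e => // b ab ob.
split=> -[g ag]; apply: (arc_extend ag) => // t /andP[t0 t1]; apply: he.
  have -> : seg b a t - a = (1 - t)%:C%C * (b - a) by rewrite /seg rmorphB; ring.
  rewrite normcM normc_real ger0_norm ?subr_ge0 //; apply: le_lt_trans ab.
  by rewrite ler_piMl ?normc_ge0 //; lra.
by apply: le_lt_trans ab; apply: normc_segB; lra.
Qed.

Lemma Hf_bounded (d r : R) : 0 < d ->
  exists M, forall b, d <= normc b <= r -> normc (H b) <= M.
Proof.
move=> d0; exists (r + \sum_(1 <= n < p.+1) `|kappa n| * d^-1 ^+ n.-1) => b /andP[db br].
rewrite /Hf /phi (le_trans (ler_normcD _ _)) // lerD //.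
apply: le_trans (ler_normc_sum _ _ _) _; apply: ler_sum => n _.
rewrite normcM normc_real normcV normcX ler_wpM2l // -exprVn.
rewrite lerXn2r ?nnegrE ?invr_ge0 ?(ltW d0) ?normc_ge0 // lef_pV2 ?posrE //.
exact: lt_le_trans db.
Qed.

Lemma Kf_joint z a (e : R) : z != 0 -> a != 0 -> 0 < e ->
  exists2 d : R, 0 < d & forall z' a', normc (z' - z) < d -> normc (a' - a) < d ->
    normc (K z' a' - K z a) < e.
Proof.
move=> z0 a0 e0.
have h : (fun q : R[i]^o * R[i]^o => K q.1 q.2 : R[i]^o) @ (nbhs (z : R[i]^o), nbhs (a : R[i]^o)) -->
    (K z a : R[i]^o).
  exact: (@Kf_cvg R p kappa _ (filter_prod (nbhs (z : R[i]^o)) (nbhs (a : R[i]^o))) _ _ _ z a z0 a0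
    cvg_fst cvg_snd).
have [[A B] /= [/nbhs_normcP[d1 d10 h1] /nbhs_normcP[d2 d20 h2]] AB] :=
  (cvg_normcP _ _).1 h e e0.
exists (Num.min d1 d2); first by rewrite lt_min d10.
move=> z' a'; rewrite !lt_min => /andP[zd1 _] /andP[_ ad2].
by apply: (AB (z', a')); split; [exact: h1|exact: h2].
Qed.

Lemma normc_Hf_bounded z : z != 0 -> normc z <= normc (H z) + csum + 1.
Proof.
move=> z0; have c0 := csum_ge0 p kappa; case: (leP 1 (normc z)) => z1.
  have := Hf_near_id p kappa z1; have := ler_normcB (H z) (H z - z).
  by rewrite (_ : H z - (H z - z) = z); [lra|ring].
by have := normc_ge0 (H z); lra.
Qed.

(* A ray from 0 inside [Om] and an arc to infinity make a Jordan curve. *)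
Lemma no_access_0 :
  (forall g, jordan_curve_0_infty g -> meets_boundary g Om) ->
  exists2 d : R, 0 < d & forall z, Om z -> normc z < d -> complex.Re (H z) != 0.
Proof.
move=> jordan; have c0 := csum_ge0 p kappa; have kp0 : 0 < `|kappa p| by rewrite normr_gt0.
have C0 : 0 < 3 * (csum + 1) by lra.
(* Origin of the factor 3: [t^(p-1) H (t z)] differs from [H z] by at most
   [2 (csum + 1) |z| / |z|^(p-1)], while for imaginary [H z] the value [Im (H z) = |H z|] is at
   least [(|kappa p| - (csum + 1) |z|) / |z|^(p-1)]. *)
exists (Num.min 1 (`|kappa p| / (3 * (csum + 1)))).
  by rewrite lt_min ltr01 divr_gt0.
move=> z oz; rewrite lt_min ltr_pdivlMr // => /andP[z1 zk]; apply/eqP => Hz0.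
have zn0 := Omega_neq0 oz; have [Iz IHz] := Omega_positive oz.
have nz0 : 0 < normc z by rewrite normc_gt0.
set y := complex.Im (H z) in IHz.
have HzE : H z = 'i%C * y%:C%C.
  by rewrite [LHS]complexE Hz0 rmorph0 add0r.
have ray t : 0 < t <= 1 -> pos (t%:C%C * z).
  move=> /andP[t0 t1]; split; first by rewrite /upper_half_plane /= ImZ mulr_gt0.
  have tz0 : t%:C%C * z != 0 by rewrite mulf_neq0 // fmorph_eq0 gt_eqF.
  have ntz : normc (t%:C%C * z) <= normc z.
    by rewrite normcM normc_real gtr0_norm // ler_piMl ?normc_ge0.
  have h1 := Hf_near0 p_ge2 kappa_p (ltW z1) zn0.
  have h2 := Hf_near0 p_ge2 kappa_p (le_trans ntz (ltW z1)) tz0.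
  have h3 : (csum + 1) * normc (t%:C%C * z) <= (csum + 1) * normc z.
    by rewrite ler_wpM2l //; lra.
  set D := (t%:C%C * z) ^+ p.-1 * H (t%:C%C * z) - z ^+ p.-1 * H z.
  have hD : normc D <= 2 * (csum + 1) * normc z.
    have -> : D = ((t%:C%C * z) ^+ p.-1 * H (t%:C%C * z) - (kappa p)%:C%C) -
      (z ^+ p.-1 * H z - (kappa p)%:C%C) by rewrite /D; ring.
    by apply: le_trans (ler_normcB _ _) _; lra.
  have zp0 : z ^+ p.-1 != 0 by rewrite expf_neq0.
  have E : (t ^+ p.-1)%:C%C * H (t%:C%C * z) = H z + D / z ^+ p.-1.
    rewrite /D exprMn rmorphXn; move: (H _) (H z) (z ^+ p.-1) zp0 (t%:C%C ^+ _) => A B X X0 Y.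
    by field.
  have tp0 : 0 < t ^+ p.-1 by rewrite exprn_gt0.
  have : 0 < complex.Im ((t ^+ p.-1)%:C%C * H (t%:C%C * z)).
    rewrite E ImD -/y.
    have h4 : normc (D / z ^+ p.-1) * normc z ^+ p.-1 = normc D.
      by rewrite normcf_div normcX divfK // expf_neq0 // normc_eq0.
    have h5 : normc (z ^+ p.-1 * H z) = normc z ^+ p.-1 * y.
      rewrite normcM normcX HzE normcM normc_real gtr0_norm //; congr (_ * _).
      by rewrite /normc /= expr0n /= add0r expr1n sqrtr1 mul1r.
    have h6 : `|kappa p| <= normc z ^+ p.-1 * y + (csum + 1) * normc z.
      rewrite -h5 -normc_real; have := lerB_normc (kappa p)%:C%C (z ^+ p.-1 * H z).
      by rewrite normc_distC; lra.
    have zpp : 0 < normc z ^+ p.-1 by rewrite exprn_gt0.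
    have h7 : normc (D / z ^+ p.-1) < y.
      by rewrite -(ltr_pM2r zpp) h4 (mulrC y); lra.
    have := ler_Im_normc (D / z ^+ p.-1); rewrite ler_norml => /andP[+ _]; lra.
  by rewrite ImZ pmulr_rgt0.
have segray t : seg 0 z t = t%:C%C * z by rewrite /seg subr0 add0r.
have rayO t : 0 < t <= 1 -> Om (t%:C%C * z).
  move=> /andP[t0 t1]; apply: (Omega_seg oz) => s /andP[s0 s1].
  have -> : seg z (t%:C%C * z) s = (1 - s + s * t)%:C%C * z.
    by rewrite /seg rmorphD rmorphM rmorphB; ring.
  by apply: ray; apply/andP; split; nra.
have [g ag] := Omega_arc oz.
have [h [ch ih h0 hoo hO]] : exists h, arc_to_infty Om 0 h.
  by apply: (arc_extend ag oz) => t t01; rewrite segray; exact: rayO.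
have [|t t0 [_]] := jordan h; last first.
  by apply; apply/open_nbhs_nbhs; split; [exact: open_Omega|exact: hO].
split => //.
- by apply: continuous_subspaceT => t; exact: ch.
- apply/cvgryPgt => M; have [S hS] := hoo M; near=> t; apply: hS.
  by near: t; apply: nbhs_pinfty_gt; exact: num_real.
- move=> t; rewrite le_eqVlt => /orP[/eqP <-|/hO /Omega_positive[/ltW //]].
  by rewrite h0.
Unshelve. all: by end_near. Qed.

Section NoAccess.
Variable del : R.
Hypotheses (del_gt0 : 0 < del)
  (no_access : forall z, Om z -> normc z < del -> complex.Re (H z) != 0).

Lemma large_preimage w : Num.max (csum * 2 ^+ p) (2 * rad) <= normc w -> 0 < complex.Im w ->
  exists z, [/\ Om z, H z = w, normc w / 2 <= normc z & rad <= normc z].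
Proof.
have r1 := rad_ge1 p kappa; rewrite ge_max => /andP[h1 h2] w0.
have [|z [z0 Hz zw]] := Hf_large p_ge2 kappa_p h1; first by lra.
have zr : rad <= normc z by lra.
exists z; split => //; apply: far_Omega => //.
have [k k2] := Im_Hf_far zr; rewrite Hz => E; move: w0; rewrite E pmulr_lgt0 //; lra.
Qed.

(** With [b = z] this excludes critical points, with [b != z] coincidences [H b = H z]. The points
    having such a partner [b] in Omega form a relatively open set, since roots of [Kpoly] move
    little, and a relatively closed one, since partners accumulate at a root of [Qpoly], which
    [closure_Omega] keeps inside Omega. *)
Lemma Kf_Omega_neq0 z b : Om z -> Om b -> K z b != 0.
Proof.
move=> oz ob; apply/eqP => Kzb.
have p1 : (0 < p.-1)%N by lia.
have r1 := rad_ge1 p kappa.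
have [M hM] := @Hf_bounded del rad del_gt0.
(* [y] exceeds [|H|] on [del <= |b| <= rad]. So a partner of a point over [i y] is not there, nor
   far by [Kf_far_neq0], nor near 0 by [no_access]. *)
pose y := Num.max (Num.max (csum * 2 ^+ p) (2 * rad)) (`|M| + 1).
have y_gt0 : 0 < y by rewrite /y lt_max ltr_wpDl ?orbT.
have ny : normc (0 +i* y)%C = y by rewrite /normc /= expr0n /= add0r sqrtr_sqr gtr0_norm.
have [|//|z0 [oz0 Hz0 _ z0r]] := @large_preimage (0 +i* y)%C.
  by rewrite ny /y le_max lexx.
suff : Om `<=` [set z | exists2 b, Om b & K z b = 0].
  move=> /(_ _ oz0)[b0 ob0 K0].
  have b00 := Omega_neq0 ob0; have z00 := Omega_neq0 oz0.
  have Hb0 : H b0 = (0 +i* y)%C.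
    apply/esym/eqP; rewrite -Hz0 -subr_eq0 HfB // K0 mulr0 //.
  case: (leP rad (normc b0)) => br.
    by have := Kf_far_neq0 z0r br; rewrite K0 eqxx.
  case: (leP del (normc b0)) => bd.
    have := hM b0; rewrite bd (ltW br) Hb0 ny => /(_ isT); apply/negP; rewrite -ltNge.
    by rewrite /y lt_max; apply/orP; right; have := ler_norm M; lra.
  by have := no_access ob0 bd; rewrite Hb0 /= eqxx.
apply: connected_clopen; first exact: connected_Omega.
- by exists z; split => //; exists b.
- move=> {oz ob Kzb}a oa [c oc Kac].
  have a0 := Omega_neq0 oa; have c0 := Omega_neq0 oc.
  have /open_normcP/(_ c oc)[e e0 he] := @open_Omega R p kappa.
  have cp : 0 < normc c ^+ p.-1 by rewrite exprn_gt0 ?normc_gt0.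
  have [d d0 hd] := @Kf_joint a c (e ^+ p.-1 / normc c ^+ p.-1) a0 c0
    ltac:(by rewrite divr_gt0 // exprn_gt0).
  apply/near_normcP; exists d => // a' a'd oa'.
  have [mK sK] := Kpoly_monic p_ge2 kappa_p a'.
  have [|c' rc'] := near_root c mK; first by rewrite sK.
  rewrite sK (Kpoly_hornerE p_ge2 kappa_p) // normcM normcX => h.
  have [c'0 Kc'] := root_Kpoly p_ge2 kappa_p (Omega_neq0 oa') rc'.
  exists c'; last by rewrite Kf_sym.
  apply: he; rewrite normc_distC -(ltr_pXn2r p1) ?nnegrE ?normc_ge0 ?(ltW e0) //.
  apply: le_lt_trans h _; rewrite mulrC -ltr_pdivlMr // Kf_sym.
  by have := hd a' c a'd; rewrite subrr normc0 Kac subr0; exact.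
move=> {oz ob Kzb}a oa /closure_normcP ca; have a0 := Omega_neq0 oa.
have [mQ sQ] := Qpoly_monic p_ge2 kappa_p (H a).
pose P (e : R) c := Om c /\ exists a', [/\ Om a', normc (a' - a) < e & K a' c = 0].
have [|||c rc hc] := @limit_root R (Qpoly p kappa (H a)) P mQ.
- by rewrite sQ; lia.
- move=> d e c de [oc [a' [oa' a'd Kc]]]; split => //; exists a'; split => //.
  exact: lt_le_trans de.
(* Partners satisfy [H c = H a'], hence are bounded by [B], and [Qpoly (H a)] tends to 0 along
   them. *)
- move=> e e0; pose B := normc (H a) + csum + 2.
  have cs0 := csum_ge0 p kappa.
  have B0 : 0 < B by rewrite /B; have := normc_ge0 (H a); lra.
  have Bp0 : 0 < B ^+ p.-1 by rewrite exprn_gt0.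
  have e20 : 0 < Num.min 1 (e / B ^+ p.-1) by rewrite lt_min ltr01 divr_gt0.
  have := (@continuous_normcP R _ (H : R[i]^o -> R[i]^o) a).1 (Hf_continuous a0) _ e20.
  move=> /near_normcP[d d0 hd].
  have [a' [oa' [c oc Kc]] a'd] := ca (Num.min d e) ltac:(by rewrite lt_min d0).
  move: a'd; rewrite lt_min => /andP[a'd a'e].
  exists c; first by split => //; exists a'.
  have c0 := Omega_neq0 oc; have a'0 := Omega_neq0 oa'.
  have Hc : H c = H a' by apply/esym/eqP; rewrite -subr_eq0 HfB // Kc mulr0.
  have := hd a' a'd; rewrite lt_min => /andP[h1 h2].
  rewrite (Qpoly_hornerE p_ge2 kappa_p) // normcM normcX Hc.
  have cB : normc c <= B.
    apply: le_trans (normc_Hf_bounded c0) _; rewrite Hc /B.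
    by have := lerB_normc (H a') (H a); lra.
  apply: le_lt_trans (_ : _ <= B ^+ p.-1 * normc (H a' - H a)) _.
    by rewrite ler_wpM2r ?normc_ge0 // lerXn2r ?nnegrE ?normc_ge0 ?(ltW B0).
  by rewrite mulrC -ltr_pdivlMr.
have [c0 Hc] := root_Qpoly p_ge2 kappa_p rc.
have oc : Om c.
  apply: closure_Omega => //; last by rewrite Hc; have [] := Omega_positive oa.
  by apply/closure_normcP => e e0; have [b' [ob' _] b'c] := hc e e0; exists b'.
exists c => //; apply/eqP; apply: contraT => Kac.
have [d d0 hd] := @Kf_joint a c (normc (K a c)) a0 c0 ltac:(by rewrite normc_gt0).
have [c' [oc' [a' [oa' a'd Kc']]] c'd] := hc d d0.
by have := hd a' c' a'd c'd; rewrite Kc' sub0r normcNE ltxx.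
Qed.

Lemma Hf_Omega_inj a b : Om a -> Om b -> H a = H b -> a = b.
Proof.
move=> oa ob Hab; apply/eqP; rewrite -subr_eq0.
have := HfB p kappa (Omega_neq0 oa) (Omega_neq0 ob); rewrite Hab subrr => /esym/eqP.
by rewrite mulf_eq0 (negbTE (Kf_Omega_neq0 oa ob)) orbF.
Qed.

(** The image of Omega is open by [Hf_open]. It is closed in the upper half-plane: preimages of
    converging points stay bounded and accumulate at a root of [Qpoly], which lies in Omega by
    [closure_Omega]. *)
Lemma Hf_Omega_surj w : 0 < complex.Im w -> exists2 z, Om z & H z = w.
Proof.
suff : @upper_half_plane R `<=` [set w | exists2 z, Om z & H z = w] by exact.
have r1 := rad_ge1 p kappa.
apply: connected_clopen; first exact: connected_upper.
- pose y := Num.max (csum * 2 ^+ p) (2 * rad).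
  have y_gt0 : 0 < y by rewrite /y lt_max; apply/orP; right; lra.
  have ny : normc (0 +i* y)%C = y by rewrite /normc /= expr0n /= add0r sqrtr_sqr gtr0_norm.
  have [|//|z0 [oz0 Hz0 _ _]] := @large_preimage (0 +i* y)%C; first by rewrite ny.
  by exists (0 +i* y)%C; split => //; exists z0.
- move=> a a0 [z oz Hz].
  have /open_normcP/(_ z oz)[e e0 he] := @open_Omega R p kappa.
  have [d d0 hd] := Hf_open p_ge2 kappa_p (Omega_neq0 oz) e0.
  apply/near_normcP; exists d => // a' a'd _.
  by have [|z' [_ Hz' /he oz']] := hd a'; [rewrite Hz|exists z'].
move=> a a0 /closure_normcP ca.
have [mQ sQ] := Qpoly_monic p_ge2 kappa_p a.
have [|//||z rz hz] := @limit_root R (Qpoly p kappa a) (fun _ z => Om z) mQ.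
- by rewrite sQ; lia.
- move=> e e0; pose B := normc a + csum + 2.
  have cs0 := csum_ge0 p kappa.
  have B0 : 0 < B by rewrite /B; have := normc_ge0 a; lra.
  have Bp0 : 0 < B ^+ p.-1 by rewrite exprn_gt0.
  have e20 : 0 < Num.min 1 (e / B ^+ p.-1) by rewrite lt_min ltr01 divr_gt0.
  have [a' [_ [c oc Hc]]] := ca _ e20; rewrite lt_min => /andP[h1 h2].
  exists c => //; have c0 := Omega_neq0 oc.
  rewrite (Qpoly_hornerE p_ge2 kappa_p) // normcM normcX Hc.
  have cB : normc c <= B.
    apply: le_trans (normc_Hf_bounded c0) _; rewrite Hc /B.
    by have := lerB_normc a' a; lra.
  apply: le_lt_trans (_ : _ <= B ^+ p.-1 * normc (a' - a)) _.
    by rewrite ler_wpM2r ?normc_ge0 // lerXn2r ?nnegrE ?normc_ge0 ?(ltW B0).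
  by rewrite mulrC -ltr_pdivlMr.
have [z0 Hz] := root_Qpoly p_ge2 kappa_p rz.
exists z => //; apply: closure_Omega => //; last by rewrite Hz.
by apply/closure_normcP => e e0; exact: hz.
Qed.

End NoAccess.

Lemma inverse_exists :
  (forall g, jordan_curve_0_infty g -> meets_boundary g Om) ->
  exists (F : R[i] -> R[i]) (d L : R), [/\ 0 < d, 1 <= L,
    (forall w, 0 < complex.Im w -> [/\ 0 < complex.Im (F w), H (F w) = w & d <= normc (F w)]),
    (forall w w', 0 < complex.Im w -> 0 < complex.Im w' -> K (F w) (F w') != 0) &
    (forall w, 0 < complex.Im w -> {for (w : R[i]^o), continuous (F : R[i]^o -> R[i]^o)}) /\
    (forall w, 0 < complex.Im w -> L <= normc w -> normc w / 2 <= normc (F w))].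
Proof.
move=> /no_access_0[del del0 hdel].
have pE : p.-1 = p.-2.+1 by move: p_ge2; clear; case: p => [|[]].
have r1 := rad_ge1 p kappa; have c0 := csum_ge0 p kappa.
have exF w : exists z, 0 < complex.Im w -> Om z /\ H z = w.
  have [w0|w0] := ltP 0 (complex.Im w); last by exists 0.
  by have [z oz Hz] := Hf_Omega_surj del0 w0; exists z.
have [F hF] := choice exF.
pose L := Num.max (csum * 2 ^+ p) (2 * rad).
have L2 : 2 * rad <= L by rewrite /L le_max lexx orbT.
have big w : 0 < complex.Im w -> L <= normc w -> normc w / 2 <= normc (F w).
  move=> w0 wL; have [z [oz Hz zw _]] := large_preimage wL w0.
  have [oF HF] := hF w w0.
  by rewrite (Hf_Omega_inj del0 hdel oF oz) // HF Hz.
have kp0 : 0 < `|kappa p| by rewrite normr_gt0.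
(* If [|F w| < d <= 1], then [|w| < L], because [|F w| >= |w| / 2] beyond [L]; hence
   [|kappa p| <= (csum + 1) |F w| + L |F w|], which the last two bounds contradict. *)
pose d := Num.min 1 (Num.min (`|kappa p| / (2 * (csum + 1))) (`|kappa p| / (2 * L))).
have d0 : 0 < d by rewrite !lt_min ltr01 !divr_gt0 //; lra.
exists F, d, L; split => //; [by lra| | |split => //].
- move=> w w0; have [oF HF] := hF w w0; have [F0 _] := Omega_positive oF.
  split => //; rewrite leNgt; apply/negP; rewrite !lt_min => /and3P[F1 F2 F3].
  have Fn0 := Omega_neq0 oF; have Fp0 : 0 < normc (F w) by rewrite normc_gt0.
  have wL : normc w < L.
    rewrite ltNge; apply/negP => wL; have := big w w0 wL; lra.
  have := Hf_near0 p_ge2 kappa_p (ltW F1) Fn0; rewrite HF => h.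
  move: F2 F3; rewrite !ltr_pdivlMr; [|by lra|by lra] => F2 F3.
  have h2 := lerB_normc (kappa p)%:C%C (F w ^+ p.-1 * w).
  rewrite normc_real (normc_distC (kappa p)%:C%C) normcM normcX in h2.
  have h3 : normc (F w) ^+ p.-1 * normc w <= normc (F w) * L.
    apply: ler_pM; rewrite ?exprn_ge0 ?normc_ge0 //; last exact: ltW.
    by rewrite pE exprS ler_piMr ?normc_ge0 // exprn_ile1 ?normc_ge0 // ltW.
  lra.
- move=> w w' w0 w'0; apply: (Kf_Omega_neq0 del0 hdel).
    by have [] := hF w w0.
  by have [] := hF w' w'0.
(* Openness of [H] gives a preimage of [w'] near [F w], and injectivity on Omega identifies it with
   [F w']. *)
move=> w w0; have [oF HF] := hF w w0; apply/continuous_normcP => e e0.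
have /open_normcP/(_ _ oF)[e1 e10 he] := @open_Omega R p kappa.
have [d1 d10 hd] := @Hf_open _ _ _ p_ge2 kappa_p (F w) (Num.min e e1) (Omega_neq0 oF)
  ltac:(by rewrite lt_min e0).
apply/near_normcP; exists (Num.min d1 (complex.Im w)); first by rewrite lt_min d10.
move=> w'; rewrite lt_min => /andP[w'd w'w].
have w'0 : 0 < complex.Im w'.
  have := le_lt_trans (ler_Im_normc _) w'w; rewrite ImB ltr_norml => /andP[+ _]; lra.
have [|z [_ Hz]] := hd w'; first by rewrite HF.
rewrite lt_min => /andP[ze ze1]; have [oF' HF'] := hF w' w'0.
by rewrite (Hf_Omega_inj del0 hdel oF' (he _ ze1)) // HF' Hz.
Qed.

End Inverse.

(** * A measure from the boundary values of the inverse *)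

Section Density.
Local Open Scope ereal_scope.
Variables (R : realType) (g : R -> R).
Notation leb := (@lebesgue_measure R).
Hypotheses (g_ge0 : forall x, (0 <= g x)%R)
  (ig : leb.-integrable [set: R] (EFin \o g))
  (g1 : \int[leb]_x (g x)%:E = 1).

Definition density_measure : set (measurableTypeR R) -> \bar R :=
  fun A => \int[leb]_(x in A) (g x)%:E.

Let density0 : density_measure set0 = 0.
Proof. by rewrite /density_measure integral_set0. Qed.

Let density_ge0 A : 0 <= density_measure A.
Proof. by apply: integral_ge0 => x _; rewrite lee_fin. Qed.

Let density_sigma_additive : semi_sigma_additive density_measure.
Proof.
move=> A mA tA mUA; rewrite /density_measure integral_bigcup //; last first.
  exact: (integrableS _ _ (subsetT _) ig).
apply: is_cvg_ereal_nneg_natsum_cond => n _ _.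
by apply: integral_ge0 => x _; rewrite lee_fin.
Qed.

HB.instance Definition _ := isMeasure.Build _ _ _
  density_measure density0 density_ge0 density_sigma_additive.

Let density_setT : density_measure [set: _] = 1.
Proof. exact: g1. Qed.

HB.instance Definition _ :=
  @Measure_isProbability.Build _ _ R density_measure density_setT.

Let mg : measurable_fun [set: R] g.
Proof. by apply/measurable_EFinP; exact: measurable_int ig. Qed.

Lemma density_dominates : density_measure `<< leb.
Proof.
apply/null_content_dominatesP => A mA A0; apply: null_set_integral => //.
exact/measurable_EFinP/measurable_funTS.
Qed.

(** [g] and the Radon-Nikodym derivative have the same integrals over measurable sets, hence agree
    almost everywhere, and change of variables for the latter gives the formula. *)
Lemma integral_density f : density_measure.-integrable [set: R] f ->
  \int[density_measure]_x f x = \int[leb]_x (f x * (g x)%:E).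
Proof.
move=> fi; have mf := measurable_int _ fi.
have ri : leb.-integrable [set: R] (Radon_Nikodym (charge_of_finite_measure density_measure) leb).
  by apply: Radon_Nikodym_integrable; exact: density_dominates.
rewrite -(Radon_Nikodym_change_of_variables density_dominates) //.
apply: ae_eq_integral => //.
- apply: emeasurable_funM => //.
  exact: measurable_int ri.
- by apply: emeasurable_funM => //; exact/measurable_EFinP.
apply: ae_eqe_mul2l; apply: integral_ae_eq => //.
  exact/measurable_EFinP.
move=> A _ mA; rewrite -Radon_Nikodym_integral //.
exact: density_dominates.
Qed.

Lemma density_exists : exists mu : probability (measurableTypeR R) R,
  (forall A, measurable A -> mu A = \int[leb]_(x in A) (g x)%:E) /\
  (forall f, mu.-integrable [set: R] f -> \int[mu]_x f x = \int[leb]_x (f x * (g x)%:E)).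
Proof. by exists density_measure; split => //; exact: integral_density. Qed.

End Density.

(* Derivatives, in the form of Caratheodory, of complex functions of a real
   variable. *)
Section ComplexDerivative.
Variable R : realType.
Implicit Types (f g : R -> R[i]) (x : R) (c d e : R[i]).

Definition cderiv f x d := exists q : R -> R[i]^o,
  [/\ forall y, f y - f x = (y - x)%:C%C * q y, {for x, continuous q} & q x = d].

Lemma cderiv_continuous f x d : cderiv f x d -> {for x, continuous (f : R -> R[i]^o)}.
Proof.
case=> q [fq cq _].
have fE : (f : R -> R[i]^o) = (fun y => f x + (y - x)%:C%C * q y).
  by apply/funext => y; rewrite -fq addrC subrK.
have h1 : (fun y : R => (y - x)%:C%C : R[i]^o) @ x --> ((x - x)%:C%C : R[i]^o).
  have h0 : (fun y : R => y - x) @ x --> x - x by apply: cvgB; [exact: cvg_id|exact: cvg_cst].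
  by apply: cvg_comp; [exact: h0|exact: continuous_realC].
have h2 : (fun=> f x : R[i]^o) @ x --> (f x : R[i]^o) by exact: cvg_cst.
have h : (fun y => f x + (y - x)%:C%C * q y : R[i]^o) @ x --> (f x + (x - x)%:C%C * q x : R[i]^o).
  exact: cvgD h2 (@cvg_mulC R R _ _ _ _ _ _ h1 cq).
by move: h; rewrite -fE subrr mul0r addr0.
Qed.

Lemma cderiv_cst c x : cderiv (fun=> c) x 0.
Proof.
exists (fun=> 0); split; [by move=> y; rewrite subrr mulr0| |by []].
exact: cvg_cst.
Qed.

Lemma cderiv_line c x : cderiv (fun y => y%:C%C + c) x 1.
Proof.
exists (fun=> 1); split; [|exact: cvg_cst|by []].
by move=> y; rewrite mulr1 rmorphB; ring.
Qed.

Lemma cderivD f g x d e : cderiv f x d -> cderiv g x e ->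
  cderiv (fun y => f y + g y) x (d + e).
Proof.
case=> q [fq cq <-] [r [gr cr <-]]; exists (fun y => q y + r y); split; last by [].
  by move=> y; rewrite mulrDr -fq -gr opprD addrACA.
have h : (fun y => q y + r y : R[i]^o) @ x --> (q x + r x : R[i]^o) := cvgD cq cr.
exact: h.
Qed.

Lemma cderivM f g x d e : cderiv f x d -> cderiv g x e ->
  cderiv (fun y => f y * g y) x (d * g x + f x * e).
Proof.
move=> df dg; have cg := cderiv_continuous dg.
case: df dg => q [fq cq <-] [r [gr cr <-]].
exists (fun y => q y * g y + f x * r y); split; last by [].
  move=> y; rewrite mulrDr [_ * (q y * _)]mulrA -fq [_ * (f x * _)]mulrCA -gr.
  by rewrite mulrBl mulrBr addrA subrK.
have h2 : (fun=> f x : R[i]^o) @ x --> (f x : R[i]^o) by exact: cvg_cst.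
have h : (fun y => q y * g y + f x * r y : R[i]^o) @ x --> (q x * g x + f x * r x : R[i]^o).
  exact: (cvgD (@cvg_mulC R R _ _ _ _ _ _ cq cg) (@cvg_mulC R R _ _ _ _ _ _ h2 cr)).
exact: h.
Qed.

Lemma cderivV f x d : (forall y, f y != 0) -> cderiv f x d ->
  cderiv (fun y => (f y)^-1) x (- (d * ((f x)^-1 * (f x)^-1))).
Proof.
move=> f0 df; have cf := cderiv_continuous df.
case: df => q [fq cq <-].
exists (fun y => - (q y * ((f y)^-1 * (f x)^-1))); split; last by [].
  move=> y; rewrite mulrN mulrA -fq; field.
  by rewrite !f0.
have h2 : (fun=> (f x)^-1 : R[i]^o) @ x --> ((f x)^-1 : R[i]^o) by exact: cvg_cst.
have h3 : (fun y => (f y)^-1 : R[i]^o) @ x --> ((f x)^-1 : R[i]^o) by exact: (@cvg_invC R R _ _ f _ (f0 x) cf).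
have h : (fun y => - (q y * ((f y)^-1 * (f x)^-1)) : R[i]^o) @ x -->
    (- (q x * ((f x)^-1 * (f x)^-1)) : R[i]^o).
  exact: (cvgN (@cvg_mulC R R _ _ _ _ _ _ cq (@cvg_mulC R R _ _ _ _ _ _ h3 h2))).
exact: h.
Qed.

Lemma cderivX f x d n : cderiv f x d ->
  cderiv (fun y => f y ^+ n) x (n%:R * f x ^+ n.-1 * d).
Proof.
move=> df; elim: n => [|n IH].
  have -> : (fun y => f y ^+ 0) = (fun=> 1) by apply/funext => y; rewrite expr0.
  by rewrite mul0r mul0r; exact: cderiv_cst.
have -> : (fun y => f y ^+ n.+1) = (fun y => f y * f y ^+ n).
  by apply/funext => y; rewrite exprS.
have := cderivM df IH; congr (cderiv _ _ _).
by case: n {IH} => [|n]; rewrite ?expr0 /=; [ring|rewrite !exprS -[n.+2%:R]natr1; ring].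
Qed.

Lemma cderiv_sum (I : Type) (r : seq I) (P : pred I) (f : I -> R -> R[i]) x (d : I -> R[i]) :
  (forall i, P i -> cderiv (f i) x (d i)) ->
  cderiv (fun y => \sum_(i <- r | P i) f i y) x (\sum_(i <- r | P i) d i).
Proof.
move=> h; elim: r => [|i r IH].
  have -> : (fun y => \sum_(i <- [::] | P i) f i y) = (fun=> 0).
    by apply/funext => y; rewrite big_nil.
  by rewrite big_nil; exact: cderiv_cst.
have -> : (fun y => \sum_(j <- i :: r | P j) f j y) =
  (fun y => (if P i then f i y else 0) + \sum_(j <- r | P j) f j y).
  by apply/funext => y; rewrite big_cons; case: (P i); rewrite ?add0r.
rewrite big_cons; have [Pi|_] := boolP (P i); first exact: cderivD (h i Pi) IH.
by move: (cderivD (cderiv_cst 0 x) IH); rewrite add0r.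
Qed.

Lemma caratheodory_is_derive (f q : R -> R) x :
  (forall y, f y - f x = (y - x) * q y) -> {for x, continuous q} -> is_derive x 1 f (q x).
Proof.
move=> fq cq.
have h : (fun t : R => t^-1 *: ((f \o shift x) (t *: (1 : R)) - f x)) @ 0^' --> q x.
  have h0 : (fun t : R => t + x) @ 0^' --> x.
    rewrite -[X in _ --> X]add0r; apply: cvgD; last exact: cvg_cst.
    exact: nbhs_dnbhs.
  have h1 : (fun t : R => q (t + x)) @ 0^' --> q x.
    by apply: cvg_comp; [exact: h0|exact: cq].
  apply: cvg_trans h1; apply: near_eq_cvg; near=> t.
  have t0 : t != 0 by near: t; exact: nbhs_dnbhs_neq.
  by rewrite /= /shift /= fq addrK -[t *: 1]/(t * 1) mulr1 -[RHS]/(t^-1 * (t * _)) mulKf.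
have dc : derivable f x 1 by apply/cvg_ex; exists (q x).
by apply: DeriveDef => //; rewrite /derive; apply: cvg_lim.
Unshelve. all: by end_near. Qed.

Lemma cderiv_Im f x d : cderiv f x d ->
  is_derive x 1 (fun y => complex.Im (f y)) (complex.Im d).
Proof.
case=> q [fq cq <-].
apply: (@caratheodory_is_derive _ (fun y => complex.Im (q y))) => [y|].
  by rewrite -ImB fq ImZ.
by apply: cvg_comp; [exact: cq|exact: continuous_Im].
Qed.

Lemma cderiv_Re f x d : cderiv f x d ->
  is_derive x 1 (fun y => complex.Re (f y)) (complex.Re d).
Proof.
case=> q [fq cq <-].
apply: (@caratheodory_is_derive _ (fun y => complex.Re (q y))) => [y|].
  by rewrite -ReB fq ReZ.
by apply: cvg_comp; [exact: cq|exact: continuous_Re].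
Qed.

(* On the upper half-plane, [- atan (x / y)] differs from the argument of
   [x + i y] by a constant. *)
Definition carg z : R := - atan (complex.Re z / complex.Im z).

(** The argument is the imaginary part of the logarithm, whose derivative along [f] is [d / f x]. *)
Lemma cderiv_carg f x d : 0 < complex.Im (f x) -> cderiv f x d ->
  is_derive x 1 (fun y => carg (f y)) (complex.Im (d / f x)).
Proof.
move=> f0 df; have dR := cderiv_Re df; have dI := cderiv_Im df.
have I0 : complex.Im (f x) != 0 by rewrite gt_eqF.
have dV := is_deriveV I0 dI.
have dM := is_deriveM dR dV.
have dA := is_derive1_comp (is_derive1_atan _) dM.
have dN := is_deriveN dA.
apply: is_derive_eq dN _.
have N0 : complex.Re (f x) ^+ 2 + complex.Im (f x) ^+ 2 != 0.
  by rewrite gt_eqF // ltr_wpDl ?sqr_ge0 // exprn_gt0.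
rewrite !fctE ImM ImV ReV normcE_sqr.
move: (complex.Re (f x)) (complex.Im (f x)) (complex.Re d) (complex.Im d) I0 N0
  => X Y X' Y' Y0 N0.
change (- ((1 + (X * Y^-1) ^+ 2)^-1 * (X * (- Y ^- 2 * Y') + Y^-1 * X')) =
  X' * (- Y / (X ^+ 2 + Y ^+ 2)) + Y' * (X / (X ^+ 2 + Y ^+ 2))).
have N1 : 1 + (X * Y^-1) ^+ 2 = (X ^+ 2 + Y ^+ 2) / Y ^+ 2 by field.
by rewrite N1; field; rewrite Y0 N0.
Qed.

End ComplexDerivative.

(** * Boundary values of the inverse and moments of the density *)

Section Boundary.
Variables (R : realType) (p : nat) (kappa : nat -> R).
Hypotheses (p_ge2 : (2 <= p)%N) (kappa_p : kappa p != 0).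
Notation H := (Hf p kappa).
Notation K := (Kf p kappa).
Notation rad := (rad p kappa).
Notation csum := (csum p kappa).
Variables (F : R[i] -> R[i]) (d L : R).
Hypotheses (d_gt0 : 0 < d) (L_ge1 : 1 <= L)
  (F_inv : forall w, 0 < complex.Im w -> [/\ 0 < complex.Im (F w), H (F w) = w & d <= normc (F w)])
  (F_neq0 : forall w w', 0 < complex.Im w -> 0 < complex.Im w' -> K (F w) (F w') != 0)
  (F_cont : forall w, 0 < complex.Im w -> {for (w : R[i]^o), continuous (F : R[i]^o -> R[i]^o)})
  (F_large : forall w, 0 < complex.Im w -> L <= normc w -> normc w / 2 <= normc (F w)).
Implicit Types (x t e : R) (w z a : R[i]).

Let Fn0 w : 0 < complex.Im w -> F w != 0.
Proof. by move=> /F_inv[/upper_neq0]. Qed.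

Lemma continuous_vertical x t : {for t, continuous (fun t => (x +i* t)%C : R[i]^o)}.
Proof.
apply/continuous_normcP => e e0; apply/nbhs_ballP; exists e => //= s.
rewrite /ball /= distrC => ts; apply: le_lt_trans ts.
by apply: le_trans (ler_normc_ReIm _) _; rewrite ReB ImB /= subrr normr0 add0r.
Qed.

Lemma continuous_horizontal x t : {for x, continuous (fun x => (x +i* t)%C : R[i]^o)}.
Proof.
apply/continuous_normcP => e e0; apply/nbhs_ballP; exists e => //= s.
rewrite /ball /= distrC => ts; apply: le_lt_trans ts.
by apply: le_trans (ler_normc_ReIm _) _; rewrite ReB ImB /= subrr normr0 addr0.
Qed.

Lemma normc_vertical x t : normc ((x +i* t)%C - x%:C%C) = `|t|.
Proof.
have -> : (x +i* t)%C - x%:C%C = (0 +i* t)%C.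
  by apply/eqP; rewrite eq_complex ReB ImB /= subrr subr0 !eqxx.
by rewrite /normc expr0n /= add0r sqrtr_sqr.
Qed.

(** At [F (x + i t)] the polynomial [Qpoly x] has the value [i t F^(p-1)], which tends to 0, so
    [F (x + i t)] approaches the finite set of roots. By connectedness of the interval of parameters
    it stays near a single root [l]. *)
Lemma boundary_limit x : exists l : R[i], forall e, 0 < e ->
  exists2 e0, 0 < e0 & forall t, 0 < t < e0 -> normc (F (x +i* t)%C - l) < e.
Proof.
pose Q := Qpoly p kappa x%:C%C.
have [mQ sQ] := Qpoly_monic p_ge2 kappa_p x%:C%C; rewrite -/Q in mQ sQ.
have sQ1 : (1 < size Q)%N by rewrite sQ ltnS ltnW.
pose B := `|x| + csum + 2.
have B0 : 0 < B by have := csum_ge0 p kappa; have := normr_ge0 x; rewrite /B; lra.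
have Bp : 0 < B ^+ p.-1 by rewrite exprn_gt0.
have QF t : 0 < t <= 1 -> normc Q.[F (x +i* t)%C] <= B ^+ p.-1 * t.
  move=> /andP[t0 t1]; have [_ HF _] := F_inv (w := (x +i* t)%C) t0.
  have F0 := @Fn0 (x +i* t)%C t0.
  rewrite /Q Qpoly_hornerE // HF normcM normcX normc_vertical gtr0_norm //.
  rewrite ler_wpM2r ?(ltW t0) // lerXn2r ?nnegrE ?normc_ge0 ?(ltW B0) //.
  have := normc_Hf_bounded p kappa F0; rewrite HF.
  have := ler_normc_ReIm (x +i* t)%C; rewrite /= (gtr0_norm t0) /B; lra.
have [||l rl hl] := @limit_root R Q (fun e z => exists2 t, 0 < t < e & z = F (x +i* t)%C) mQ sQ1.
- by move=> e e' z ee' [t /andP[t0 te] ->]; exists t => //; rewrite t0 (lt_le_trans te).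
- move=> e e0; pose t := Num.min 1 (Num.min e (e / B ^+ p.-1)) / 2.
  have m0 : 0 < Num.min 1 (Num.min e (e / B ^+ p.-1)) by rewrite !lt_min ltr01 e0 divr_gt0.
  have t0 : 0 < t by rewrite /t divr_gt0.
  have tm : t < Num.min 1 (Num.min e (e / B ^+ p.-1)) by rewrite /t; lra.
  move: tm; rewrite !lt_min => /and3P[t1 te tB].
  exists (F (x +i* t)%C); first by exists t => //; rewrite t0.
  by apply: le_lt_trans (QF _ _) _; rewrite ?t0 ?(ltW t1) // mulrC -ltr_pdivlMr.
have [rs QE] := closed_field_poly_normal Q.
rewrite (monicP mQ) scale1r in QE.
have rootE a : root Q a = (a \in rs) by rewrite QE root_prod_XsubC.
(* Roots other than [l] are at distance at least [2 s] from it, so the discs of radius [h <= s]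
   around [l] and around any other root are disjoint. *)
have [s s0 hs] : exists2 s, 0 < s & forall a, a \in rs -> a != l -> 2 * s <= normc (a - l).
  elim: rs {QE rootE} => [|r rs [s s0 IH]]; first by exists 1.
  have [->|rl0] := eqVneq r l.
    by exists s => // a; rewrite inE => /orP[/eqP ->|]; [rewrite eqxx|exact: IH].
  have nr : 0 < normc (r - l) by rewrite normc_gt0 subr_eq0.
  exists (Num.min s (normc (r - l) / 2)); first by rewrite lt_min s0 divr_gt0.
  have m1 : Num.min s (normc (r - l) / 2) <= s by rewrite ge_min lexx.
  have m2 : Num.min s (normc (r - l) / 2) <= normc (r - l) / 2 by rewrite ge_min lexx orbT.
  move=> a; rewrite inE => /orP[/eqP -> _|ars al]; first by lra.
  by have := IH a ars al; lra.
exists l => e e0; pose h := Num.min e s.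
have h0 : 0 < h by rewrite lt_min e0.
have he : h <= e by rewrite ge_min lexx.
have hS : h <= s by rewrite ge_min lexx orbT.
have hp : 0 < h ^+ p by rewrite exprn_gt0.
pose e1 := Num.min 1 (h ^+ p / B ^+ p.-1).
have e10 : 0 < e1 by rewrite lt_min ltr01 divr_gt0.
have near_r t : 0 < t < e1 -> exists2 a, a \in rs & normc (F (x +i* t)%C - a) < h.
  rewrite lt_min => /and3P[t0 t1 tB].
  have [a ra ha] := near_root (F (x +i* t)%C) mQ sQ1.
  exists a; first by rewrite -rootE.
  rewrite sQ in ha; rewrite -(ltr_pXn2r (n := p)) ?nnegrE ?normc_ge0 ?(ltW h0) //; last exact: ltnW.
  apply: le_lt_trans ha _; apply: le_lt_trans (QF _ _) _; first by rewrite t0 ltW.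
  by rewrite mulrC -ltr_pdivlMr.
exists e1 => // t te1; apply: lt_le_trans he.
suff : `]0, e1[%classic `<=` [set t | normc (F (x +i* t)%C - l) < h].
  by apply; rewrite /= in_itv.
apply: connected_locally_constant.
- by apply/connected_intervalP/interval_is_interval.
- have [z [u ue zE] zl] := hl (Num.min e1 h) ltac:(by rewrite lt_min e10).
  move: ue zl => /andP[u0]; rewrite lt_min => /andP[ue _]; rewrite lt_min => /andP[_ zl].
  exists u; split; first by rewrite /= in_itv /= u0 ue.
  by rewrite /= -zE.
move=> u; rewrite /= in_itv /= => ue1; have /andP[u0 ue] := ue1.
have cu : {for u, continuous (fun t => F (x +i* t)%C : R[i]^o)}.
  apply: (@cvg_comp _ _ _ (fun t => (x +i* t)%C : R[i]^o) (F : R[i]^o -> R[i]^o)).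
    exact: continuous_vertical.
  by apply: F_cont.
have [a ars ha] := near_r u ue1.
have g0 : 0 < h - normc (F (x +i* u)%C - a) by rewrite subr_gt0.
have := (@continuous_normcP R _ _ u).1 cu _ g0.
apply: filterS => v /= vu; rewrite in_itv /= => ve1.
have va : normc (F (x +i* v)%C - a) < h.
  have := ler_normcD (F (x +i* v)%C - F (x +i* u)%C) (F (x +i* u)%C - a).
  rewrite addrA subrK; lra.
have [al|al] := eqVneq a l; first by rewrite -al; split => _.
have := hs a ars al => al2.
have no w : normc (w - a) < h -> ~ normc (w - l) < h.
  move=> wa wl; have := ler_normcB (w - l) (w - a).
  by rewrite (_ : w - l - (w - a) = a - l); [lra|ring].
by split => h1; exfalso; [exact: (no _ ha)|exact: (no _ va)].
Qed.

Definition Fb x : R[i] := projT1 (cid (boundary_limit x)).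

Lemma FbP x e : 0 < e ->
  exists2 e0, 0 < e0 & forall t, 0 < t < e0 -> normc (F (x +i* t)%C - Fb x) < e.
Proof. exact: (projT2 (cid (boundary_limit x)) e). Qed.

Let eps (k : nat) : R := k.+1%:R^-1.

Let eps_gt0 k : 0 < eps k.
Proof. by rewrite /eps invr_gt0 ltr0n. Qed.

Lemma Fb_cvg x : (fun k => F (x +i* k.+1%:R^-1)%C : R[i]^o) @ \oo --> (Fb x : R[i]^o).
Proof.
apply/cvg_normcP => e e0; have [e1 e10 he] := FbP x e0.
have := @cvg_harmonic R; move=> /cvgrPdist_lt/(_ e1 e10); apply: filterS => k /= h.
apply: he; rewrite eps_gt0 /=; move: h; rewrite /harmonic sub0r normrN gtr0_norm //.
Qed.

Lemma Fb_norm x : d <= normc (Fb x).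
Proof.
rewrite leNgt; apply/negP => h.
have [e1 e10 he] := FbP x (e := d - normc (Fb x)) ltac:(by rewrite subr_gt0).
have e2 : 0 < e1 / 2 < e1 by apply/andP; split; lra.
have := he _ e2; have [_ _ hd] := F_inv (w := (x +i* (e1 / 2))%C) ltac:(by rewrite /=; lra).
have := lerB_normc (F (x +i* (e1 / 2))%C) (Fb x); lra.
Qed.

Lemma Fb_neq0 x : Fb x != 0.
Proof. by rewrite -normc_gt0 (lt_le_trans d_gt0) // Fb_norm. Qed.

Lemma Fb_Im x : 0 <= complex.Im (Fb x).
Proof.
rewrite leNgt; apply/negP => h.
have [e1 e10 he] := FbP x (e := - complex.Im (Fb x)) ltac:(by rewrite oppr_gt0).
have e2 : 0 < e1 / 2 < e1 by apply/andP; split; lra.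
have := he _ e2; have [hi _ _] := F_inv (w := (x +i* (e1 / 2))%C) ltac:(by rewrite /=; lra).
move=> /(le_lt_trans (ler_Im_normc _)); rewrite ImB ltr_norml => /andP[_]; lra.
Qed.

Lemma Hf_Fb x : H (Fb x) = x%:C%C.
Proof.
have h : (fun k => H (F (x +i* k.+1%:R^-1)%C) : R[i]^o) @ \oo --> (H (Fb x) : R[i]^o).
  exact: (@Hf_cvg R p kappa _ _ _ _ _ (Fb_neq0 x) (@Fb_cvg x)).
have hE : (fun k => H (F (x +i* k.+1%:R^-1)%C) : R[i]^o) = (fun k => (x +i* k.+1%:R^-1)%C).
  by apply/funext => k; have [_ -> _] := F_inv (w := (x +i* k.+1%:R^-1)%C) (eps_gt0 k).
have h2 : (fun k => (x +i* k.+1%:R^-1)%C : R[i]^o) @ \oo --> (x%:C%C : R[i]^o).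
  apply/cvg_normcP => e e0; have := @cvg_harmonic R; move=> /cvgrPdist_lt/(_ e e0).
  apply: filterS => k /=; rewrite /harmonic sub0r normrN => hk.
  by rewrite normc_vertical.
rewrite hE in h; have := @cvg_unique _ (@norm_hausdorff _ R[i]^o) _ _ _ _ h h2.
exact.
Qed.

(** [F_large] gives [|Fb x| >= |x| / 2 >= rad], where [Im (H z)] is [Im z] times a factor at least
    [1 / 2]; as [H (Fb x) = x] is real, so is [Fb x]. Its sign follows from
    [|H z - z| <= csum < |x| / 2]. *)
Lemma Fb_far x : L <= `|x| -> 2 * rad <= `|x| -> 2 * csum < `|x| ->
  complex.Im (Fb x) = 0 /\ 0 < x * complex.Re (Fb x).
Proof.
move=> xL xr xc; have r1 := rad_ge1 p kappa.
have big : `|x| / 2 <= normc (Fb x).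
  rewrite leNgt; apply/negP => h.
  have [e1 e10 he] := FbP x (e := `|x| / 2 - normc (Fb x)) ltac:(by rewrite subr_gt0).
  have e2 : 0 < e1 / 2 < e1 by apply/andP; split; lra.
  have w0 : 0 < complex.Im (x +i* (e1 / 2))%C by rewrite /=; lra.
  have xw := ler_Re_normc (x +i* (e1 / 2))%C; rewrite /= in xw.
  have := he _ e2; have := F_large w0 (le_trans xL xw).
  have := lerB_normc (F (x +i* (e1 / 2))%C) (Fb x); lra.
have br : rad <= normc (Fb x) by lra.
have I0 : complex.Im (Fb x) = 0.
  have [k k2] := Im_Hf_far br; rewrite Hf_Fb /= => /esym/eqP.
  by rewrite mulf_eq0 => /orP[/eqP|/eqP] //; lra.
split => //.
have b1 : 1 <= normc (Fb x) by lra.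
have := Hf_near_id p kappa b1; rewrite Hf_Fb => /(le_trans (ler_Re_normc _)).
rewrite ReB /= ler_norml => /andP[h1 h2].
have [x0|x0] := leP 0 x.
  by rewrite (ger0_norm x0) in xc xr; rewrite mulr_gt0 //; lra.
by rewrite (ltr0_norm x0) in xc xr; rewrite nmulr_rgt0 //; lra.
Qed.

(** By Lagrange inversion its coefficient of degree [n], divided by [n + 1], is the moment of order
    [n]. *)
Definition cf n := cum_poly kappa p ^+ n.+1.

(** The summand [n.+1] ensures that the index [n] occurs in sums over ['I_(deg n)]. *)
Definition deg n := (size (cf n) + n.+1)%N.

Lemma Hf_cum_poly z : z != 0 ->
  H z = z * (map_poly (real_complex R) (cum_poly kappa p)).[z^-1].
Proof.
move=> z0; rewrite (@horner_coef_wide _ p.+1); last first.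
  by rewrite size_map_poly size_poly.
rewrite /Hf /phi big_ord_recl coef_map coef_poly /= expr0 mulr1 mulrDr mulr1.
congr (_ + _); rewrite big_add1 big_mkord mulr_sumr; apply: eq_bigr => i _.
rewrite coef_map coef_poly /= /bump /= add1n ltnS ltn_ord mulrCA exprVn exprS.
by field; rewrite z0 expf_neq0.
Qed.

Lemma Hf_exp n z : z != 0 ->
  H z ^+ n.+1 = z ^+ n.+1 * \sum_(j < deg n) ((cf n)`_j)%:C%C * z^-1 ^+ j.
Proof.
move=> z0; rewrite Hf_cum_poly // exprMn -horner_exp -rmorphXn.
rewrite (@horner_coef_wide _ (deg n)) ?size_map_poly ?leq_addr //.
by congr (_ * _); apply: eq_bigr => i _; rewrite coef_map.
Qed.

(* A primitive of [z^(n - 1 - j)] for [j != n]. *)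
Definition Tj n j z : R[i] := if (j < n)%N then z ^+ (n - j) / (n - j)%:R
  else - (z^-1 ^+ (j - n) / (j - n)%:R).

(* With [w = H z], [Psi n w z + cf n`_n / n.+1 * ln z] is a primitive of
   [w ^+ n / z] as a function of [w]. *)
Definition Psi n w z : R[i] := n.+1%:R^-1 * (w ^+ n.+1 * z^-1 +
  \sum_(j < deg n | j != n :> nat) ((cf n)`_j)%:C%C * Tj n j z).

Section Antiderivative.
Variable t : R.
Hypothesis t_gt0 : 0 < t.

Let wt x : R[i] := x%:C%C + (0 +i* t)%C.

Let wtE x : wt x = (x +i* t)%C.
Proof. by apply/eqP; rewrite eq_complex ReD ImD /= addr0 add0r !eqxx. Qed.

Let wt0 x : 0 < complex.Im (wt x).
Proof. by rewrite wtE. Qed.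

Let f x := F (wt x).

Let f0 x : f x != 0.
Proof. exact/Fn0/wt0. Qed.

Let D x := (K (f x) (f x))^-1.

(** The difference quotient of [F] is [1 / K (F w') (F w)], which makes sense and is continuous also
    at [w' = w]. *)
Lemma cderiv_F x : cderiv f x (D x).
Proof.
have cf' : (fun y => f y : R[i]^o) @ x --> (f x : R[i]^o).
  have -> : (fun y => f y : R[i]^o) = (fun y => F (y +i* t)%C) by apply/funext => y; rewrite /f wtE.
  rewrite /f wtE.
  apply: (@cvg_comp _ _ _ (fun y => (y +i* t)%C : R[i]^o) (F : R[i]^o -> R[i]^o)).
    exact: continuous_horizontal.
  by apply: F_cont.
exists (fun y => (K (f y) (f x))^-1); split; last by [].
  move=> y; have K0 := F_neq0 (wt0 y) (wt0 x).
  apply: (mulIf K0); rewrite mulfVK // -HfB //.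
  have [_ -> _] := F_inv (wt0 y); have [_ -> _] := F_inv (wt0 x).
  by rewrite /wt rmorphB; ring.
have h2 : (fun=> f x : R[i]^o) @ x --> (f x : R[i]^o) by exact: cvg_cst.
have h3 : (fun y => K (f y) (f x) : R[i]^o) @ x --> (K (f x) (f x) : R[i]^o).
  exact: (@Kf_cvg R p kappa _ _ _ _ _ _ _ (f0 x) (f0 x) cf' h2).
have h : (fun y => (K (f y) (f x))^-1 : R[i]^o) @ x --> ((K (f x) (f x))^-1 : R[i]^o).
  exact: (@cvg_invC R R _ _ _ _ (F_neq0 (wt0 x) (wt0 x)) h3).
exact: h.
Qed.

(** Writing [z^(n-1-j)] as [z^(n+1) z^-(j+2)] gives one form for both signs of [n - j], and the one
    that matches [Hf_exp]. *)
Lemma cderiv_Tj n j x : j != n ->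
  cderiv (fun x => Tj n j (f x)) x (f x ^+ n.+1 * (f x)^-1 ^+ j.+2 * D x).
Proof.
move=> jn; have df := cderiv_F x.
have nat0 k : (0 < k)%N -> k%:R != 0 :> R[i] by rewrite pnatr_eq0 -lt0n.
rewrite /Tj; case: ltnP => [jn'|nj].
  have := cderivM (cderivX (n - j) df) (cderiv_cst (n - j)%:R^-1 x).
  congr (cderiv _ _ _); rewrite mulr0 addr0.
  have -> : n.+1 = ((n - j).-1 + j.+2)%N by lia.
  have fX (a b : nat) : f x ^+ (a + b) * (f x)^-1 ^+ b = f x ^+ a.
    by rewrite exprD -mulrA -exprMn divff // expr1n mulr1.
  have nj := nat0 (n - j)%N ltac:(by rewrite subn_gt0).
  rewrite fX; move: (_%:R) (D x) (f x ^+ _) nj => A B X A0.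
  by field.
have nj0 : (0 < j - n)%N by rewrite subn_gt0 ltn_neqAle eq_sym jn.
have df' := cderivV f0 df.
have h := cderivM (cderivM (cderivX (j - n) df') (cderiv_cst (j - n)%:R^-1 x)) (cderiv_cst (-1) x).
have -> : (fun x => - ((f x)^-1 ^+ (j - n) / (j - n)%:R)) =
    (fun x => (f x)^-1 ^+ (j - n) / (j - n)%:R * -1) by apply/funext => y; rewrite mulrN1.
move: h; congr (cderiv _ _ _); rewrite !mulr0 !addr0.
have -> : j.+2 = (n.+1 + (j - n).+1)%N by lia.
have fX (a b : nat) : f x ^+ a * (f x)^-1 ^+ (a + b) = (f x)^-1 ^+ b.
  by rewrite exprD mulrA -exprMn divff // expr1n mul1r.
rewrite fX; have -> : ((j - n).+1 = (j - n).-1.+2)%N by lia.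
rewrite !exprS; have := nat0 _ nj0.
by move: ((f x)^-1 ^+ _) (_%:R) (D x) (f0 x) => A B C f0' B0; field; rewrite f0' B0.
Qed.

Let Theta n x := complex.Im (Psi n (wt x) (f x)) + (cf n)`_n / n.+1%:R * carg (f x).

(** Integration by parts: the derivative of [w^(n+1) / z] is [(n+1) w^n / z - w^(n+1) z' / z^2], and
    [Hf_exp] expands [w^(n+1) / z^2] in powers of [z]. Each term has a primitive [Tj], except
    [j = n], a multiple of [z' / z], which is handled by [carg]. *)
Lemma is_derive_Theta n x :
  is_derive x 1 (Theta n) (complex.Im (wt x ^+ n / f x)).
Proof.
have df := cderiv_F x; have [f_pos Hfx _] := F_inv (wt0 x).
have dw : cderiv wt x 1 by exact: cderiv_line.
have dPsi : cderiv (fun x => Psi n (wt x) (f x)) x (wt x ^+ n / f x -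
    ((cf n)`_n / n.+1%:R)%:C%C * (D x / f x)).
  have dsum := cderiv_sum (index_enum _) (fun (j : 'I_(deg n)) (jn : j != n :> nat) =>
    cderivM (cderiv_cst ((cf n)`_j)%:C%C x) (cderiv_Tj x jn)).
  have dall := cderivM (cderiv_cst (n.+1%:R^-1) x)
    (cderivD (cderivM (cderivX n.+1 dw) (cderivV f0 df)) dsum).
  move: dall; congr (cderiv _ _ _); rewrite mul0r add0r.
  have jn : (n < deg n)%N by rewrite /deg addnS ltnS leq_addl.
  have E := Hf_exp n (f0 x); rewrite -/(f x) Hfx in E.
  rewrite (bigD1 (Ordinal jn)) //= in E.
  have -> : \sum_(j < deg n | j != n :> nat) (0 * Tj n j (f x) +
      ((cf n)`_j)%:C%C * (f x ^+ n.+1 * (f x)^-1 ^+ j.+2 * D x)) =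
      f x ^+ n.+1 * (\sum_(j < deg n | j != Ordinal jn) ((cf n)`_j)%:C%C * (f x)^-1 ^+ j) *
      ((f x)^-1 * (f x)^-1 * D x).
    rewrite mulr_sumr mulr_suml; apply: eq_bigr => j _.
    by rewrite mul0r add0r !exprS; ring.
  set S := \sum_(j < deg n | _) _ in E *.
  have -> : f x ^+ n.+1 * S = wt x ^+ n.+1 - f x ^+ n.+1 * (((cf n)`_n)%:C%C * (f x)^-1 ^+ n).
    by rewrite E; ring.
  have n0 : n.+1%:R != 0 :> R[i] by rewrite pnatr_eq0.
  have -> : ((cf n)`_n / n.+1%:R)%:C%C = ((cf n)`_n)%:C%C / n.+1%:R :> R[i].
    by rewrite rmorphM fmorphV rmorph_nat.
  have -> : f x ^+ n.+1 * (((cf n)`_n)%:C%C * (f x)^-1 ^+ n) = ((cf n)`_n)%:C%C * f x.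
    by rewrite exprS mulrCA -mulrA -exprMn divff // expr1n mulr1.
  move: ((cf n)`_n)%:C%C (D x) (wt x ^+ n) (wt x ^+ n.+1) (n.+1%:R) n0 => c d' A B N n0 /=.
  by field; rewrite f0 n0.
have dI := cderiv_Im dPsi.
have dA := cderiv_carg f_pos df.
have h := is_deriveD dI (is_deriveZ ((cf n)`_n / n.+1%:R) dA).
have -> : complex.Im (wt x ^+ n / f x) = complex.Im (wt x ^+ n / f x -
    ((cf n)`_n / n.+1%:R)%:C%C * (D x / f x)) +
    ((cf n)`_n / n.+1%:R) *: complex.Im (D x / f x).
  by rewrite ImB ImZ -[_ *: _]/(_ * _) subrK.
exact: h.
Qed.

Lemma continuous_integrand n : continuous (fun x => complex.Im ((x +i* t)%C ^+ n / F (x +i* t)%C)).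
Proof.
move=> x; have df := cderiv_F x; have dw : cderiv wt x 1 by exact: cderiv_line.
have dq := cderivM (cderivX n dw) (cderivV f0 df).
have -> : (fun x => complex.Im ((x +i* t)%C ^+ n / F (x +i* t)%C)) =
    (fun x => complex.Im (wt x ^+ n * (f x)^-1)).
  by apply/funext => y; rewrite /f wtE.
by apply: cvg_comp; [exact: (cderiv_continuous dq)|exact: continuous_Im].
Qed.

Lemma vertical_integral n (a b : R) : a < b ->
  (\int[lebesgue_measure]_(x in `[a, b]) (complex.Im ((x +i* t)%C ^+ n / F (x +i* t)%C))%:E)%E =
  ((complex.Im (Psi n (b +i* t)%C (F (b +i* t)%C)) +
     (cf n)`_n / n.+1%:R * carg (F (b +i* t)%C)) -
   (complex.Im (Psi n (a +i* t)%C (F (a +i* t)%C)) +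
     (cf n)`_n / n.+1%:R * carg (F (a +i* t)%C)))%:E.
Proof.
move=> ab.
have cT x : {for x, continuous (Theta n)}.
  have [dT _] := is_derive_Theta n x.
  exact/differentiable_continuous/derivable1_diffP.
have cI x : {for x, continuous (fun x => complex.Im (wt x ^+ n / f x))}.
  have df := cderiv_F x; have dw : cderiv wt x 1 by exact: cderiv_line.
  have dq := cderivM (cderivX n dw) (cderivV f0 df).
  by apply: cvg_comp; [exact: (cderiv_continuous dq)|exact: continuous_Im].
have h : (\int[lebesgue_measure]_(x in `[a, b]) (complex.Im (wt x ^+ n / f x))%:E)%E =
    ((Theta n b)%:E - (Theta n a)%:E)%E.
  apply: continuous_FTC2 => //.
  - by apply: continuous_subspaceT => x; exact: cI.
  - split.
    + by move=> x _; have [] := is_derive_Theta n x.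
    + by apply: cvg_at_right_filter; exact: cT.
    + by apply: cvg_at_left_filter; exact: cT.
  - move=> x _; rewrite derive1E.
    by have [_ ->] := is_derive_Theta n x.
move: h; rewrite /Theta /f !wtE -EFinB => <-.
by apply: eq_integral => x _; rewrite wtE.
Qed.

End Antiderivative.

Lemma Im0_real z : complex.Im z = 0 -> z = (complex.Re z)%:C%C.
Proof. by case: z => a b /= ->. Qed.

Lemma Psi_real n w z : complex.Im w = 0 -> complex.Im z = 0 -> complex.Im (Psi n w z) = 0.
Proof.
move=> /Im0_real -> /Im0_real ->; move: (complex.Re w) (complex.Re z) => u v.
rewrite /Psi -[n.+1%:R](rmorph_nat (real_complex R)) -!(fmorphV, rmorphXn, rmorphM).
rewrite ImZ ImD [complex.Im _%:C%C]/= add0r Im_sum big1 ?mulr0 // => j jn.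
rewrite ImZ /Tj; case: ifP => _.
  by rewrite -[_%:R](rmorph_nat (real_complex R)) -fmorphV -rmorphXn -rmorphM /= mulr0.
by rewrite -[_%:R](rmorph_nat (real_complex R)) -!fmorphV -rmorphXn -rmorphM -rmorphN /= mulr0.
Qed.

Lemma Psi_cvg n (u v : nat -> R[i]^o) (w z : R[i]^o) : z != 0 ->
  u @ \oo --> w -> v @ \oo --> z ->
  (fun k => Psi n (u k) (v k) : R[i]^o) @ \oo --> (Psi n w z : R[i]^o).
Proof.
move=> z0 uw vz.
have vV : (fun k => (v k)^-1 : R[i]^o) @ \oo --> (z^-1 : R[i]^o) by exact: cvg_invC.
have cc (a : R[i]^o) : (fun _ : nat => a) @ \oo --> a by exact: cvg_cst.
apply: (@cvg_mulC R nat _ _ (fun=> n.+1%:R^-1) _ (n.+1%:R^-1)); first exact: cc.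
have h1 : (fun k => u k ^+ n.+1 * (v k)^-1 : R[i]^o) @ \oo --> (w ^+ n.+1 * z^-1 : R[i]^o).
  exact: (@cvg_mulC R nat _ _ (fun k => u k ^+ n.+1) _ _ _ (@cvg_expC R nat _ _ _ _ _ uw) vV).
have h2 : (fun k => \sum_(j < deg n | j != n :> nat) ((cf n)`_j)%:C%C * Tj n j (v k) : R[i]^o) @ \oo -->
    (\sum_(j < deg n | j != n :> nat) ((cf n)`_j)%:C%C * Tj n j z : R[i]^o).
  apply: (@cvg_sumC R nat _ _ _ _ _ (fun (j : 'I_(deg n)) k => ((cf n)`_j)%:C%C * Tj n j (v k))
    (fun j : 'I_(deg n) => ((cf n)`_j)%:C%C * Tj n j z)) => j _.
  apply: (@cvg_mulC R nat _ _ (fun=> ((cf n)`_j)%:C%C)); first exact: cc.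
  rewrite /Tj; case: ifP => _.
    exact: (@cvg_mulC R nat _ _ (fun k => v k ^+ _) (fun=> _) _ _ (@cvg_expC R nat _ _ _ _ _ vz) (cc _)).
  have h : (fun k => (v k)^-1 ^+ (j - n) / (j - n)%:R : R[i]^o) @ \oo -->
      (z^-1 ^+ (j - n) / (j - n)%:R : R[i]^o).
    exact: (@cvg_mulC R nat _ _ (fun k => (v k)^-1 ^+ (j - n)) (fun=> (j - n)%:R^-1) _ _
      (@cvg_expC R nat _ _ _ _ _ vV) (cc _)).
  exact: (cvgN h).
exact: (cvgD h1 h2).
Qed.

Let wk x k : R[i] := (x +i* k.+1%:R^-1)%C.

Lemma wk_cvg x : (fun k => wk x k : R[i]^o) @ \oo --> (x%:C%C : R[i]^o).
Proof.
apply/cvg_normcP => e e0; have := @cvg_harmonic R; move=> /cvgrPdist_lt/(_ e e0).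
apply: filterS => k /=; rewrite /harmonic sub0r normrN => hk.
by rewrite normc_vertical.
Qed.

Lemma wk_gt0 x k : 0 < complex.Im (wk x k).
Proof. exact: eps_gt0. Qed.

Lemma ratio_cvgy (u v : nat -> R) (l : R) : 0 < l -> u @ \oo --> l ->
  (forall k, 0 < v k) -> v @ \oo --> (0 : R) -> (fun k => atan (u k / v k)) @ \oo --> pi / 2.
Proof.
move=> l0 ul v0 vl.
have : (fun k => u k / v k) @ \oo --> +oo.
  apply/cvgryPge => M; near=> k.
  have uk : l / 2 < u k.
    near: k; move/cvgrPdist_lt: ul => /(_ (l / 2) ltac:(by rewrite divr_gt0)).
    by apply: filterS => k; rewrite ltr_norml => /andP[_]; lra.
  have M0 : 0 < `|M| + 1 by rewrite ltr_wpDl.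
  have vk : v k < l / 2 / (`|M| + 1).
    near: k; move/cvgrPdist_lt: vl => /(_ (l / 2 / (`|M| + 1)) ltac:(by rewrite !divr_gt0)).
    by apply: filterS => k; rewrite sub0r normrN ltr_norml => /andP[_].
  rewrite ler_pdivlMr //; move: vk; rewrite ltr_pdivlMr // => vk.
  have := ler_wpM2r (ltW (v0 k)) (ler_norm M); have := v0 k; lra.
by move=> h; apply: cvg_comp; [exact: h|exact: cvgy_atan].
Unshelve. all: by end_near. Qed.

Lemma Im_Fb_cvg x : (fun k => complex.Im (F (wk x k))) @ \oo --> complex.Im (Fb x).
Proof. by apply: cvg_comp; [exact: (@Fb_cvg x)|exact: continuous_Im]. Qed.

Lemma Re_Fb_cvg x : (fun k => complex.Re (F (wk x k))) @ \oo --> complex.Re (Fb x).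
Proof. by apply: cvg_comp; [exact: (@Fb_cvg x)|exact: continuous_Re]. Qed.

Lemma carg_cvg x : L <= `|x| -> 2 * rad <= `|x| -> 2 * csum < `|x| ->
  (fun k => carg (F (wk x k))) @ \oo --> - (Num.sg x * (pi / 2)).
Proof.
move=> xL xr xc; have [I0 R0] := Fb_far xL xr xc.
have Ic := Im_Fb_cvg (x := x); rewrite I0 in Ic.
have Ip k : 0 < complex.Im (F (wk x k)) by have [] := F_inv (wk_gt0 x k).
have [x0|x0|x0] := ltgtP x 0; last by rewrite x0 mul0r ltxx in R0.
  rewrite ltr0_sg // mulN1r opprK.
  have Rn : 0 < - complex.Re (Fb x) by rewrite oppr_gt0; rewrite nmulr_rgt0 in R0.
  have h : (fun k => - complex.Re (F (wk x k))) @ \oo --> - complex.Re (Fb x).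
    exact: (cvgN (Re_Fb_cvg (x := x))).
  have -> : (fun k => carg (F (wk x k))) =
      (fun k => atan (- complex.Re (F (wk x k)) / complex.Im (F (wk x k)))).
    by apply/funext => k; rewrite /carg mulNr atanN.
  exact: ratio_cvgy h Ip Ic.
rewrite gtr0_sg // mul1r.
have Rp : 0 < complex.Re (Fb x) by rewrite pmulr_rgt0 in R0.
exact: (cvgN (ratio_cvgy Rp (Re_Fb_cvg (x := x)) Ip Ic)).
Unshelve. all: by end_near. Qed.

Lemma primitive_cvg n x : L <= `|x| -> 2 * rad <= `|x| -> 2 * csum < `|x| ->
  (fun k => complex.Im (Psi n (wk x k) (F (wk x k))) +
     (cf n)`_n / n.+1%:R * carg (F (wk x k))) @ \oo -->
  - ((cf n)`_n / n.+1%:R * (Num.sg x * (pi / 2))).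
Proof.
move=> xL xr xc; have [I0 _] := Fb_far xL xr xc.
rewrite -[X in _ --> X]add0r -mulrN; apply: cvgD; last first.
  by apply: cvgM; [exact: cvg_cst|exact: carg_cvg].
have <- : complex.Im (Psi n x%:C%C (Fb x)) = 0 by exact: Psi_real.
apply: (@cvg_comp _ _ _ (fun k => Psi n (wk x k) (F (wk x k)) : R[i]^o)
  (fun z : R[i]^o => complex.Im z)); last exact: continuous_Im.
by apply: Psi_cvg; [exact: Fb_neq0|exact: wk_cvg|exact: (@Fb_cvg x)].
Qed.

(** Limit of [vertical_integral] at the heights [1 / (k + 1)]. At both end points the limit of [F]
    is real, so [Psi] contributes nothing, while [carg] tends to [pi / 2] at [- A] and to [- pi / 2]
    at [A]: the integral of [Im (w^n / F)] tends to [- pi] times the coefficient. *)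
Lemma boundary_moments n (A : R) : L <= A -> 2 * rad <= A -> 2 * csum < A ->
  (\int[lebesgue_measure]_(x in `[(- A)%R, A]) (x ^+ n * (- complex.Im (Fb x)^-1 / pi))%:E)%E =
  ((cf n)`_n / n.+1%:R)%:E.
Proof.
move=> AL Ar Ac; set D := `[(- A), A]%classic.
have r1 := rad_ge1 p kappa.
have A0 : 0 < A by lra.
have nA : `|A| = A by rewrite gtr0_norm.
have nA' : `|- A| = A by rewrite normrN.
pose f_ k x := complex.Im (wk x k ^+ n / F (wk x k)).
pose f x := complex.Im (x%:C%C ^+ n / Fb x).
have f_f x : f_ ^~ x @ \oo --> f x.
  have vV : (fun k => (F (wk x k))^-1 : R[i]^o) @ \oo --> ((Fb x)^-1 : R[i]^o).
    exact: (@cvg_invC R nat _ _ _ _ (Fb_neq0 x) (@Fb_cvg x)).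
  have h : (fun k => wk x k ^+ n * (F (wk x k))^-1 : R[i]^o) @ \oo -->
      (x%:C%C ^+ n * (Fb x)^-1 : R[i]^o).
    have hw : (fun k => wk x k ^+ n : R[i]^o) @ \oo --> (x%:C%C ^+ n : R[i]^o).
      exact: (@cvg_expC R nat _ _ _ _ _ (@wk_cvg x)).
    exact: (@cvg_mulC R nat _ _ (fun k => wk x k ^+ n) (fun k => (F (wk x k))^-1) _ _ hw vV).
  by apply: cvg_comp; [exact: h|exact: continuous_Im].
have mfk k : measurable_fun D (f_ k).
  have ck := @continuous_integrand _ (eps_gt0 k) n.
  exact: measurable_funTS (continuous_measurable_fun ck).
have mf : measurable_fun D f by apply: (measurable_fun_cvg mfk) => x _; exact: f_f.
have mD : measurable D by exact: measurable_itv.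
have Dfin : (lebesgue_measure D < +oo)%E.
  by rewrite lebesgue_measure_itv /=; case: ifP => _; rewrite ltry.
(* Dominating constant: [|w| <= A + 1] on the segments considered, and [|F w| >= d]. *)
pose M := (A + 1) ^+ n / d.
have M0 : 0 <= M by rewrite divr_ge0 ?exprn_ge0 ?(ltW d_gt0) //; lra.
have f_M x k : D x -> `|f_ k x| <= M.
  rewrite /D /= in_itv /= => /andP[x1 x2].
  apply: le_trans (ler_Im_normc _) _; rewrite normcM normcX normcV.
  have [_ _ dF] := F_inv (wk_gt0 x k).
  apply: ler_pM; rewrite ?exprn_ge0 ?invr_ge0 ?normc_ge0 //.
    rewrite lerXn2r ?nnegrE ?normc_ge0 //; first by lra.
    apply: le_trans (ler_normc_ReIm _) _; apply: lerD => /=.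
      by rewrite ler_norml x1.
    by rewrite ger0_norm ?invr_ge0 // invf_le1 ?ler1n // ltr0n.
  by rewrite lef_pV2 ?posrE // (lt_le_trans d_gt0).
have iM : lebesgue_measure.-integrable D (EFin \o (fun=> M)).
  apply: measurable_bounded_integrable => //.
  by exists M; split; [exact: num_real|move=> u Mu x _ /=; rewrite ger0_norm // ltW].
have ae1 : {ae lebesgue_measure, forall x : R, D x -> (fun k => (f_ k x)%:E) @ \oo --> (f x)%:E}.
  apply: aeW => x _; apply/fine_cvgP; split; first by apply: nearW.
  exact: f_f.
have ae2 : {ae lebesgue_measure, forall (x : R) k, D x -> (`|(f_ k x)%:E| <= M%:E)%E}.
  by apply: aeW => x k Dx; rewrite lee_fin f_M.
have [iF _] := @dominated_convergence _ _ R lebesgue_measure D mD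
  (fun k x => (f_ k x)%:E) (fun x => (f x)%:E) (fun=> M%:E)
  (fun k => (measurable_EFinP _ _).2 (mfk k)) ((measurable_EFinP _ _).2 mf) ae1 iM ae2.
have intE : (fun k => (\int[lebesgue_measure]_(x in D) (f_ k x)%:E)%E) =
  (fun k => ((complex.Im (Psi n (wk A k) (F (wk A k))) +
     (cf n)`_n / n.+1%:R * carg (F (wk A k))) -
   (complex.Im (Psi n (wk (- A) k) (F (wk (- A) k))) +
     (cf n)`_n / n.+1%:R * carg (F (wk (- A) k))))%:E).
  by apply/funext => k; apply: vertical_integral; [exact: eps_gt0|lra].
have lim2 : (fun k => ((complex.Im (Psi n (wk A k) (F (wk A k))) +
     (cf n)`_n / n.+1%:R * carg (F (wk A k))) -
   (complex.Im (Psi n (wk (- A) k) (F (wk (- A) k))) +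
     (cf n)`_n / n.+1%:R * carg (F (wk (- A) k))))%:E) @ \oo -->
   (- ((cf n)`_n / n.+1%:R * pi))%:E.
  apply/fine_cvgP; split; first by apply: nearW.
  have -> : - ((cf n)`_n / n.+1%:R * pi) = - ((cf n)`_n / n.+1%:R * (Num.sg A * (pi / 2))) -
      - ((cf n)`_n / n.+1%:R * (Num.sg (- A) * (pi / 2))).
    rewrite sgrN gtr0_sg // mul1r mulN1r.
    by field; rewrite addrC natr1 pnatr_eq0.
  by apply: cvgB; apply: primitive_cvg; rewrite ?nA' ?nA.
rewrite /= intE => lim1.
have IE := @cvg_unique _ (@ereal_hausdorff R) _ _ _ _ lim1 lim2.
have pi0 : pi != 0 :> R by rewrite gt_eqF // pi_gt0.
have -> : (\int[lebesgue_measure]_(x in D) (x ^+ n * (- complex.Im (Fb x)^-1 / pi))%:E)%E =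
    (\int[lebesgue_measure]_(x in D) ((- pi^-1)%:E * (f x)%:E))%E.
  apply: eq_integral => x _; rewrite -EFinM /f -rmorphXn ImZ; congr _%:E.
  by ring.
rewrite integralZl //.
by rewrite IE -EFinM; congr _%:E; rewrite mulNr mulrN opprK mulrCA mulVf ?mulr1.
Qed.

(** The density is cut off outside [[- A, A]], which gives compact support at once; the moment of
    order 0 shows that the mass kept is 1. *)
Lemma boundary_measure : exists mu : probability (measurableTypeR R) R,
  compact_support mu /\
  forall n, (\int[mu]_x (x ^+ n)%:E)%E = ((cf n)`_n / n.+1%:R)%:E.
Proof.
have c0 := csum_ge0 p kappa; have r1 := rad_ge1 p kappa.
pose A := Num.max L (2 * rad) + 2 * csum + 1.
have AL' : Num.max L (2 * rad) + 1 <= A by rewrite /A; lra.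
have mL : L <= Num.max L (2 * rad) by rewrite le_max lexx.
have mr : 2 * rad <= Num.max L (2 * rad) by rewrite le_max lexx orbT.
have AL : L <= A by lra.
have Ar : 2 * rad <= A by lra.
have Ac : 2 * csum < A by rewrite /A; lra.
have moments := boundary_moments _ AL Ar Ac.
set D := `[(- A), A]%classic in moments *.
have mD : measurable D by exact: measurable_itv.
have Dfin : (lebesgue_measure D < +oo)%E.
  by rewrite lebesgue_measure_itv /=; case: ifP => _; rewrite ltry.
pose rho x := - complex.Im (Fb x)^-1 / pi.
have rho_ge0 x : 0 <= rho x.
  rewrite /rho divr_ge0 ?pi_ge0 // ImV mulNr opprK divr_ge0 ?sqr_ge0 //.
  exact: Fb_Im.
have rho_le x : rho x <= d^-1 / pi.
  rewrite /rho ler_wpM2r ?invr_ge0 ?pi_ge0 //.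
  apply: le_trans (ler_norm _) _; rewrite normrN.
  apply: le_trans (ler_Im_normc _) _; rewrite normcV.
  by rewrite lef_pV2 ?posrE ?Fb_norm // (lt_le_trans d_gt0) ?Fb_norm.
have mrho : measurable_fun D rho.
  have h k : measurable_fun D (fun x => - complex.Im ((x +i* k.+1%:R^-1)%C ^+ 0 / F (x +i* k.+1%:R^-1)%C) / pi).
    have ck := @continuous_integrand _ (eps_gt0 k) 0%N.
    have mk : measurable_fun D _ := measurable_funTS (continuous_measurable_fun ck).
    by apply: measurable_funM => //; exact: measurableT_comp.
  apply: (measurable_fun_cvg h) => x _.
  apply: cvgM; last exact: cvg_cst.
  apply: cvgN; apply: (@cvg_comp _ _ _ (fun k => (wk x k) ^+ 0 / F (wk x k) : R[i]^o)
    (fun z : R[i]^o => complex.Im z)); last exact: continuous_Im.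
  under eq_fun do rewrite expr0 mul1r.
  exact: (@cvg_invC R nat _ _ _ _ (Fb_neq0 x) (@Fb_cvg x)).
pose g := rho \_ D.
have g_ge0 x : 0 <= g x by rewrite /g patchE; case: ifP.
have mg : measurable_fun [set: R] g by exact: (measurable_restrictT _ mD).1.
have bnd (h : R -> R) (M : R) (m : {measure set (measurableTypeR R) -> \bar R}) : (m D < +oo)%E ->
    measurable_fun D h -> (forall x, D x -> `|h x| <= M) -> m.-integrable D (EFin \o h).
  move=> mfin mh hM; apply: measurable_bounded_integrable => //.
  exists M; split; first exact: num_real.
  by move=> u Mu x Dx; apply: le_trans (hM x Dx) (ltW Mu).
have patchE' (h : R -> R) x : ((EFin \o h) \_ D) x = ((h \_ D) x)%:E.
  by rewrite !patchE; case: ifP.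
have restr (h : R -> R) : (EFin \o (h \_ D)) = ((EFin \o h) \_ D).
  by apply/funext => x; rewrite patchE'.
have ig : lebesgue_measure.-integrable [set: R] (EFin \o g).
  rewrite restr; apply/integrable_restrict => //; rewrite setTI.
  by apply: (bnd _ (d^-1 / pi)) => // x _; rewrite ger0_norm.
have g1 : (\int[lebesgue_measure]_x (g x)%:E = 1)%E.
  have -> : (\int[lebesgue_measure]_x (g x)%:E)%E = (\int[lebesgue_measure]_(x in D) (rho x)%:E)%E.
    by rewrite [RHS]integral_mkcond; apply: eq_integral => x _; rewrite patchE'.
  have := moments 0%N; rewrite /cf expr1 coef_poly /= divr1 => <-.
  by apply: eq_integral => x _; rewrite expr0 mul1r.
have [mu [muE muI]] := density_exists g_ge0 ig g1.
have muDC : mu (~` D) = 0%E.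
  rewrite muE; last exact: measurableC.
  apply: integral0_eq => x Dx; rewrite /g patchE; case: ifP => //.
  by rewrite inE => /Dx.
exists mu; split; first by exists D => //; exact: segment_compact.
move=> n; have mX : measurable_fun [set: R] (fun x : R => x ^+ n).
  exact: exprn_measurable.
have mXD : measurable_fun [set: R] ((fun x : R => x ^+ n) \_ D).
  by apply: (measurable_restrictT _ mD).1; exact: measurable_funTS.
(* To get a bounded integrand, the power is replaced by its restriction to [D], which carries the
   whole mass. *)
have -> : (\int[mu]_x (x ^+ n)%:E)%E = (\int[mu]_x (((fun x : R => x ^+ n) \_ D) x)%:E)%E.
  apply: ae_eq_integral => //; [exact/measurable_EFinP|exact/measurable_EFinP|].
  exists (~` D); split; [exact: measurableC|exact: muDC|].
  move=> x /= nx Dx; apply: nx => _; rewrite patchE; case: ifP => //.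
  by rewrite mem_set.
rewrite muI; last first.
  have := restr (fun x : R => x ^+ n); rewrite /comp => ->.
  apply/integrable_restrict => //; rewrite setTI.
  apply: (bnd _ (A ^+ n)).
  - by apply: le_lt_trans (_ : _ <= 1)%E (ltry _); exact: probability_le1.
  - exact: measurable_funTS.
  - move=> x; rewrite /D /= in_itv /= => /andP[x1 x2]; rewrite normrX.
    by rewrite lerXn2r ?nnegrE //; [lra|rewrite ler_norml x1].
rewrite -moments [RHS]integral_mkcond; apply: eq_integral => x _.
rewrite -EFinM; rewrite /g !patchE; case: ifP => // _.
by rewrite mul0r.
Qed.

End Boundary.

(** * Expectations of complex functions and their expansions *)

Section Expectation.
Variables (R : realType) (mu : probability (measurableTypeR R) R).
Implicit Types (f g : R -> R[i]) (a b : R[i]).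

Definition bcont f := continuous (f : R -> R[i]^o) /\ exists B : R, forall x, normc (f x) <= B.

Definition Ex f : R[i] :=
  ((\int[mu]_x complex.Re (f x))%R +i* (\int[mu]_x complex.Im (f x))%R)%C.

Lemma bcont_cst a : bcont (fun=> a).
Proof. by split; [move=> x; exact: cvg_cst|exists (normc a)]. Qed.

Lemma bcontD f g : bcont f -> bcont g -> bcont (fun x => f x + g x).
Proof.
move=> [cf [B hB]] [cg [B' hB']]; split.
  by move=> x; exact: (cvgD (cf x) (cg x)).
by exists (B + B') => x; rewrite (le_trans (ler_normcD _ _)) // lerD.
Qed.

Lemma bcontM f g : bcont f -> bcont g -> bcont (fun x => f x * g x).
Proof.
move=> [cf [B hB]] [cg [B' hB']]; split.
  by move=> x; exact: (@cvg_mulC R R _ _ _ _ _ _ (cf x) (cg x)).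
by exists (B * B') => x; rewrite normcM ler_pM ?normc_ge0.
Qed.

Lemma bcontX f n : bcont f -> bcont (fun x => f x ^+ n).
Proof.
move=> bf; elim: n => [|n IH].
  by under eq_fun do rewrite expr0; exact: bcont_cst.
by under eq_fun do rewrite exprS; exact: bcontM.
Qed.

Lemma bcontV f (e : R) : 0 < e -> (forall x, e <= normc (f x)) -> bcont f ->
  bcont (fun x => (f x)^-1).
Proof.
move=> e0 fe [cf _]; have f0 x : f x != 0 by rewrite -normc_gt0 (lt_le_trans e0).
split; first by move=> x; exact: (@cvg_invC R R _ _ _ _ (f0 x) (cf x)).
exists e^-1 => x; rewrite normcV lef_pV2 ?posrE //.
exact: lt_le_trans (fe x).
Qed.

Lemma bcont_integrable (h : R -> R) (B : R) : continuous h -> (forall x, `|h x| <= B) ->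
  mu.-integrable [set: R] (EFin \o h).
Proof.
move=> ch hB; apply: measurable_bounded_integrable => //.
- by apply: le_lt_trans (_ : _ <= 1)%E (ltry _); exact: probability_le1.
- exact: continuous_measurable_fun.
exists B; split; first exact: num_real.
by move=> u Bu x _; apply: le_trans (hB x) (ltW Bu).
Qed.

Lemma bcont_Re f : bcont f -> mu.-integrable [set: R] (EFin \o (fun x => complex.Re (f x))).
Proof.
move=> [cf [B hB]]; apply: (@bcont_integrable _ B) => [x|x].
  by apply: cvg_comp; [exact: (cf x)|exact: continuous_Re].
exact: le_trans (ler_Re_normc _) _.
Qed.

Lemma bcont_Im f : bcont f -> mu.-integrable [set: R] (EFin \o (fun x => complex.Im (f x))).
Proof.
move=> [cf [B hB]]; apply: (@bcont_integrable _ B) => [x|x].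
  by apply: cvg_comp; [exact: (cf x)|exact: continuous_Im].
exact: le_trans (ler_Im_normc _) _.
Qed.

Lemma ExD f g : bcont f -> bcont g -> Ex (fun x => f x + g x) = Ex f + Ex g.
Proof.
move=> bf bg; apply/eqP; rewrite eq_complex ReD ImD /=; apply/andP; split; apply/eqP.
  rewrite -RintegralD //; [|exact: bcont_Re..].
  by apply: eq_Rintegral => x _; rewrite ReD.
rewrite -RintegralD //; [|exact: bcont_Im..].
by apply: eq_Rintegral => x _; rewrite ImD.
Qed.

Lemma ExZ a f : bcont f -> Ex (fun x => a * f x) = a * Ex f.
Proof.
move=> bf; have iR := bcont_Re bf; have iI := bcont_Im bf.
have iRZ r : mu.-integrable [set: R] (EFin \o (fun x => r * complex.Re (f x))).
  have := integrableZl measurableT r iR; by apply: eq_integrable => // x _; rewrite /= EFinM.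
have iIZ r : mu.-integrable [set: R] (EFin \o (fun x => r * complex.Im (f x))).
  have := integrableZl measurableT r iI; by apply: eq_integrable => // x _; rewrite /= EFinM.
apply/eqP; rewrite eq_complex ReM ImM /=; apply/andP; split; apply/eqP.
  rewrite -!RintegralZl // -RintegralB //.
  by apply: eq_Rintegral => x _; rewrite ReM.
rewrite -!RintegralZl // -RintegralD //.
by apply: eq_Rintegral => x _; rewrite ImM.
Qed.

Let Rint_cst (B : R) : \int[mu]_(x in [set: R]) B = B.
Proof.
rewrite Rintegral_cst // -[RHS]mulr1; congr (_ * _).
by rewrite -[1]/(fine 1%E); congr fine; exact: probability_setT.
Qed.

Lemma Ex_cst a : Ex (fun=> a) = a.
Proof.
by rewrite /Ex !Rint_cst; case: a.
Qed.

(** Real and imaginary parts are bounded separately, whence the factor 2. *)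
Lemma Ex_norm f (B : R) : bcont f -> (forall x, normc (f x) <= B) -> normc (Ex f) <= 2 * B.
Proof.
move=> bf fB; apply: le_trans (ler_normc_ReIm _) _ => /=.
have bound (h : R -> R) : mu.-integrable [set: R] (EFin \o h) -> (forall x, `|h x| <= B) ->
    `|\int[mu]_x h x| <= B.
  move=> ih hB; apply: le_trans (le_normr_Rintegral _ ih) _ => //.
  have -> : B = \int[mu]_(x in [set: R]) B.
    by rewrite Rint_cst.
  apply: le_Rintegral => //.
  - have := integrable_abse ih; by apply: eq_integrable.
  - by apply: (@bcont_integrable _ `|B|) => // x; exact: cvg_cst.
have h1 : `|\int[mu]_x complex.Re (f x)| <= B.
  by apply: bound => [|x]; [exact: bcont_Re|exact: le_trans (ler_Re_normc _) _].
have h2 : `|\int[mu]_x complex.Im (f x)| <= B.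
  by apply: bound => [|x]; [exact: bcont_Im|exact: le_trans (ler_Im_normc _) _].
by rewrite mulr_natl mulr2n lerD.
Qed.

Lemma Ex_Im_le f (B : R) : bcont f -> (forall x, complex.Im (f x) <= B) ->
  complex.Im (Ex f) <= B.
Proof.
move=> bf fB; have -> : B = \int[mu]_(x in [set: R]) B.
  by rewrite Rint_cst.
apply: le_Rintegral => //; first exact: bcont_Im.
by apply: (@bcont_integrable _ `|B|) => // x; exact: cvg_cst.
Qed.

End Expectation.

(** * Taylor expansions with explicit remainders *)

Section Expansions.
Variable R : realType.
Implicit Types (f g : R[i] -> R[i]) (c d : nat -> R[i]) (r k : R) (a t : R[i]).

(* [c] are the Taylor coefficients at 0 of [f] on the disc of radius [r],
   [1 / k] being a lower bound of the radius of convergence. *)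
Definition expands f c r k := forall k', k < k' -> exists2 A : R, 0 <= A &
  (forall n, normc (c n) <= A * k' ^+ n) /\
  (forall n t, normc t <= r ->
     normc (f t - \sum_(i < n) c i * t ^+ i) <= A * (k' * normc t) ^+ n).

Lemma bernoulli_le (q : R) n : 0 <= q -> 1 + n%:R * q <= (1 + q) ^+ n.
Proof.
move=> q0; elim: n => [|n IH]; first by rewrite mul0r addr0 expr0.
rewrite exprS; apply: le_trans (_ : (1 + q) * (1 + n%:R * q) <= _); last first.
  by rewrite ler_wpM2l // addr_ge0.
have := mulr_ge0 (ler0n R n) (mulr_ge0 q0 q0); rewrite -natr1; nra.
Qed.

Lemma expandsD f g c d r k : expands f c r k -> expands g d r k ->
  expands (fun t => f t + g t) (fun n => c n + d n) r k.
Proof.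
move=> ef eg k' kk'; have [A A0 [cA fA]] := ef k' kk'; have [B B0 [dB gB]] := eg k' kk'.
exists (A + B); first exact: addr_ge0.
split=> [n|n t tr]; rewrite mulrDl.
  by rewrite (le_trans (ler_normcD _ _)) // lerD.
under eq_bigr do rewrite mulrDl.
rewrite big_split /= opprD addrACA.
by rewrite (le_trans (ler_normcD _ _)) // lerD ?fA ?gB.
Qed.

(** Cauchy product. Adding up [n + 1] products of bounds at [k1] costs a factor [n + 1], absorbed by
    passing from [k1] to [k']; this loss is the reason why [expands] asks for bounds at every
    [k' > k] rather than at [k]. *)
Lemma expandsM f g c d r k : 0 <= k -> expands f c r k -> expands g d r k ->
  expands (fun t => f t * g t) (fun n => \sum_(i < n.+1) c i * d (n - i)%N) r k.
Proof.
move=> k_ge0 ef eg k' kk'; pose k1 := (k + k') / 2.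
have kk1 : k < k1 by rewrite /k1; lra.
have k1k' : k1 < k' by rewrite /k1; lra.
have k1_gt0 : 0 < k1 by lra.
have [A A0 [cA fA]] := ef k1 kk1; have [B B0 [dB gB]] := eg k1 kk1.
pose q := k' / k1 - 1.
have q0 : 0 < q by rewrite subr_gt0 ltr_pdivlMr // mul1r.
have q00 : 0 <= q := ltW q0.
have k100 : 0 <= k1 := ltW k1_gt0.
have kq : k' = k1 * (1 + q) by rewrite /q; field; rewrite gt_eqF.
(* Bernoulli's inequality for [k' / k1 = 1 + q]. *)
have grow n : n.+1%:R * k1 ^+ n <= (1 + q^-1) * k' ^+ n.
  have -> : (1 + q^-1) * k' ^+ n = k1 ^+ n * ((1 + q^-1) * (1 + q) ^+ n).
    by rewrite [X in _ * X ^+ _ = _]kq exprMn mulrCA.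
  rewrite mulrC ler_wpM2l ?exprn_ge0 ?(ltW k1_gt0) //.
  apply: le_trans (_ : (1 + q^-1) * (1 + n%:R * q) <= _); last first.
    by apply: ler_wpM2l; [rewrite addr_ge0 ?invr_ge0|exact: bernoulli_le].
  have -> : (1 + q^-1) * (1 + n%:R * q) = n.+1%:R + n%:R * q + q^-1.
    by rewrite -natr1; field; rewrite gt_eqF.
  by rewrite -addrA lerDl addr_ge0 ?mulr_ge0 ?invr_ge0.
exists (A * B * (1 + q^-1)).
  by rewrite !mulr_ge0 // addr_ge0 // invr_ge0.
split=> [n|n t tr].
  apply: le_trans (ler_normc_sum _ _ _) _.
  apply: (@le_trans _ _ (\sum_(i < n.+1) A * B * k1 ^+ n)).
    apply: ler_sum => i _; rewrite normcM.
    have -> : A * B * k1 ^+ n = (A * k1 ^+ i) * (B * k1 ^+ (n - i)).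
      by rewrite mulrACA -exprD subnKC // -ltnS.
    by apply: ler_pM; rewrite ?normc_ge0.
  rewrite sumr_const card_ord -mulr_natl mulrCA -[leRHS]mulrA.
  by rewrite ler_wpM2l ?mulr_ge0.
have PE : \sum_(m < n) (\sum_(i < m.+1) c i * d (m - i)%N) * t ^+ m =
    \sum_(i < n) c i * t ^+ i * (\sum_(j < n - i) d j * t ^+ j).
  elim: (n) => [|m IH]; first by rewrite !big_ord0.
  rewrite big_ord_recr IH /= [RHS]big_ord_recr /= subSnn big_ord_recr /= big_ord_recl /=.
  under [in RHS]eq_bigr => i _.
    have -> : (m.+1 - i = (m - i).+1)%N by rewrite subSn // ltnW.
    rewrite big_ord_recr mulrDr /=.
    over.
  rewrite big_split /= -addrA; congr (_ + _).
  rewrite mulrDl mulr_suml; congr (_ + _); last first.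
    by rewrite subnn big_ord0 addr0 expr0 mulr1 mulrAC.
  apply: eq_bigr => i _; rewrite mulrACA -exprD subnKC //.
  exact: ltnW.
set s := k1 * normc t.
have s0 : 0 <= s by rewrite mulr_ge0 ?normc_ge0 // ltW.
have tot : normc (f t * g t - \sum_(m < n) (\sum_(i < m.+1) c i * d (m - i)%N) * t ^+ m) <=
    n.+1%:R * (A * B * s ^+ n).
  (* The remainder of the product is the remainder of [f] times [g], plus each term of [f] times the
     remainder of [g] of complementary order. *)
  have -> : f t * g t - \sum_(m < n) (\sum_(i < m.+1) c i * d (m - i)%N) * t ^+ m =
     (f t - \sum_(i < n) c i * t ^+ i) * g t +
     \sum_(i < n) c i * t ^+ i * (g t - \sum_(j < n - i) d j * t ^+ j).
    have -> : \sum_(i < n) c i * t ^+ i * (g t - \sum_(j < n - i) d j * t ^+ j) =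
        \sum_(i < n) c i * t ^+ i * g t -
        \sum_(i < n) c i * t ^+ i * \sum_(j < n - i) d j * t ^+ j.
      by rewrite -sumrB; apply: eq_bigr => i _; rewrite mulrBr.
    by rewrite PE mulrBl mulr_suml addrA subrK.
  apply: le_trans (ler_normcD _ _) _.
  rewrite -natr1 [leRHS]mulrDl mul1r [leLHS]addrC; apply: lerD; last first.
    have := gB 0%N t tr; rewrite big_ord0 subr0 expr0 mulr1 => g0.
    rewrite normcM mulrAC; apply: ler_pM; rewrite ?normc_ge0 //.
    exact: fA.
  apply: le_trans (ler_normc_sum _ _ _) _.
  apply: (@le_trans _ _ (\sum_(i < n) A * B * s ^+ n)); last first.
    by rewrite sumr_const card_ord mulr_natl.
  apply: ler_sum => i _; rewrite 2!normcM normcX.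
  have -> : A * B * s ^+ n = (A * s ^+ i) * (B * s ^+ (n - i)).
    by rewrite mulrACA -exprD subnKC // ltnW.
  apply: ler_pM; rewrite ?mulr_ge0 ?exprn_ge0 ?normc_ge0 ?gB //.
  by rewrite /s exprMn mulrA ler_wpM2r ?exprn_ge0 ?normc_ge0.
apply: le_trans tot _; rewrite mulrCA -[leRHS]mulrA ler_wpM2l ?mulr_ge0 //.
rewrite /s [(k1 * _) ^+ n]exprMn [(k' * _) ^+ n]exprMn !mulrA.
by rewrite ler_wpM2r ?exprn_ge0 ?normc_ge0.
Qed.

Lemma expands_cst a r k : 0 <= k -> expands (fun=> a) (fun n => if n is 0 then a else 0) r k.
Proof.
move=> k0 k' kk'; exists (normc a); first exact: normc_ge0.
split=> [[|n]|[|n] t tr]; rewrite ?expr0 ?mulr1 //.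
- by rewrite normc0 mulr_ge0 ?normc_ge0 // exprn_ge0 //; lra.
- by rewrite big_ord0 subr0.
rewrite big_ord_recl big1 ?addr0 => [|i _]; last by rewrite /= mul0r.
by rewrite expr0 mulr1 subrr normc0 mulr_ge0 ?normc_ge0 // exprn_ge0 // mulr_ge0 ?normc_ge0 //; lra.
Qed.

Lemma expands_id r k : 0 <= k -> 0 <= r -> expands id (fun n => (n == 1)%:R) r k.
Proof.
move=> k0 r0 k' kk'; have k'0 : 0 < k' by lra.
exists (r + k'^-1); first by rewrite addr_ge0 // invr_ge0 ltW.
have Ak : 1 <= (r + k'^-1) * k' by rewrite mulrDl mulVf ?gt_eqF // lerDr mulr_ge0 // ltW.
split=> [[|[|n]]|[|[|n]] t tr].
- by rewrite normc0 mulr_ge0 ?exprn_ge0 ?addr_ge0 ?invr_ge0 // ltW.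
- by rewrite normc1 expr1.
- by rewrite normc0 mulr_ge0 ?exprn_ge0 ?addr_ge0 ?invr_ge0 // ltW.
- by rewrite big_ord0 subr0 expr0 mulr1 (le_trans tr) // lerDl invr_ge0 ltW.
- rewrite big_ord_recl big_ord0 /= mul0r addr0 subr0 expr1 mulrA.
  by rewrite ler_peMl ?normc_ge0.
rewrite big_ord_recl big_ord_recl big1 => [|i _]; last by rewrite /= mul0r.
rewrite /= mul0r add0r mul1r expr1 addr0 subrr normc0.
by rewrite mulr_ge0 ?exprn_ge0 ?addr_ge0 ?mulr_ge0 ?normc_ge0 ?invr_ge0 // ltW.
Qed.

Lemma expands_ext f g c d r k : f =1 g -> c =1 d -> expands f c r k -> expands g d r k.
Proof. by move=> /funext -> /funext ->. Qed.

Lemma expandsZ a f c r k : 0 <= k -> expands f c r k ->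
  expands (fun t => a * f t) (fun n => a * c n) r k.
Proof.
move=> k0 ef; apply: expands_ext (expandsM k0 (expands_cst a r k0) ef) => // n.
by rewrite big_ord_recl big1 ?addr0 ?subn0 // => i _; rewrite mul0r.
Qed.

Lemma expands_mul_id f c r k : 0 <= k -> 0 <= r -> expands f c r k ->
  expands (fun t => t * f t) (fun n => if n is m.+1 then c m else 0) r k.
Proof.
move=> k0 r0 ef; apply: expands_ext (expandsM k0 (expands_id k0 r0) ef) => // -[|n].
  by rewrite big_ord1 mul0r.
rewrite big_ord_recl mul0r add0r big_ord_recl mul1r big1 ?addr0.
  by rewrite /bump /= subn1.
by move=> i _; rewrite mul0r.
Qed.

Lemma expandsX f c r k n : 0 <= k -> expands f c r k ->
  exists d, expands (fun t => f t ^+ n) d r k.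
Proof.
move=> k0 ef; elim: n => [|n [d IH]].
  by exists (fun n => if n is 0 then 1 else 0); exact: expands_cst.
exists (fun m => \sum_(i < m.+1) c i * d (m - i)%N).
by apply: expands_ext (expandsM k0 ef IH) => // t; rewrite exprS.
Qed.

Lemma expands_sum (n : nat) (f : nat -> R[i] -> R[i]) (c : nat -> nat -> R[i]) r k : 0 <= k ->
  (forall i, expands (f i) (c i) r k) ->
  expands (fun t => \sum_(i < n) f i t) (fun m => \sum_(i < n) c i m) r k.
Proof.
move=> k0 ef; elim: n => [|n IH].
  by apply: expands_ext (expands_cst 0 r k0) => [t|[|m]]; rewrite big_ord0.
by apply: expands_ext (expandsD IH (ef n)) => [t|m]; rewrite big_ord_recr.
Qed.

(** Uniqueness of Taylor coefficients: once those before [n] vanish, dividing the remainder estimate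
    of order [n + 1] by [s^n] bounds [c n] by a multiple of [s], for arbitrarily small real [s]. *)
Lemma expands_eq0 f c r k (r0 : R) : 0 < r0 -> r0 <= r -> 0 <= k -> expands f c r k ->
  (forall t, t != 0 -> normc t <= r0 -> f t = 0) -> forall n, c n = 0.
Proof.
move=> r00 r0r k0 ef f0; have [A A0 [_ fA]] := ef (k + 1) ltac:(by rewrite ltrDl).
elim/ltn_ind => n IH; apply/eqP; rewrite -normc_eq0 eq_le normc_ge0 andbT.
have h (s : R) : 0 < s -> s <= r0 -> normc (c n) <= A * (k + 1) ^+ n.+1 * s.
  move=> s0 sr; have sn0 : s%:C%C != 0 :> R[i] by rewrite fmorph_eq0 gt_eqF.
  have ns : normc s%:C%C = s by rewrite normc_real gtr0_norm.
  have := fA n.+1 s%:C%C; rewrite ns (le_trans sr r0r) => /(_ isT).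
  rewrite f0 ?ns // big_ord_recr big1 /= => [|i _]; last by rewrite IH ?mul0r.
  rewrite !add0r normcNE normcM normcX ns exprMn [s ^+ n.+1]exprS !mulrA => hs.
  have sp : 0 < s ^+ n by rewrite exprn_gt0.
  by rewrite -(ler_pM2r sp).
apply/ler_addgt0Pr => e e0; rewrite add0r.
pose B := A * (k + 1) ^+ n.+1; have B0 : 0 <= B by rewrite mulr_ge0 // exprn_ge0 // addr_ge0.
have B1 : 0 < B + 1 by lra.
pose s := Num.min r0 (e / (B + 1)).
have s0 : 0 < s by rewrite lt_min r00 divr_gt0.
have := h s s0; rewrite ge_min lexx => /(_ isT) /le_trans; apply.
have : s <= e / (B + 1) by rewrite ge_min lexx orbT.
rewrite ler_pdivlMr // => hs; rewrite -/B; have := ltW s0; nra.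
Qed.

(** For some [k' > k] still [k' |t| < 1], and the remainder bound tends to 0. With [expands_eq0]
    this is an identity theorem: vanishing near 0 spreads to all [t] with [|t| <= r] and
    [k |t| < 1]. *)
Lemma expands0_eq0 f c r k t : 0 <= k -> expands f c r k -> (forall n, c n = 0) ->
  normc t <= r -> k * normc t < 1 -> f t = 0.
Proof.
move=> k0 ef c0 tr kt; pose k' := k + (1 - k * normc t) / (2 * (normc t + 1)).
have t0 := normc_ge0 t.
have d0 : 0 < (1 - k * normc t) / (2 * (normc t + 1)) by rewrite divr_gt0 //; lra.
have k'1 : k' * normc t < 1.
  have : (1 - k * normc t) / (2 * (normc t + 1)) * normc t <= (1 - k * normc t) / 2.
    rewrite invfM mulrA -mulrA ler_piMr ?divr_ge0 //; try lra.
    by rewrite mulrC ler_pdivrMr; lra.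
  by rewrite /k' mulrDl; lra.
have [A A0 [_ fA]] := ef k' ltac:(by rewrite ltrDl).
set q := k' * normc t in k'1.
have q0 : 0 <= q by rewrite mulr_ge0 // /k'; lra.
apply/eqP; rewrite -normc_eq0 eq_le normc_ge0 andbT.
have h n : normc (f t) <= A * q ^+ n.
  have := fA n t tr; rewrite big1 ?subr0 // => i _.
  by rewrite c0 mul0r.
have cq : (fun n => A * q ^+ n) @ \oo --> (0 : R).
  rewrite -(mulr0 A); apply: cvgM; first exact: cvg_cst.
  by apply: cvg_expr; rewrite ger0_norm.
have c1 : (fun _ : nat => normc (f t)) @ \oo --> normc (f t) by exact: cvg_cst.
by apply: (ler_cvg_to c1 cq); exact: nearW.
Qed.

End Expansions.

(** * The Cauchy transform of a measure with given free cumulants *)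

Section CauchyTransform.
Variables (R : realType) (mu : probability (measurableTypeR R) R).
Variables (p : nat) (kappa : nat -> R) (M : R).
Hypotheses (kappa_eq0 : forall n, (p < n)%N -> kappa n = 0) (M_gt0 : 0 < M)
  (mu_supp : mu (~` `[(- M), M]%classic) = 0%E) (mu_cum : is_free_cumulants mu kappa).
Implicit Types (u v : R -> R[i]) (w z h t : R[i]).
Notation E := (Ex mu).

(** Finite geometric sum with its exact remainder under the integral. It serves at infinity, with
    [u = 1] and [v = clipC], and around a point [Y], with [u = 1 / (Y - clipC)] and [v = - u]. *)
Lemma expands_geometric u v (k r : R) : bcont u -> bcont v -> (forall x, normc (v x) <= k) ->
  0 <= k -> 0 <= r -> r * k < 1 ->
  expands (fun h => E (fun x => u x / (1 - h * v x))) (fun i => E (fun x => u x * v x ^+ i)) r k.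
Proof.
move=> bu bv vk k0 r0 rk k' kk'; have [_ [U hU]] := bu.
have U0 : 0 <= U by apply: le_trans (hU 0); exact: normc_ge0.
have d0 : 0 < 1 - r * k by rewrite subr_gt0.
have den h x : normc h <= r -> 1 - r * k <= normc (1 - h * v x).
  move=> hr; apply: le_trans (lerB_normc _ _); rewrite normc1 normcM lerD2l lerN2.
  by apply: ler_pM; rewrite ?normc_ge0.
have bden h : normc h <= r -> bcont (fun x => (1 - h * v x)^-1).
  move=> hr; apply: (bcontV d0) => [x|]; first exact: den.
  have := bcontD (bcont_cst 1) (bcontM (bcont_cst (- h)) bv).
  by congr bcont; apply/funext => x; rewrite mulNr.
have bRn h n : normc h <= r -> bcont (fun x => u x * v x ^+ n / (1 - h * v x)).
  by move=> hr; apply: bcontM; [apply: bcontM => //; exact: bcontX|exact: bden].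
pose Rn h n := E (fun x => u x * v x ^+ n / (1 - h * v x)).
have RnE h n : normc h <= r -> E (fun x => u x / (1 - h * v x)) =
    \sum_(i < n) E (fun x => u x * v x ^+ i) * h ^+ i + h ^+ n * Rn h n.
  move=> hr; elim: n => [|n IH].
    rewrite big_ord0 add0r expr0 mul1r /Rn; congr E; apply/funext => x.
    by rewrite expr0 mulr1.
  rewrite IH big_ord_recr /= -addrA; congr (_ + _).
  have den0 x : 1 - h * v x != 0 by rewrite -normc_gt0 (lt_le_trans d0) ?den.
  have -> : Rn h n = E (fun x => u x * v x ^+ n) + h * Rn h n.+1.
    have hZ : E (fun x => h * (u x * v x ^+ n.+1 / (1 - h * v x))) = h * Rn h n.+1.
      by apply: ExZ; exact: bRn.
    have bX : bcont (fun x => u x * v x ^+ n) by apply: bcontM => //; exact: bcontX.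
    have bh : bcont (fun x => h * (u x * v x ^+ n.+1 / (1 - h * v x))).
      by apply: bcontM; [exact: bcont_cst|exact: bRn].
    rewrite -hZ -(ExD mu bX bh) /Rn; congr E; apply/funext => x; rewrite exprS.
    by field; rewrite den0.
  by rewrite exprS; ring.
have kn n : k ^+ n <= k' ^+ n by rewrite lerXn2r ?nnegrE //; lra.
have un x n : normc (u x * v x ^+ n) <= U * k ^+ n.
  rewrite normcM normcX; apply: ler_pM; rewrite ?exprn_ge0 ?normc_ge0 //.
  by rewrite lerXn2r ?nnegrE ?normc_ge0.
pose A := 2 * U / (1 - r * k).
have A0 : 0 <= A by rewrite divr_ge0 ?mulr_ge0 // ltW.
exists A => //; split=> [n|n h hr].
  apply: le_trans (_ : 2 * (U * k ^+ n) <= _).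
    by apply: Ex_norm => [|x]; [apply: bcontM => //; exact: bcontX|exact: un].
  rewrite mulrA; apply: le_trans (_ : A * k ^+ n <= _); last by rewrite ler_wpM2l.
  rewrite ler_wpM2r ?exprn_ge0 // /A ler_pdivlMr // ler_piMr ?mulr_ge0 //.
  by rewrite gerBl mulr_ge0.
rewrite (RnE h n hr) addrC addKr normcM normcX exprMn mulrC mulrA.
rewrite ler_wpM2r ?exprn_ge0 ?normc_ge0 //.
apply: le_trans (_ : A * k ^+ n <= _); last by rewrite ler_wpM2l.
have -> : A * k ^+ n = 2 * (U * k ^+ n / (1 - r * k)) by rewrite /A; ring.
apply: Ex_norm => [|x]; first exact: bRn.
rewrite normcf_div; apply: ler_pM; rewrite ?invr_ge0 ?normc_ge0 //.
rewrite lef_pV2 ?posrE ?den //.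
by apply: lt_le_trans (den h x hr).
Qed.

(** Equal to [x] almost everywhere for [mu], and bounded on the whole line, so that the integrands
    below are bounded and continuous everywhere. *)
Definition clip (x : R) : R := Num.max (- M) (Num.min M x).
Definition clipC (x : R) : R[i] := (clip x)%:C%C.

Lemma clip_le x : `|clip x| <= M.
Proof.
have MM : - M <= M by have := M_gt0; lra.
by rewrite ler_norml /clip le_max lexx ge_max MM ge_min lexx.
Qed.

Lemma clip_continuous : continuous clip.
Proof.
move=> x; apply: (@continuous_max _ _ (cst (- M)) (fun x => Num.min M x)); first exact: cvg_cst.
by apply: (@continuous_min _ _ (cst M) id); [exact: cvg_cst|exact: cvg_id].
Qed.

Lemma bcont_clipC : bcont clipC.
Proof.
split; last by exists M => x; rewrite normc_real clip_le.
by move=> x; apply: cvg_comp; [exact: clip_continuous|exact: continuous_realC].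
Qed.

Lemma moment_raney n : E (fun x => clipC x ^+ n) = (raney kappa n.+1 1)%:C%C.
Proof.
case: n => [|n].
  have -> : (fun x => clipC x ^+ 0) = (fun=> 1) by apply/funext => x; rewrite expr0.
  by rewrite Ex_cst raneySS big_ord1 raney00 mulr1.
have mn : (\int[mu]_x (clip x ^+ n.+1)%:E)%E = (raney kappa n.+2 1)%:E.
  rewrite -noncrossing_sum // -mu_cum //.
  have cX : continuous (fun x => clip x ^+ n.+1).
    move=> x; apply: (@cvg_comp _ _ _ clip (fun y => y ^+ n.+1)); first exact: clip_continuous.
    exact: exprn_continuous.
  apply: ae_eq_integral => //.
  - apply/measurable_EFinP; exact: continuous_measurable_fun cX.
  - apply/measurable_EFinP; exact: exprn_measurable.
  exists (~` `[(- M), M]%classic); split; [|exact: mu_supp|].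
    by apply: measurableC; exact: measurable_itv.
  move=> x /= nx Dx; apply: nx => _; move: Dx; rewrite in_itv /= => /andP[x1 x2].
  by rewrite /clip min_r // max_r.
have XR : (fun x => complex.Re (clipC x ^+ n.+1)) = (fun x => clip x ^+ n.+1).
  by apply/funext => x; rewrite /clipC -rmorphXn.
have XI : (fun x => complex.Im (clipC x ^+ n.+1)) = (fun=> 0).
  by apply/funext => x; rewrite /clipC -rmorphXn.
rewrite /Ex XR XI /Rintegral mn /= integral0 /=.
by [].
Qed.

Definition cauchyG w : R[i] := E (fun x => (w - clipC x)^-1).

(** Equal to [g (H (1 / g) - w)] for [g != 0], but polynomial in [g], hence within reach of
    [expands]. *)
Definition curve_eq w (g : R[i]) := \sum_(n < p.+1) (cum1 kappa n)%:C%C * g ^+ n - w * g.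

(* The functional equation at infinity: [raney kappa n k] are the Taylor
   coefficients of [G(1 / t)^k]. *)
Lemma curve_eq_far w : 2 * M <= normc w -> curve_eq w (cauchyG w) = 0.
Proof.
have M0 := M_gt0 => wM; have w0 : w != 0 by rewrite -normc_gt0; lra.
pose r := (2 * M)^-1; have r0 : 0 < r by rewrite invr_gt0; lra.
have rM : r * M < 1 by rewrite /r invfM mulfVK ?gt_eqF //; lra.
pose e t := E (fun x => 1 / (1 - t * clipC x)).
have ee : expands e (fun n => (raney kappa n.+1 1)%:C%C) r M.
  apply: expands_ext (expands_geometric (bcont_cst 1) bcont_clipC _ (ltW M_gt0) (ltW r0) rM) => //.
    by move=> n; under eq_fun do rewrite mul1r; exact: moment_raney.
  by move=> x; rewrite normc_real clip_le.
have Ml := ltW M_gt0; have rl := ltW r0.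
have eg : expands (fun t => t * e t) (fun n => (raney kappa n 1)%:C%C) r M.
  by apply: expands_ext (expands_mul_id Ml rl ee) => // -[|n].
have egX k : expands (fun t => (t * e t) ^+ k) (fun n => (raney kappa n k)%:C%C) r M.
  elim: k => [|k IH].
    apply: expands_ext (expands_cst 1 r (ltW M_gt0)) => [t|[|n]].
    - by rewrite expr0.
    - by rewrite raney00.
    - by rewrite raneyS0.
  apply: expands_ext (expandsM (ltW M_gt0) IH eg) => [t|n]; first by rewrite exprSr.
  by rewrite -[k.+1]addn1 raneyD rmorph_sum; apply: eq_bigr => i _; rewrite rmorphM.
have esum := expands_sum p.+1 Ml (fun k => expandsZ (cum1 kappa k)%:C%C Ml (egX k)).
(* The equation divided by [w]: with [t = 1 / w] and [g = t e(t)] it reads [t C(g) - g = 0], and its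
   coefficients vanish by the recursion for [raney kappa n.+1 1]. *)
have ef := expandsD (expands_mul_id Ml rl esum) (expandsZ (-1) Ml eg).
have tr : normc w^-1 <= r by rewrite normcV /r lef_pV2 ?posrE //; lra.
have kt : M * normc w^-1 < 1.
  by rewrite normcV ltr_pdivrMr ?mul1r; lra.
have c0 : forall n, (if n is m.+1 then \sum_(k < p.+1) (cum1 kappa k)%:C%C * (raney kappa m k)%:C%C
    else 0) + -1 * (raney kappa n 1)%:C%C = 0.
  case=> [|n]; first by rewrite raney0S mulr0 addr0.
  rewrite mulN1r (@raneySS_ge _ _ (n.+1 + p.+1)%N) ?rmorph_sum; last by rewrite ltn_addr.
  apply/eqP; rewrite subr_eq0; apply/eqP.
  rewrite (big_ord_widen (n.+1 + p.+1)
    (fun k => (cum1 kappa k)%:C%C * (raney kappa n k)%:C%C) (leq_addl n.+1 p.+1)).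
  rewrite big_mkcond; apply: eq_bigr => k _; rewrite add0n rmorphM; case: ifP => //.
  rewrite ltnS => /negbT; rewrite -ltnNge => pk.
  suff -> : cum1 kappa k = 0 by rewrite mul0r.
  by case: (nat_of_ord k) pk => // k' pk; rewrite /= kappa_eq0.
have := expands0_eq0 Ml ef c0 tr kt; rewrite /curve_eq.
have -> : w^-1 * e w^-1 = cauchyG w.
  rewrite /e /cauchyG -ExZ.
    congr E; apply/funext => x; rewrite mul1r -invfM mulrBr mulr1 mulrA divff // mul1r.
    by [].
  have : bcont (fun x => (1 - w^-1 * clipC x)^-1).
    apply: (@bcontV _ _ (1 / 2)) => [|x|]; first by rewrite divr_gt0.
      apply: le_trans (lerB_normc _ _); rewrite normc1 normcM normc_real.
      have : normc w^-1 * `|clip x| <= r * M by apply: ler_pM; rewrite ?normc_ge0 ?clip_le.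
      by rewrite /r invfM mulfVK ?gt_eqF //; lra.
    have := bcontD (bcont_cst 1) (bcontM (bcont_cst (- w^-1)) bcont_clipC).
    by congr bcont; apply/funext => x; rewrite mulNr.
  by congr bcont; apply/funext => x; rewrite mul1r.
by move=> h; apply: (mulfI (invr_neq0 w0)); rewrite mulr0 mulrBr mulKf // -mulN1r.
Qed.

(** Expand [G] around [Y = i y]. The equation holds on the unit disc around [Y] by [curve_eq_far],
    and the expansion is valid at distances below [y], since the real line is at distance [y] from
    [Y]; [y] is chosen so that this reaches [w]. *)
Lemma curve_eq_upper w : 0 < complex.Im w -> curve_eq w (cauchyG w) = 0.
Proof.
have M0 := M_gt0 => w0.
(* [|w - Y|^2 = |w|^2 - 2 y Im w + y^2] is below [y^2] once [2 y Im w > |w|^2]; the summand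
   [2 * M + 2] keeps the unit disc around [Y] where [curve_eq_far] applies. *)
pose y := 2 * M + 2 + normc w ^+ 2 / complex.Im w.
have yM : 2 * M + 2 <= y by rewrite /y lerDl divr_ge0 ?exprn_ge0 ?normc_ge0 // ltW.
have y0 : 0 < y by lra.
pose Y : R[i] := (0 +i* y)%C.
have YN : normc Y = y by rewrite /normc /= expr0n /= add0r sqrtr_sqr gtr0_norm.
have wY : normc (w - Y) < y.
  rewrite -(ltr_pXn2r (n := 2)) ?nnegrE ?normc_ge0 ?(ltW y0) // normcE_sqr ReB ImB /= subr0.
  have : normc w ^+ 2 < 2 * complex.Im w * y.
    have -> : 2 * complex.Im w * y = 2 * complex.Im w * (2 * M + 2) + 2 * normc w ^+ 2.
      by rewrite /y; field; rewrite gt_eqF.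
    have := sqr_ge0 (normc w); have : 0 < complex.Im w * M by rewrite mulr_gt0.
    lra.
  by rewrite normcE_sqr; lra.
have YC x : y <= normc (Y - clipC x).
  apply: le_trans (ler_Im_normc _); rewrite ImB /= subr0.
  exact: ler_norm.
have YC0 x : Y - clipC x != 0 by rewrite -normc_gt0 (lt_le_trans y0).
pose u x := (Y - clipC x)^-1.
have bu : bcont u.
  apply: (bcontV y0 YC).
  have := bcontD (bcont_cst Y) (bcontM (bcont_cst (-1)) bcont_clipC).
  by congr bcont; apply/funext => x; rewrite mulN1r.
have bv : bcont (fun x => - u x).
  have := bcontM (bcont_cst (-1)) bu.
  by congr bcont; apply/funext => x; rewrite mulN1r.
pose k := y^-1; pose r := Num.max (normc (w - Y)) 1.
have k0 : 0 <= k by rewrite invr_ge0 ltW.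
have r1 : 1 <= r by rewrite le_max lexx orbT.
have r0 : 0 <= r by lra.
have rk : r * k < 1 by rewrite ltr_pdivrMr // mul1r gt_max wY /=; lra.
have vk x : normc (- u x) <= k.
  by rewrite normcNE normcV lef_pV2 ?posrE // (lt_le_trans y0).
pose G h := cauchyG (Y + h).
have eG : expands G (fun i => E (fun x => u x * (- u x) ^+ i)) r k.
  apply: expands_ext (expands_geometric bu bv vk k0 r0 rk) => // h.
  congr E; apply/funext => x; rewrite /u mulrN opprK.
  have -> : 1 + h / (Y - clipC x) = (Y + h - clipC x) / (Y - clipC x).
    by rewrite addrAC mulrDl divff.
  by rewrite invfM invrK mulrCA mulVf ?mulr1.
have /choice[d hd] n := expandsX n k0 eG.
have esum := expands_sum p.+1 k0 (fun n => expandsZ (cum1 kappa n)%:C%C k0 (hd n)).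
have ewG := expandsD (expandsZ Y k0 eG) (expands_mul_id k0 r0 eG).
have ef := expandsD esum (expandsZ (-1) k0 ewG).
have fE h : \sum_(n < p.+1) (cum1 kappa n)%:C%C * G h ^+ n + -1 * (Y * G h + h * G h) =
    curve_eq (Y + h) (G h).
  by rewrite /curve_eq mulN1r mulrDl.
have c0 := expands_eq0 ltr01 r1 k0 ef.
have := expands0_eq0 (t := w - Y) k0 ef (c0 _).
have YwY : Y + (w - Y) = w by rewrite addrC subrK.
rewrite fE /G YwY; apply.
- move=> h _ h1; rewrite fE; apply: curve_eq_far.
  have := lerB_normcD Y h; rewrite YN; lra.
- by rewrite le_max lexx.
- by rewrite mulrC ltr_pdivrMr // mul1r.
Qed.

Lemma Im_le_clipC w x : complex.Im w <= normc (w - clipC x).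
Proof. by apply: le_trans (ler_Im_normc _); rewrite ImB /= subr0 ler_norm. Qed.

Lemma bcont_resolvent w : 0 < complex.Im w -> bcont (fun x => (w - clipC x)^-1).
Proof.
move=> w0; apply: (bcontV w0) => [x|]; first exact: Im_le_clipC.
have := bcontD (bcont_cst w) (bcontM (bcont_cst (-1)) bcont_clipC).
by congr bcont; apply/funext => x; rewrite mulN1r.
Qed.

Lemma Im_cauchyG w : 0 < complex.Im w -> complex.Im (cauchyG w) < 0.
Proof.
have M0 := M_gt0 => w0; have wM : 0 < normc w + M by rewrite ltr_wpDl ?normc_ge0.
apply: (@le_lt_trans _ _ (- complex.Im w / (normc w + M) ^+ 2)); last first.
  by rewrite mulNr oppr_lt0 divr_gt0 // exprn_gt0.
apply: Ex_Im_le => [|x]; first exact: bcont_resolvent.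
have d0 := lt_le_trans w0 (Im_le_clipC w x).
rewrite ImV ImB /= subr0 !mulNr lerN2 ler_pM2l //.
rewrite lef_pV2 ?posrE ?exprn_gt0 //.
rewrite lerXn2r ?nnegrE ?normc_ge0 ?(ltW wM) //.
by apply: le_trans (ler_normcB _ _) _; rewrite normc_real lerD2l clip_le.
Qed.

Lemma cauchyG_neq0 w : 0 < complex.Im w -> cauchyG w != 0.
Proof. by move=> /Im_cauchyG; apply: contraTneq => ->; rewrite ltxx. Qed.

Lemma normc_cauchyG w : 0 < complex.Im w -> M < normc w ->
  normc (cauchyG w) <= 2 / (normc w - M).
Proof.
move=> w0 wM; have wM0 : 0 < normc w - M by rewrite subr_gt0.
apply: Ex_norm => [|x]; first exact: bcont_resolvent.
have d : normc w - M <= normc (w - clipC x).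
  by apply: le_trans (lerB_normc _ _); rewrite lerD2l lerN2 normc_real clip_le.
by rewrite normcV lef_pV2 ?posrE // (lt_le_trans wM0).
Qed.

(** Resolvent identity: the difference of two resolvents is their product times the difference of
    the points. *)
Lemma normc_cauchyGB w w' : 0 < complex.Im w -> 0 < complex.Im w' ->
  normc (cauchyG w' - cauchyG w) <= 2 / (complex.Im w * complex.Im w') * normc (w' - w).
Proof.
move=> w0 w'0; have bw := bcont_resolvent w0; have bw' := bcont_resolvent w'0.
have bb := bcontM bw bw'.
have -> : cauchyG w' = cauchyG w +
    (w - w') * E (fun x => (w - clipC x)^-1 * (w' - clipC x)^-1).
  rewrite -(ExZ mu _ bb) -(ExD mu bw (bcontM (bcont_cst _) bb)).
  congr E; apply/funext => x.
  have d0 : w - clipC x != 0 by rewrite -normc_gt0 (lt_le_trans w0) ?Im_le_clipC.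
  have d'0 : w' - clipC x != 0 by rewrite -normc_gt0 (lt_le_trans w'0) ?Im_le_clipC.
  have -> : w - w' = (w - clipC x) - (w' - clipC x) by ring.
  by move: (w - _) (w' - _) d0 d'0 => a b a0 b0; field; rewrite ?a0 ?b0.
rewrite addrC addKr normcM mulrC (normc_distC w) ler_wpM2r ?normc_ge0 //.
apply: Ex_norm => // x; rewrite normcM !normcV invfM.
by apply: ler_pM; rewrite ?invr_ge0 ?normc_ge0 // lef_pV2 ?posrE ?Im_le_clipC //;
  apply: lt_le_trans (Im_le_clipC _ _).
Qed.

Lemma Hf_invG w : 0 < complex.Im w -> Hf p kappa (cauchyG w)^-1 = w.
Proof.
move=> w0; have g0 := cauchyG_neq0 w0; have := curve_eq_upper w0; rewrite /curve_eq.
move: (cauchyG w) g0 => g g0 /eqP; rewrite subr_eq0 => /eqP h.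
apply: (mulIf g0); rewrite -h big_ord_recl /= expr0 mulr1 /Hf /phi mulrDl mulVf //.
congr (_ + _); rewrite big_add1 /= big_mkord mulr_suml; apply: eq_bigr => i _.
by rewrite /= exprVn invrK exprSr mulrA.
Qed.

(** [F = 1 / G]. The local Lipschitz bound comes from the resolvent identity and stands in for
    differentiability: it forbids [H] to be critical at [F w]. *)
Lemma right_inverse_exists : exists F : R[i] -> R[i],
  [/\ forall w, 0 < complex.Im w -> [/\ 0 < complex.Im (F w), Hf p kappa (F w) = w &
        (normc w - M) / 2 <= normc (F w)] &
      forall w, 0 < complex.Im w -> exists C d : R, [/\ 0 < C, 0 < d & forall w',
        normc (w' - w) < d -> normc (F w' - F w) <= C * normc (w' - w)]].
Proof.
exists (fun w => (cauchyG w)^-1); split=> w w0; have g0 := cauchyG_neq0 w0.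
  have gp : 0 < normc (cauchyG w) by rewrite normc_gt0.
  split; last 1 first.
  - rewrite normcV; have [wM|wM] := leP (normc w) M.
      by apply: le_trans (_ : 0 <= _); [lra|rewrite invr_ge0 ltW].
    have d0 : 0 < normc w - M by rewrite subr_gt0.
    by rewrite -invf_div lef_pV2 ?posrE ?divr_gt0 // normc_cauchyG.
  - by rewrite ImV divr_gt0 ?exprn_gt0 // oppr_gt0 Im_cauchyG.
  - exact: Hf_invG.
pose v := complex.Im w; pose g : R := normc (cauchyG w).
have gp : 0 < g by rewrite normc_gt0.
pose C := 4 / v ^+ 2.
have C0 : 0 < C by rewrite divr_gt0 ?exprn_gt0.
have C2 : 0 < 2 * C by rewrite mulr_gt0.
exists (C * (2 / g ^+ 2)), (Num.min (v / 2) (g / (2 * C))).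
split=> [||w'].
- by rewrite mulr_gt0 // divr_gt0 ?exprn_gt0.
- by rewrite lt_min !divr_gt0 // mulr_gt0.
rewrite lt_min [X in _ && X](ltr_pdivlMr _ _ C2) => /andP[wv wg].
have v' : v / 2 < complex.Im w'.
  by have := le_lt_trans (ler_Im_normc _) wv; rewrite ImB -/v ltr_norml => /andP[+ _]; lra.
have v0 : 0 < v by [].
have w'0 : 0 < complex.Im w' by lra.
have hB : normc (cauchyG w' - cauchyG w) <= C * normc (w' - w).
  apply: le_trans (normc_cauchyGB w0 w'0) _; rewrite ler_wpM2r ?normc_ge0 //.
  have -> : C = 2 / (v * (v / 2)) by rewrite /C; field; rewrite gt_eqF.
  rewrite ler_pM2l // lef_pV2 ?posrE ?mulr_gt0 ?divr_gt0 //.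
  by rewrite ler_pM2l //; lra.
have g'2 : g / 2 < normc (cauchyG w').
  by have := lerB_normc (cauchyG w) (cauchyG w'); rewrite -/g normc_distC; lra.
have g'0 := cauchyG_neq0 w'0.
have -> : (cauchyG w')^-1 - (cauchyG w)^-1 =
    - (cauchyG w' - cauchyG w) * ((cauchyG w')^-1 * (cauchyG w)^-1).
  by move: (cauchyG w) (cauchyG w') g0 g'0 => a b a0 b0; field; rewrite ?a0 ?b0.
rewrite normcM normcNE mulrAC; apply: ler_pM => //; rewrite ?normc_ge0 //.
rewrite normcM !normcV -invfM -/g.
have -> : 2 / g ^+ 2 = (g / 2 * g)^-1 by field; rewrite gt_eqF.
rewrite lef_pV2 ?posrE ?mulr_gt0 ?divr_gt0 //; last by apply: lt_trans g'2; rewrite divr_gt0.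
by rewrite ler_pM2r // ltW.
Qed.

End CauchyTransform.

(** * Necessity of the Jordan curve condition *)

Section Necessity.
Variables (R : realType) (p : nat) (kappa : nat -> R).
Hypotheses (p_ge2 : (2 <= p)%N) (kappa_p : kappa p != 0).
Implicit Types (z w a b : R[i]).

Notation H := (Hf p kappa).
Notation K := (Kf p kappa).
Notation Om := (Omega (phi p kappa)).
Notation rad := (rad p kappa).
Notation csum := (csum p kappa).

Variables (F : R[i] -> R[i]) (M : R).
Hypotheses (M_gt0 : 0 < M)
  (F_inv : forall w, 0 < complex.Im w -> [/\ 0 < complex.Im (F w), H (F w) = w &
    (normc w - M) / 2 <= normc (F w)])
  (F_lip : forall w, 0 < complex.Im w -> exists C d : R, [/\ 0 < C, 0 < d & forall w',
    normc (w' - w) < d -> normc (F w' - F w) <= C * normc (w' - w)]).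

(* [F] is a right inverse of [H] with difference quotients bounded by [C]. *)
Lemma Kf_diag_neq0 w : 0 < complex.Im w -> K (F w) (F w) != 0.
Proof.
move=> w0; have [C [d [C0 d0 hF]]] := F_lip w0; have [F0 HF _] := F_inv w0.
have Fn0 := upper_neq0 F0.
apply/eqP => K0; have [e e0 he] := @Kf_joint R p kappa (F w) (F w) C^-1 Fn0 Fn0 ltac:(by rewrite invr_gt0).
pose s := Num.min d (e / C) / 2.
have m0 : 0 < Num.min d (e / C) by rewrite lt_min d0 divr_gt0.
have s0 : 0 < s by rewrite divr_gt0.
have sm : s < Num.min d (e / C) by rewrite /s; lra.
pose w' : R[i] := w + (0 +i* s)%C.
have ww : normc (w' - w) = s.
  by rewrite /w' addrC addKr /normc /= expr0n /= add0r sqrtr_sqr gtr0_norm.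
move: sm; rewrite lt_min => /andP[sd se].
have hs := hF w'; rewrite ww in hs; have {}hs := hs sd.
have w'0 : 0 < complex.Im w' by rewrite /w' ImD /= addr_gt0.
have [F'0 HF' _] := F_inv w'0.
have := HfB p kappa (upper_neq0 F'0) Fn0; rewrite HF HF' => /(congr1 (@normc R)).
rewrite ww normcM => E.
have := he (F w') (F w); rewrite K0 subr0 subrr normc0 => /(_ _ e0) hK.
have {}hK : normc (K (F w') (F w)) < C^-1.
  by apply: hK; apply: le_lt_trans hs _; rewrite mulrC -ltr_pdivlMr.
have : s < s; last by rewrite ltxx.
rewrite {1}E; apply: le_lt_trans (_ : C * s * normc (K (F w') (F w)) < _).
  by rewrite ler_wpM2r ?normc_ge0.
rewrite mulrAC gtr_pMl //.
by rewrite mulrC -ltr_pdivlMr // div1r.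
Qed.

Lemma F_continuous w (e : R) : 0 < complex.Im w -> 0 < e ->
  exists2 d : R, 0 < d & forall w', normc (w' - w) < d -> normc (F w' - F w) < e.
Proof.
move=> w0 e0; have [C [d [C0 d0 hF]]] := F_lip w0.
exists (Num.min d (e / C)); first by rewrite lt_min d0 divr_gt0.
move=> w'; rewrite lt_min => /andP[w'd w'e]; apply: le_lt_trans (hF w' w'd) _.
by rewrite mulrC -ltr_pdivlMr.
Qed.

Lemma FH_continuous z (e : R) : Om z -> 0 < e ->
  exists2 d : R, 0 < d & forall z', normc (z' - z) < d -> normc (F (H z') - F (H z)) < e.
Proof.
move=> oz e0; have [_ Hz0] := Omega_positive oz.
have [d d0 hd] := F_continuous Hz0 e0.
have := (@continuous_normcP R _ (H : R[i]^o -> R[i]^o) z).1 (Hf_continuous (Omega_neq0 oz)) _ d0.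
by move=> /near_normcP[d' d'0 hd']; exists d' => // z' /hd' /hd.
Qed.

(** Where [F (H x) = x], the value [K x x] is not 0 by [Kf_diag_neq0]. So for [y] near [x] the
    points [F (H y)] and [y], which have the same image under [H], coincide: the set is open, and it
    is closed by continuity. *)
Lemma FH_id z : Om z -> F (H z) = z.
Proof.
have r1 := rad_ge1 p kappa; have c0 := csum_ge0 p kappa; have M0 := M_gt0.
suff : Om `<=` [set z | F (H z) = z] by exact.
apply: connected_clopen; first exact: connected_Omega.
(* [|H (i Y)| >= Y - csum = 2 rad + M], so [|F (H (i Y))| >= rad], and both points lie where [K]
   does not vanish. *)
- pose Y := 2 * rad + M + csum.
  have Y0 : 0 < Y by rewrite /Y; lra.
  have YN : normc (0 +i* Y)%C = Y by rewrite /normc /= expr0n /= add0r sqrtr_sqr gtr0_norm.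
  have Yr : rad <= normc (0 +i* Y)%C by rewrite YN /Y; lra.
  have oY : Om (0 +i* Y)%C by exact: far_Omega.
  exists (0 +i* Y)%C; split => //=.
  have [_ HY0] := Omega_positive oY; have [F0 HF FN] := F_inv HY0.
  have Fr : rad <= normc (F (H (0 +i* Y)%C)).
    apply: le_trans FN; have := Hf_near_id p kappa (le_trans r1 Yr).
    have := lerB_normc (0 +i* Y)%C (0 +i* Y - H (0 +i* Y))%C.
    have -> : ((0 +i* Y) - ((0 +i* Y) - H (0 +i* Y)))%C = H (0 +i* Y)%C by ring.
    by rewrite normc_distC YN /Y; lra.
  have /esym/eqP := HfB p kappa (upper_neq0 F0) (Omega_neq0 oY).
  rewrite HF subrr mulf_eq0 (negbTE (Kf_far_neq0 Fr Yr)) orbF subr_eq0 => /eqP.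
  by [].
- move=> x ox /= Fx; have [_ Hx0] := Omega_positive ox.
  have Kx := Kf_diag_neq0 Hx0; rewrite Fx in Kx.
  have xn0 := Omega_neq0 ox.
  have [d d0 hd] := @Kf_joint R p kappa x x (normc (K x x)) xn0 xn0 ltac:(by rewrite normc_gt0).
  have [e e0 he] := FH_continuous ox d0.
  apply/near_normcP; exists (Num.min d e); first by rewrite lt_min d0.
  move=> y; rewrite lt_min => /andP[yd ye] oy.
  have [_ Hy0] := Omega_positive oy; have [F0 HF _] := F_inv Hy0.
  have := he y ye; rewrite Fx => Fyd.
  have K0 : K (F (H y)) y != 0.
    apply/eqP => K0; have := hd _ _ Fyd yd.
    by rewrite K0 sub0r normcNE ltxx.
  have /esym/eqP := HfB p kappa (upper_neq0 F0) (Omega_neq0 oy).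
  by rewrite HF subrr mulf_eq0 (negbTE K0) orbF subr_eq0 => /eqP.
move=> x ox /closure_normcP cx /=; apply/eqP; rewrite -subr_eq0 -normc_eq0.
rewrite eq_le normc_ge0 andbT; apply/ler_addgt0Pr => e e0; rewrite add0r.
have e20 : 0 < e / 2 by rewrite divr_gt0.
have [d d0 hd] := FH_continuous ox e20.
have [y [oy /= Fy]] := cx (Num.min (e / 2) d) ltac:(by rewrite lt_min e20).
rewrite lt_min => /andP[ye yd]; have := hd y yd; rewrite Fy => h.
have -> : F (H x) - x = (y - x) - (y - F (H x)) by ring.
by apply: le_trans (ler_normcB _ _) _; lra.
Qed.

(** A real point of large modulus is the limit of far points above it, which are in Omega, without
    being in Omega: it is a boundary point. *)
Lemma far_boundary z : 0 <= complex.Im z -> rad <= normc z -> ~ boundary Om z -> Om z.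
Proof.
have r1 := rad_ge1 p kappa => z_ge0 zr nb; have [z0|z0] := ltP 0 (complex.Im z).
  exact: far_Omega.
have {}z0 : complex.Im z = 0 by apply/eqP; rewrite eq_le z0.
exfalso; apply: nb; split; last first.
  by move=> /interior_subset /Omega_positive[]; rewrite z0 ltxx.
apply/closure_normcP => e e0; exists (z + (0 +i* (e / 2))%C).
  apply: far_Omega; first by rewrite ImD /= z0 add0r divr_gt0.
  apply: le_trans zr _.
  rewrite -(ler_pXn2r (n := 2)) ?nnegrE ?normc_ge0 // !normcE_sqr ReD ImD /= z0 addr0 lerD2l.
  by rewrite expr0n /= sqr_ge0.
rewrite addrC addKr /normc /= expr0n /= add0r sqrtr_sqr gtr0_norm ?divr_gt0 //.
by rewrite ltr_pdivrMr // ltr_pMr // ltr1n.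
Qed.

Lemma FH_jordan g : jordan_curve_0_infty g -> meets_boundary g Om.
Proof.
have r1 := rad_ge1 p kappa; have c0 := csum_ge0 p kappa; have M0 := M_gt0.
move=> [cg ig g0 goo gI]; apply: contrapT => nb.
have [cg1 cg0] := (continuous_within_itvcyP 0 g).1 cg.
have nbt (t : R) : 0 < t -> ~ boundary Om (g t) by move=> t0 bt; apply: nb; exists t.
have og (t : R) : 0 < t -> Om (g t).
  move=> t0; suff : `]0, +oo[ `<=` [set t | Om (g t)] by apply; rewrite /= in_itv /= t0.
  apply: connected_locally_constant.
  - by apply/connected_intervalP/interval_is_interval.
  - have : \forall t \near +oo, 0 < t /\ rad < normc (g t).
      near=> s; split; first by near: s; apply: nbhs_pinfty_gt; exact: num_real.
      by near: s; move/cvgryPgt : goo; apply.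
    move=> /(@filter_ex _ _ _)[s [s0 sr]]; exists s; split.
      by rewrite /= in_itv /= s0.
    by apply: far_boundary => //; [apply: gI; exact: ltW|exact: ltW|exact: nbt].
  - move=> s; rewrite /= in_itv /= andbT => s0.
    have cs : {for s, continuous g} by apply: cg1; rewrite in_itv /= s0.
    (* Off the boundary a point is either interior to Omega or outside its closure, and in both
       cases membership does not change nearby. *)
    have [cl|ncl] := pselect (closure Om (g s)).
      have oi : nbhs (g s) Om by apply: contrapT => ni; apply: (nbt s s0).
      near=> u => _; split=> _; last exact: nbhs_singleton.
      by near: u; exact: cs oi.
    have [C hC CE] : exists2 C : set R[i]^o, nbhs (g s) C & forall z, C z -> ~ closure Om z.
      exists (~` closure Om); last by [].
      apply: open_nbhs_nbhs; split; [exact/closed_openC/closed_closure|exact: ncl].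
    near=> u => _.
    have ncu : ~ closure Om (g u) by apply: CE; near: u; exact: cs hC.
    split=> os; exfalso.
      exact: ncl (subset_closure os).
    exact: ncu (subset_closure os).
have kp0 : 0 < `|kappa p| by rewrite normr_gt0.
(* For [|z| < 1] and [z = F (H z)] the bound on [F] gives [|H z| <= M + 2], so [|kappa p| <= (csum +
   1) |z| + (M + 2) |z|], which the last two bounds make smaller than [|kappa p|]. *)
pose e := Num.min 1 (Num.min (`|kappa p| / (2 * (csum + 1))) (`|kappa p| / (2 * (M + 3)))).
have e0 : 0 < e by rewrite !lt_min ltr01 !divr_gt0 //; lra.
have /cvg_normcP/(_ e e0) := cg0.
rewrite g0 => ng.
have /(@filter_ex _ _ _)[t [t0 gt]] : \forall t \near 0^'+, 0 < t /\ normc (g t) < e.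
  near=> t; split; first by [].
  by rewrite -[g t]subr0; near: t; exact: ng.
move: gt; rewrite !lt_min => /and3P[g1 g2 g3].
have ot := og t t0; have zn0 := Omega_neq0 ot; have zp : 0 < normc (g t) by rewrite normc_gt0.
have [_ Hg0] := Omega_positive ot; have [_ _] := F_inv Hg0; rewrite FH_id //.
have := Hf_near0 p_ge2 kappa_p (ltW g1) zn0.
move: (g t) (H (g t)) g1 g2 g3 zn0 zp => z h g1 g2 g3 zn0 zp h1 h2.
have h3 := lerB_normc (kappa p)%:C%C (z ^+ p.-1 * h).
rewrite normc_real (normc_distC (kappa p)%:C%C) normcM normcX in h3.
move: g2 g3; rewrite !ltr_pdivlMr; [|by lra|by lra] => g2 g3.
have pE : p.-1 = p.-2.+1 by move: p_ge2; clear; case: p => [|[]].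
have h4 : normc z ^+ p.-1 * normc h <= normc z * normc h.
  rewrite ler_wpM2r ?normc_ge0 // pE exprS ler_piMr ?normc_ge0 //.
  by rewrite exprn_ile1 ?normc_ge0 // ltW.
have h5 : normc z * normc h <= normc z * (M + 2).
  by rewrite ler_pM2l //; lra.
have := mulr_gt0 zp M0; lra.
Unshelve. all: by end_near. Qed.

End Necessity.

(** Replacing [m] by the largest index of a nonzero cumulant makes the pole of [phi] at 0 of exact
    order [p - 1 >= 1]. *)
Lemma highest_cumulant (R : realType) (m : nat) (kappa : nat -> R) :
  (forall n, (m.+1 <= n)%N -> kappa n = 0) -> (exists2 n, (2 <= n <= m)%N & kappa n != 0) ->
  exists p, [/\ (2 <= p)%N, kappa p != 0, forall n, (p < n)%N -> kappa n = 0 &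
    phi m kappa = phi p kappa].
Proof.
move=> kz [n0 n0m kn0]; pose P n := (2 <= n <= m)%N && (kappa n != 0).
have exP : exists n, P n by exists n0; rewrite /P n0m.
have Pm n : P n -> (n <= m)%N by move=> /andP[/andP[]].
case: (ex_maxnP exP Pm) => p /andP[/andP[p2 pm] kp] pmax.
have kp0 n : (p < n)%N -> kappa n = 0.
  move=> pn; apply/eqP; apply: contraLR pn => kn; rewrite -leqNgt.
  have [n2|n2] := ltnP n 2; first by rewrite (leq_trans _ p2) // ltnW.
  apply: pmax; rewrite /P n2 kn andbT leqNgt; apply: contra_neqN kn; exact: kz.
exists p; split => //; apply/funext => z; rewrite /phi.
rewrite (big_cat_nat (n := p.+1)) //= [X in _ + X]big_nat_cond [X in _ + X]big1 ?addr0 // => n.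
by rewrite andbT => /andP[pn _]; rewrite kp0 // mul0r.
Qed.

Lemma compact_support_itv (R : realType) (mu : probability (measurableTypeR R) R) :
  compact_support mu -> exists2 M : R, 0 < M & mu (~` `[(- M), M]%classic) = 0%E.
Proof.
move=> [A cA A0]; have [M [_ hM]] := compact_bounded cA.
have M0 : 0 < `|M| + 1 by rewrite ltr_wpDl.
exists (`|M| + 1) => //.
have mA : measurable (A : set (measurableTypeR R)).
  by apply: closed_measurable; exact: compact_closed (@Rhausdorff R) cA.
apply: (subset_measure0 _ (measurableC mA) _ A0).
  by apply: measurableC; exact: measurable_itv.
apply: subsetC => x Ax; rewrite /= in_itv /= -ler_norml.
by apply: hM => //; rewrite (le_lt_trans (ler_norm M)) // ltrDl.
Qed.

(* phi_nonconstant is implicit in "m >= 2": when phi is constant, the Dirac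
   measure at kappa_1 has these cumulants, but Omega is the upper half-plane
   and the imaginary half-axis meets its boundary only at its end points. *)
Theorem theorem2p2 (R : realType) (m : nat) (m_ge2 : (2 <= m)%N)
    (kappa : nat -> R) (kappa_eq0 : forall n : nat, (m.+1 <= n)%N -> kappa n = 0)
    (phi_nonconstant : exists2 n : nat, (2 <= n <= m)%N & kappa n != 0) :
  (exists mu : probability (measurableTypeR R) R,
     compact_support mu /\ is_free_cumulants mu kappa)
  <->
  (forall g : R -> R[i]^o,
     jordan_curve_0_infty g -> meets_boundary g (Omega (phi m kappa))).
Proof.
have [p [p_ge2 kappa_p kappa_gt ->]] := highest_cumulant kappa_eq0 phi_nonconstant.
split=> [[mu [/compact_support_itv[M M0 supp] cum]]|jordan].
  have [F [F_inv F_lip]] := right_inverse_exists kappa_gt M0 supp cum.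
  by move=> g; exact: (FH_jordan p_ge2 kappa_p M0 F_inv F_lip).
have [F [d [L [d0 L1 F_inv F_neq0 [F_cont F_large]]]]] := inverse_exists p_ge2 kappa_p jordan.
have [mu [supp mom]] := boundary_measure p_ge2 kappa_p d0 L1 F_inv F_neq0 F_cont F_large.
(* Lagrange inversion identifies the computed moments with the noncrossing sums: both are
   [raney kappa n.+1 1]. *)
exists mu; split=> // n n0; rewrite mom noncrossing_sum //; congr EFin.
by rewrite /cf -(raney_lagrange1 kappa_gt) mulrC mulKf // pnatr_eq0.
Qed.
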